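(* Let $K$ be a connected compact set in $\mathbb R^n$, and let $\mathcal T_K=K\times i\mathbb R^n\subset\mathbb C^n$. For every point $z_0=p+iq\in\mathbb C^n$ with $p\in\mathrm{Co}(K)$ there exists a positive current $T$ of bidimension $(1,1)$ on $\mathbb C^n$ with finite mass satisfying $\mathrm{supp}(T)\subset\mathrm{Co}(K)\times i\mathbb R^n$ and $dd^cT=\mu-\delta_{z_0}$, where $\mu$ is a probability measure on $\mathcal T_K$ and $\delta_{z_0}$ is the Dirac mass at $z_0$. Conversely, let $T$ be a positive $(1,1)$ current on $\mathbb C^n$ with finite mass such that $\pi(\mathrm{supp}\,T)$ is a bounded set in $\mathbb R^n$. If $dd^cT\le0$ on $\mathbb C^n\setminus\mathcal T_K$, then $\mathrm{supp}\,T\subset\mathrm{Co}(K)\times i\mathbb R^n$.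
   Context: $\mathrm{Co}(K)$ is the convex hull of $K$, and $\pi\colon\mathbb C^n\to\mathbb R^n$ is the projection $\pi(x+iy)=x$. A ''$(1,1)$ current'' means a current of bidimension $(1,1)$; it is positive if $T(\alpha)\ge0$ for every $(1,1)$-form $\alpha$ with compact support which is positive, i.e. $\langle\alpha(q),\nu\wedge J\nu\rangle\ge0$ for every point $q$ and every $\nu\in T_q\mathbb C^n$ ($J$ is the standard complex structure). $d^c=i(\overline\partial-\partial)$, so $dd^c=2i\partial\overline\partial$, and $(dd^cT)(u)=T(dd^cu)$ for test functions $u$; $dd^cT\le0$ on an open set $U$ means $(dd^cT)(u)\le0$ for every nonnegative test function $u$ with compact support in $U$. *)

(* Defs.v *)
From HB Require Import structures.
From mathcomp Require Import all_boot all_order all_algebra.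
From mathcomp Require Import all_classical all_reals all_analysis.
From mathcomp Require Export complex.

Set Implicit Arguments.
Unset Strict Implicit.
Unset Printing Implicit Defensive.

Import Order.TTheory GRing.Theory Num.Theory.
Import numFieldNormedType.Exports.

Local Open Scope classical_set_scope.
Local Open Scope ring_scope.
Local Open Scope complex_scope.

(* The pair (x, y) stands for the point x + iy of C^n; it is also used for
   tangent vectors. *)
Notation Cn R n := ('rV[R]_n * 'rV[R]_n)%type.

Section Cn.
Context {R : realType} {n : nat}.
Implicit Types (q v w : Cn R n).

Definition cpi q : 'rV[R]_n := q.1.

Definition cJ v : Cn R n := (- v.2, v.1).

Definition zcoord v (j : 'I_n) : R[i] := v.1 0 j +i* v.2 0 j.

(* the library norm on row vectors and on pairs is the maximum norm *)
Definition eucl_norm v : R :=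
  Num.sqrt (\sum_j (v.1 0 j ^+ 2 + v.2 0 j ^+ 2)).

Definition dir_x (j : 'I_n) : Cn R n := (delta_mx 0 j, 0).
Definition dir_y (j : 'I_n) : Cn R n := (0, delta_mx 0 j).

Definition convex_hull (K : set 'rV[R]_n) : set 'rV[R]_n :=
  smallest (@convex_set R 'rV[R]_n) K.

Definition tube (K : set 'rV[R]_n) : set (Cn R n) := K `*` setT.

Definition borel_Cn := g_sigma_algebraType (@open (Cn R n)).

Fixpoint Ck (k : nat) (u : Cn R n -> R) : Prop :=
  if k is k'.+1
  then (forall q, differentiable u q) /\ (forall v, Ck k' ('D_v u))
  else continuous u.

Definition smooth (u : Cn R n -> R) : Prop := forall k, Ck k u.

Definition fsupp (V : nmodType) (f : Cn R n -> V) : set (Cn R n) :=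
  closure [set q | f q <> 0].

Definition test_function (u : Cn R n -> R) : Prop :=
  smooth u /\ compact (fsupp u).

(* derivative of a complex-valued function in the real direction v *)
Definition cderive v (f : Cn R n -> R[i]) (q : Cn R n) : R[i] :=
  'D_v (fun p => complex.Re (f p)) q +i* 'D_v (fun p => complex.Im (f p)) q.

Definition d_z (j : 'I_n) (f : Cn R n -> R[i]) (q : Cn R n) : R[i] :=
  (cderive (dir_x j) f q - 'i%C * cderive (dir_y j) f q) / 2%:R.

Definition d_zbar (j : 'I_n) (f : Cn R n -> R[i]) (q : Cn R n) : R[i] :=
  (cderive (dir_x j) f q + 'i%C * cderive (dir_y j) f q) / 2%:R.

(* A (1,1)-form is given by its coefficient matrix in the basis
   dz_j /\ dzbar_k. *)
Definition form11 := Cn R n -> 'M[R[i]]_n.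

(* The value on v /\ w of the (1,1)-covector
   \sum_(j, k) A j k dz_j /\ dzbar_k. *)
Definition covector_eval (A : 'M[R[i]]_n) v w : R[i] :=
  \sum_j \sum_k A j k *
    (zcoord v j * (zcoord w k)^* - zcoord w j * (zcoord v k)^*).

Definition test_form (a : form11) : Prop :=
  (forall j k, smooth (fun q => complex.Re (a q j k)) /\
               smooth (fun q => complex.Im (a q j k)))
  /\ compact (fsupp a).

Definition positive_form (a : form11) : Prop :=
  forall q v, 0 <= covector_eval (a q) v (cJ v).

(* 2i d dbar u *)
Definition ddc (u : Cn R n -> R) : form11 := fun q =>
  \matrix_(j, k) (2%:R * 'i%C * d_z j (d_zbar k (fun p => (u p)%:C)) q).

Definition coord_dir v : Prop := exists j, v = dir_x j \/ v = dir_y j.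

(* All partial derivatives of order at most N of the coefficients of a are
   bounded by b. *)
Definition coef_bound (N : nat) (a : form11) (b : R) : Prop :=
  forall (s : seq (Cn R n)) j k q,
    (size s <= N)%N -> (forall v, v \in s -> coord_dir v) ->
    Normc.normc (foldr cderive (fun p => a p j k) s q) <= b.

(* Currents of bidimension (1,1): continuous linear functionals on the space
   of test (1,1)-forms, continuity being expressed by the seminorms of the
   spaces of forms supported in a fixed compact set.  Values outside of the
   space of test forms are irrelevant. *)
Record current11 := Current11 {
  current_val :> form11 -> R[i] ;
  current_linear : forall (c : R[i]) (a b : form11),
    test_form a -> test_form b ->
    current_val (fun q => c *: a q + b q)
      = c * current_val a + current_val b ;
  current_continuous : forall L : set (Cn R n), compact L ->
    exists (N : nat) (C : R), forall (a : form11) (b : R),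
      test_form a -> fsupp a `<=` L -> coef_bound N a b ->
      Normc.normc (current_val a) <= C * b }.

Implicit Types T : current11.

Definition positive_current T : Prop :=
  forall a : form11, test_form a -> positive_form a -> 0 <= T a.

Definition comass (A : 'M[R[i]]_n) : \bar R :=
  ereal_sup [set z | exists v w, [/\ eucl_norm v <= 1, eucl_norm w <= 1 &
                       z = (Normc.normc (covector_eval A v w))%:E]].

Definition mass T : \bar R :=
  ereal_sup [set z | exists a : form11,
               [/\ test_form a, (forall q, (comass (a q) <= 1)%E) &
                   z = (Normc.normc (T a))%:E]].

Definition finite_mass T : Prop := (mass T < +oo)%E.

Definition vanishes_on T (U : set (Cn R n)) : Prop :=
  forall a : form11, test_form a -> fsupp a `<=` U -> T a = 0.

Definition csupp T : set (Cn R n) :=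
  ~` \bigcup_(U in [set U | open U /\ vanishes_on T U]) U.

(* dd^c T = mu - delta_z0 as distributions *)
Definition ddc_eq_dirac T (mu : {measure set borel_Cn -> \bar R}) (z0 : Cn R n)
    : Prop :=
  forall u : Cn R n -> R, test_function u ->
    T (ddc u) = (Rintegral mu setT u - u z0)%:C.

Definition ddc_le0_on T (U : set (Cn R n)) : Prop :=
  forall u : Cn R n -> R, test_function u -> (forall q, 0 <= u q) ->
    fsupp u `<=` U -> T (ddc u) <= 0.

End Cn.

Arguments form11 : clear implicits.
Arguments current11 : clear implicits.
Arguments borel_Cn : clear implicits.

(* Main.v *)
(* Both halves test currents on smooth functions u through the Laplacians
   levi u q v of t |-> u (q + t v), t in C, which are the values of dd^c u on
   v /\ Jv.

   Existence. Neither Green functions nor analytic discs are needed. If u is a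
   test function plus a combination of 1, |x|^2, |y|^2, has levi u >= 0 over
   Co(K) and u <= 0 on T_K, then the three lines argument along the complex lines
   joining two points of Co(K) gives u <= 0 over Co(K), in particular at z0. By
   the extension theorem of M. Riesz the functional (levi u, - u) |-> - u z0
   extends to a positive functional on pairs of functions dominated by
   (|v|^2, 1 + |y|^2). Its first component is the current; its second
   component is a finitely additive probability whose second moment in y is
   finite, hence tight, so it is represented by a Borel measure. The closedness
   of Co(K) is Caratheodory's theorem.

   Converse. A point z0 over the complement of Co(K) is separated from K by a
   ball with centre c and squared radius r, so that
   rho = |x - c|^2 - |y - y0|^2 / 2 - r is strictly plurisubharmonic, positive at
   z0, negative on T_K and positive only for y in a bounded set when x is
   bounded. Correcting rho beyond pi(supp T), a convex increasing function of
   rho, flat at 0, is a nonnegative test function supported off T_K with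
   dd^c >= 0 on supp T and > 0 at z0, which forces T = 0 near z0. *)

(* The current and the measure are coupled by the equation and are found together, as the two
   restrictions of one positive functional on functions on the disjoint union of [C * C] and [C].
   The current side stays finitely additive: a current only needs a linear form with an order zero
   bound, so no measure represents it. Test functions alone cannot dominate a positive weight on
   these unbounded domains; this is why quadratic terms are added, [- |y|^2] giving the second
   moment and [|x|^2] outweighing it so that [levi] stays positive. In the converse the obstacle is
   compact support: a compactly supported [u] with [levi u > 0] somewhere has [levi u < 0]
   elsewhere. The correction of [rho] confines the negative part to a compact set off the support,
   where a form killed by [T] is added to restore positivity. [T] then kills the resulting positive
   form, and with it, like a positive measure, every form which that one dominates. *)
Require Import Defs.
From HB Require Import structures.
From mathcomp Require Import all_boot all_order all_algebra.
From mathcomp Require Import all_classical all_reals all_analysis.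
From mathcomp Require Import complex.
From mathcomp Require Import measurable_realfun finmap ring lra.

Import Order.TTheory GRing.Theory Num.Theory.
Import numFieldNormedType.Exports.
Local Open Scope classical_set_scope.
Local Open Scope ring_scope.

Set Implicit Arguments.
Unset Strict Implicit.
Unset Printing Implicit Defensive.

(** * Hahn-Banach theorem for a sublinear bound on a subspace *)

Section HahnBanach.
Context (R : realType) (V : lmodType R).

(** A predicate instead of a subtype: functionals remain total functions on [V], and nothing is
    claimed about their values outside [E]. *)
Definition subspace_set (E : set V) : Prop :=
  E 0 /\ forall (a : R) x y, E x -> E y -> E (a *: x + y).

Definition linear_on (E : set V) (f : V -> R) : Prop :=
  forall (a : R) x y, E x -> E y -> f (a *: x + y) = a * f x + f y.

Variables (E : set V) (p : V -> R).
Hypothesis subE : subspace_set E.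
Hypothesis pD : forall x y, E x -> E y -> p (x + y) <= p x + p y.
Hypothesis pZ : forall (a : R) x, 0 < a -> E x -> p (a *: x) = a * p x.

(* Partial linear functionals dominated by p, as graphs. *)
Definition dominated_graph (G : set (V * R)) : Prop :=
  [/\ forall (a : R) x y, G x -> G y -> G (a *: x.1 + y.1, a * x.2 + y.2),
      forall x, G x -> E x.1 &
      forall x, G x -> x.2 <= p x.1].

Let E0 : E 0. Proof. by case: subE. Qed.
Let EZ a x : E x -> E (a *: x).
Proof. by move=> Ex; rewrite -[_ *: _]addr0; apply: subE.2. Qed.
Let ED x y : E x -> E y -> E (x + y).
Proof. by move=> Ex Ey; rewrite -[x]scale1r; apply: subE.2. Qed.
Let EB x y : E x -> E y -> E (x - y).
Proof. by move=> Ex Ey; rewrite addrC -scaleN1r; apply: subE.2. Qed.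

Let p0 : p 0 = 0.
Proof.
have := @pZ 2 0 (ltr0Sn _ _) E0; rewrite scaler0 => h.
lra.
Qed.

(** The empty set is a dominated graph, so empty chains need no special treatment; in return, that
    the maximal graph contains [(0, 0)] has to be proved afterwards. *)
Lemma max_dominated_graph : exists G, dominated_graph G /\
  forall H, G `<` H -> ~ dominated_graph H.
Proof.
apply: Zorn_bigcup => F FP Ftot; split.
- move=> a x y [A FA Ax] [B FB By].
  have [AB|BA] := Ftot _ _ FA FB.
  + by exists B => //; have [h _ _] := FP _ FB; apply: h => //; apply: AB.
  + by exists A => //; have [h _ _] := FP _ FA; apply: h => //; apply: BA.
- by move=> x [A FA Ax]; have [_ h _] := FP _ FA; apply: h.
- by move=> x [A FA Ax]; have [_ _ h] := FP _ FA; apply: h.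
Qed.

(** By subadditivity ([key]) every [y.2 - p (y.1 - x)] lies below every [p (z.1 + x) - z.2], so the
    supremum of the former is a possible value at [x]. Positive homogeneity reduces a general
    multiple [t *: x] to the cases [t = 1] and [t = -1]. *)
Lemma dominated_graph_ext (G : set (V * R)) (x : V) :
  dominated_graph G -> G (0, 0) -> E x -> exists c : R,
  dominated_graph [set z | exists y (t : R), G y /\ z = (y.1 + t *: x, y.2 + t * c)].
Proof.
move=> [Gl GE Gp] G0 Ex.
have key (y z : V * R) : G y -> G z -> y.2 - p (y.1 - x) <= p (z.1 + x) - z.2.
  move=> Gy Gz; have := Gp _ (Gl 1 _ _ Gy Gz); rewrite !scale1r !mul1r /= => h.
  have := pD (EB (GE _ Gy) Ex) (ED (GE _ Gz) Ex).
  rewrite addrACA addNr addr0 => h'; lra.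
pose A := [set r : R | exists2 y, G y & r = y.2 - p (y.1 - x)].
have A0 : A !=set0 by exists (0 - p (0 - x)), (0, 0).
have Aub z : G z -> ubound A (p (z.1 + x) - z.2).
  by move=> Gz _ [y Gy ->]; apply: key.
have supA : has_sup A by split=> //; exists (p (0 + x) - 0); exact: (Aub (0, 0)).
exists (sup A).
have c1 y : G y -> y.2 - p (y.1 - x) <= sup A.
  by move=> Gy; apply: sup_upper_bound => //; exists y.
have c2 y : G y -> sup A <= p (y.1 + x) - y.2.
  by move=> Gy; apply: ge_sup => //; apply: Aub.
have GZ a z : G z -> G (a *: z.1, a * z.2).
  by move=> Gz; have := Gl a _ _ Gz G0; rewrite !addr0.
split.
- move=> a _ _ [y1 [t1 [Gy1 ->]]] [y2 [t2 [Gy2 ->]]] /=.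
  exists (a *: y1.1 + y2.1, a * y1.2 + y2.2), (a * t1 + t2); split.
    exact: Gl.
  congr pair => /=; last by ring.
  by rewrite scalerDr scalerDl addrACA scalerA.
- move=> _ [y [t [Gy ->]]] /=; apply: ED; [exact: GE|exact: EZ].
- move=> _ [y [t [Gy ->]]] /=.
  have [t0|t0|<-] := ltgtP 0 t; last by rewrite scale0r mul0r !addr0; apply: Gp.
  + have := c2 _ (GZ t^-1 _ Gy).
    rewrite /= => h.
    have -> : y.1 + t *: x = t *: (t^-1 *: y.1 + x).
      by rewrite scalerDr scalerA divff ?gt_eqF// scale1r.
    rewrite pZ//; last by apply: ED => //; apply: EZ; apply: GE.
    rewrite -(ler_pM2l t0) mulrBr mulrA divff ?gt_eqF// mul1r in h.
    lra.
  + have s0 : 0 < - t by rewrite oppr_gt0.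
    have := c1 _ (GZ (- t)^-1 _ Gy).
    rewrite /= => h.
    have -> : y.1 + t *: x = (- t) *: ((- t)^-1 *: y.1 - x).
      by rewrite scalerBr scalerA divff ?gt_eqF// scale1r scaleNr opprK.
    rewrite pZ//; last by apply: EB => //; apply: EZ; apply: GE.
    rewrite -(ler_pM2l s0) mulrBr mulrA divff ?gt_eqF// mul1r in h.
    lra.
Qed.

Theorem hahn_banach : exists f : V -> R,
  linear_on E f /\ forall x, E x -> f x <= p x.
Proof.
have [G [dG maxG]] := max_dominated_graph.
have G0 : G (0, 0).
  have [[z Gz]|Ge] := pselect (G !=set0).
    case: dG => Gl _ _; have /= := Gl (-1) _ _ Gz Gz.
    by rewrite scaleN1r mulN1r !addNr.
  (* An empty maximal graph would be strictly contained in the graph of the zero functional on the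
     zero space. *)
  exfalso; apply: (maxG [set (0, 0)]).
    split; first by move=> z Gz; exfalso; apply: Ge; exists z.
    by move=> /(_ (0,0) erefl) Gz; apply: Ge; exists (0, 0).
  split=> /=; do ?[by move=> _ ->; rewrite /= ?p0].
  by move=> a _ _ -> -> /=; rewrite scaler0 mulr0 !addr0.
have Gfull x : E x -> exists r, G (x, r).
  move=> Ex; apply: contrapT => nG.
  have [c dc] := dominated_graph_ext dG G0 Ex.
  apply: (maxG _ _ dc); split.
    move=> z Gz; exists z, 0; split=> //.
    by rewrite scale0r mul0r !addr0; case: z Gz.
  move=> /(_ (x, c)) h; apply: nG; exists c; apply: h.
  by exists (0, 0), 1; split => //=; rewrite !add0r scale1r mul1r.
(* Two values over the same point give a pair [(0, r' - s')] in [G], and its second entry is at most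
   [p 0 = 0]. *)
have Guniq x r s : G (x, r) -> G (x, s) -> r = s.
  case: dG => Gl _ Gp.
  have aux r' s' : G (x, r') -> G (x, s') -> r' <= s'.
    move=> h1 h2; have := Gp _ (Gl (-1) _ _ h2 h1).
    by rewrite /= scaleN1r mulN1r addNr p0 addrC subr_le0.
  by move=> h1 h2; apply/eqP; rewrite eq_le !aux.
exists (fun x => xget 0 [set r | G (x, r)]).
have Gf x : E x -> G (x, xget 0 [set r | G (x, r)]).
  by move=> /Gfull [r Gr]; apply: (@xgetPex _ 0 [set r | G (x, r)]); exists r.
case: (dG) => Gl GE Gp.
split.
  move=> a x y Ex Ey; apply: (Guniq (a *: x + y)).
    by apply: Gf; apply: subE.2.
  exact: (Gl a _ _ (Gf _ Ex) (Gf _ Ey)).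
by move=> x Ex; apply: (Gp _ (Gf _ Ex)).
Qed.

End HahnBanach.

(** * M. Riesz extension of positive functionals *)

Section PositiveExtension.
Context (R : realType) (X : choiceType) (U : lmodType R).
Variables (S : set X) (W : X -> R).

(** Only values on [S] are constrained, and positivity is also tested on [S] alone; a positive
    functional on this space therefore cannot distinguish functions that agree on [S]. *)
Definition weight_dominated (f : X -> R) : Prop :=
  exists2 C : R, 0 <= C & forall s, S s -> `|f s| <= C * W s.

Variables (V : set U) (P : U -> X -> R) (l : U -> R).
Hypothesis subV : subspace_set V.
Hypothesis Plin : forall (a : R) u v s, V u -> V v -> S s ->
  P (a *: u + v) s = a * P u s + P v s.
Hypothesis llin : linear_on V l.
Hypothesis lpos : forall u, V u -> (forall s, S s -> 0 <= P u s) -> 0 <= l u.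
Hypothesis major : exists2 u, V u & forall s, S s -> W s <= P u s.

Lemma subspace_dominated : subspace_set weight_dominated.
Proof.
split; first by exists 0 => // s Ss; rewrite normr0 mul0r.
move=> a f g [C C0 Cf] [D D0 Dg]; exists (`|a| * C + D).
  by rewrite addr_ge0// mulr_ge0.
move=> s Ss; apply: (le_trans (ler_normD _ _)).
rewrite mulrDl; apply: lerD; last exact: Dg.
by rewrite -mulrA normrM ler_wpM2l// Cf.
Qed.

Let above (f : X -> R) : set R :=
  [set r | exists u, [/\ V u, (forall s, S s -> f s <= P u s) & r = l u]].

(** The sublinear functional of the M. Riesz theorem: the least price [l u] of an element of [V]
    lying above [f]. [major] makes [above f] nonempty and [lpos] bounds it from below, so [inf] is a
    true infimum and not a default value. *)
Let p (f : X -> R) : R := inf (above f).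

Let V0 : V 0. Proof. by case: subV. Qed.
Let VZ a u : V u -> V (a *: u).
Proof. by move=> Vu; rewrite -[_ *: _]addr0; apply: subV.2. Qed.
Let l0 : l 0 = 0.
Proof. by have := llin 1 V0 V0; rewrite scale1r addr0; lra. Qed.
Let P0 s : S s -> P 0 s = 0.
Proof. by move=> Ss; have := Plin 1 V0 V0 Ss; rewrite scale1r addr0; lra. Qed.
Let lZ a u : V u -> l (a *: u) = a * l u.
Proof. by move=> Vu; rewrite -[_ *: u]addr0 llin// l0 addr0. Qed.
Let PZ a u s : V u -> S s -> P (a *: u) s = a * P u s.
Proof. by move=> Vu Ss; rewrite -[_ *: u]addr0 Plin// P0// addr0. Qed.

Let above_neq0 f : weight_dominated f -> above f !=set0.
Proof.
move=> [C C0 Cf]; have [u Vu Wu] := major.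
exists (l (C *: u)), (C *: u); split => //; first exact: VZ.
move=> s Ss; rewrite PZ//; apply: (le_trans (ler_norm _)).
by apply: (le_trans (Cf _ Ss)); rewrite ler_wpM2l// Wu.
Qed.

Let above_lb f : weight_dominated f -> has_lbound (above f).
Proof.
move=> [C C0 Cf]; have [u Vu Wu] := major.
exists (- l (C *: u)) => _ [v [Vv fv ->]].
rewrite -subr_ge0 opprK -[l v]mul1r -llin //; last exact: VZ.
apply: lpos; first by apply: subV.2 => //; apply: VZ.
move=> s Ss; rewrite Plin//; last exact: VZ.
rewrite mul1r PZ//.
have h1 : C * W s <= C * P u s by rewrite ler_wpM2l// Wu.
have h2 := Cf _ Ss; have h3 := fv _ Ss; have h4 := ler_norm (- f s).
rewrite normrN in h4; lra.
Qed.

Let p_le f u : weight_dominated f -> V u -> (forall s, S s -> f s <= P u s) ->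
  p f <= l u.
Proof. by move=> Df Vu fu; apply: ge_inf; [exact: above_lb|exists u]. Qed.

(** [l] is already encoded in [p], so domination by [p] gives everything. If [f >= 0] on [S], then
    [- f] lies below [P 0], whence [L (- f) <= l 0 = 0]. For [u] in [V], comparing [P u] with itself
    and [- P u] with [P (- u)] squeezes [L (P u)] to [l u]. *)
Theorem positive_extension : exists L : (X -> R) -> R,
  [/\ linear_on weight_dominated L,
      forall f, weight_dominated f -> (forall s, S s -> 0 <= f s) -> 0 <= L f &
      forall u, V u -> weight_dominated (P u) -> L (P u) = l u].
Proof.
have [Dom0 DomL] := subspace_dominated.
have DZ a f : weight_dominated f -> weight_dominated (a *: f).
  by move=> Df; rewrite -[_ *: _]addr0; apply: DomL.
have [||L [Llin Lp]] := @hahn_banach R (X -> R) weight_dominated p subspace_dominated.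
- move=> f g Df Dg; rewrite -lerBlDr; apply: lb_le_inf; first exact: above_neq0.
  move=> _ [u [Vu fu ->]]; rewrite lerBlDr -lerBlDl.
  apply: lb_le_inf; first exact: above_neq0.
  move=> _ [v [Vv gv ->]]; rewrite lerBlDl -[l u]mul1r -llin//; apply: p_le.
  + by rewrite -[f]scale1r; apply: DomL.
  + exact: subV.2.
  + by move=> s Ss; rewrite Plin// mul1r; apply: lerD; [exact: fu|exact: gv].
- move=> a f a0 Df.
  have aux b g : 0 < b -> weight_dominated g -> p (b *: g) <= b * p g.
    move=> b0 Dg; rewrite -ler_pdivrMl//; apply: lb_le_inf; first exact: above_neq0.
    move=> _ [u [Vu gu ->]]; rewrite ler_pdivrMl// -lZ//; apply: p_le.
    + exact: DZ.
    + exact: VZ.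
    + by move=> s Ss; rewrite PZ//= ler_pM2l// gu.
  apply/eqP; rewrite eq_le aux//=.
  have := aux a^-1 (a *: f); rewrite invr_gt0 => /(_ a0 (DZ _ _ Df)).
  by rewrite scalerA mulVf ?gt_eqF// scale1r ler_pdivlMl.
have L0 : L 0 = 0 by have := Llin 1 _ _ Dom0 Dom0; rewrite scale1r addr0; lra.
have LN f : weight_dominated f -> L (- f) = - L f.
  by move=> Df; rewrite -scaleN1r -[_ *: _]addr0 Llin// L0 addr0 mulN1r.
have DN f : weight_dominated f -> weight_dominated (- f).
  by move=> Df; rewrite -scaleN1r; apply: DZ.
exists L; split=> //.
  move=> f Df f0; rewrite -oppr_le0 -LN//; apply: (le_trans (Lp _ (DN _ Df))).
  rewrite -l0; apply: p_le => //; first exact: DN.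
  by move=> s Ss; rewrite P0//= oppr_le0 f0.
move=> u Vu Du; apply/eqP; rewrite eq_le; apply/andP; split.
  by apply: (le_trans (Lp _ Du)); apply: p_le.
rewrite -lerN2 -LN//.
have -> : - l u = l (-1 *: u) by rewrite lZ// mulN1r.
apply: (le_trans (Lp _ (DN _ Du))).
apply: p_le => //; [exact: DN|exact: VZ|].
by move=> s Ss; rewrite PZ//= mulN1r.
Qed.

End PositiveExtension.

(** * From a tight finitely additive set function to a Borel probability *)

Section Regularization.
Context (R : realType) (T : normedModType R).
Local Open Scope ereal_scope.

Variable nu : set T -> R.
Hypothesis nu0 : nu set0 = 0%R.
Hypothesis nu_mono : forall A B, A `<=` B -> (nu A <= nu B)%R.
Hypothesis nu_sub : forall A B, (nu (A `|` B) <= nu A + nu B)%R.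
Hypothesis nu_add : forall A B, A `&` B = set0 -> nu (A `|` B) = (nu A + nu B)%R.

(** A finitely additive function on all subsets need not be a measure. As in the Riesz-Markov
    construction, it is read off compact sets inside open sets, then extended from outside to all
    sets; on open sets this can only lose mass. *)
Definition inner_val (U : set T) : \bar R :=
  ereal_sup [set (nu C)%:E | C in [set C | compact C /\ C `<=` U]].

Definition outer_val (A : set T) : \bar R :=
  ereal_inf [set inner_val U | U in [set U | open U /\ A `<=` U]].

Let inner_ub (C U : set T) : compact C -> C `<=` U -> (nu C)%:E <= inner_val U.
Proof. by move=> cC CU; apply: ereal_sup_ubound; exists C. Qed.

Let inner_le (U : set T) : inner_val U <= (nu U)%:E.
Proof.
by apply: ge_ereal_sup => _ [C [cC CU] <-]; rewrite lee_fin nu_mono.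
Qed.

Let inner_ge0 U : 0 <= inner_val U.
Proof. by have := @inner_ub set0 U (@compact0 _) (@sub0set _ _); rewrite nu0. Qed.

Let inner_mono (U V : set T) : U `<=` V -> inner_val U <= inner_val V.
Proof.
move=> UV; apply: ge_ereal_sup => _ [C [cC CU] <-]; apply: inner_ub => //.
exact: subset_trans UV.
Qed.

Let inner_fin U : inner_val U \is a fin_num.
Proof.
rewrite ge0_fin_numE ?inner_ge0//; apply: (le_lt_trans (inner_le U)).
exact: ltry.
Qed.

Let outer_ge0 A : 0 <= outer_val A.
Proof. by apply: le_ereal_inf_tmp => _ [U _ <-]; exact: inner_ge0. Qed.

Let outer_lb (A U : set T) : open U -> A `<=` U -> outer_val A <= inner_val U.
Proof. by move=> oU AU; apply: ereal_inf_lbound; exists U. Qed.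

Let outer_open U : open U -> outer_val U = inner_val U.
Proof.
move=> oU; apply/eqP; rewrite eq_le outer_lb//=.
by apply: le_ereal_inf_tmp => _ [V [oV UV] <-]; exact: inner_mono.
Qed.

Let outer_mono (A B : set T) : A `<=` B -> outer_val A <= outer_val B.
Proof.
move=> AB; apply: le_ereal_inf_tmp => _ [V [oV BV] <-]; apply: outer_lb => //.
exact: subset_trans BV.
Qed.

Let outer_fin A : outer_val A \is a fin_num.
Proof.
rewrite ge0_fin_numE ?outer_ge0//; apply: (@le_lt_trans _ _ (inner_val setT)).
  by apply: outer_lb => //; exact: openT.
by rewrite -ge0_fin_numE ?inner_fin ?inner_ge0.
Qed.

Let outer_set0 : outer_val set0 = 0.
Proof.
rewrite outer_open; last exact: open0.
by apply/eqP; rewrite eq_le inner_ge0 andbT (le_trans (inner_le _))// nu0.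
Qed.

Let outer_approx A (e : R) : (0 < e)%R ->
  exists U, [/\ open U, A `<=` U & inner_val U <= outer_val A + e%:E].
Proof.
move=> e0; have [_ [U [oU AU] <-] h] := lb_ereal_inf_adherent e0 (outer_fin A).
by exists U; split => //; exact: ltW.
Qed.

Let inner_approx U (e : R) : (0 < e)%R ->
  exists C, [/\ compact C, C `<=` U & inner_val U - e%:E <= (nu C)%:E].
Proof.
move=> e0; have [_ [C [cC CU] <-] h] := ub_ereal_sup_adherent e0 (inner_fin U).
by exists C; split => //; exact: ltW.
Qed.

(* A compact subset of a union of open sets is a finite union of compact
   pieces, each lying in one of the open sets. *)
Let inner_bigcup (U : (set T)^nat) : (forall i, open (U i)) ->
  inner_val (\bigcup_i U i) <= \sum_(i <oo) inner_val (U i).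
Proof.
move=> oU; apply: ge_ereal_sup => _ [C [cC CU] <-].
have /choice[f fP] : forall x, exists p : nat * set T, C x ->
    [/\ nbhs x p.2 & closure p.2 `<=` U p.1].
  move=> x; have [Cx|nCx] := pselect (C x); last by exists (0%N, set0).
  have [i _ Uix] := CU _ Cx.
  have [V xV cV] := @uniform_regular T x (U i) (open_nbhs_nbhs (conj (oU i) Uix)).
  by exists (i, V).
move: (cC); rewrite compact_cover => /(_ T C (fun x => (f x).2^°)) [||D DC CD].
- by move=> x _; exact: open_interior.
- by move=> x Cx; exists x => //; have [] := fP _ Cx.
pose K i := C `&` \bigcup_(x in [set` D] `&` [set x | (f x).1 = i]) closure (f x).2.
have finD i : finite_set ([set` D] `&` [set x | (f x).1 = i]).
  by apply: finite_setIl; exact: finite_fset.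
have cK i : compact (K i).
  apply: compact_closedI => //; apply: closed_bigcup => // x _.
  exact: closed_closure.
have KU i : K i `<=` U i.
  move=> y [Cy [x [Dx xi] cy]]; have [_] := fP _ (set_mem (DC _ Dx)).
  by rewrite xi; apply.
pose N := (\max_(x <- enum_fset D) (f x).1).+1.
have CK : C `<=` \big[setU/set0]_(i < N) K i.
  move=> y Cy; have [x Dx fxy] := CD _ Cy.
  have iN : ((f x).1 < N)%N by rewrite ltnS; apply: leq_bigmax_seq.
  rewrite -bigcup_mkord; exists (f x).1 => //; split => //.
  exists x; first by split.
  by apply: subset_closure; exact: interior_subset fxy.
have nu_big n : (nu (\big[setU/set0]_(i < n) K i) <= \sum_(i < n) nu (K i))%R.
  elim: n => [|n IH]; first by rewrite !big_ord0 nu0.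
  by rewrite !big_ord_recr/=; apply: (le_trans (nu_sub _ _)); rewrite lerD2r.
apply: (@le_trans _ _ (\sum_(0 <= i < N) inner_val (U i))).
  apply: (@le_trans _ _ (\sum_(i < N) nu (K i))%R%:E).
    by rewrite lee_fin; apply: le_trans (nu_big N); exact: nu_mono.
  rewrite -sumEFin big_mkord; apply: lee_sum => i _; exact: inner_ub.
by apply: nneseries_lim_ge => i _ _; exact: inner_ge0.
Qed.

Let outer_sigma_subadditive : sigma_subadditive outer_val.
Proof.
move=> F; apply/lee_addgt0Pr => e e0.
apply: le_trans (epsilon_trick _ _ (ltW e0)); last by move=> i; exact: outer_ge0.
have /choice[U UP] : forall i, exists U, [/\ open U, F i `<=` U &
    inner_val U <= outer_val (F i) + (e / (2 ^ i.+1)%:R)%:E].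
  by move=> i; apply: outer_approx; rewrite divr_gt0// ltr0n expn_gt0.
apply: (@le_trans _ _ (inner_val (\bigcup_i U i))).
  apply: outer_lb; first by apply: bigcup_open => i _; have [] := UP i.
  by move=> x [i _ Fx]; exists i => //; have [_ + _] := UP i; apply.
apply: (le_trans (inner_bigcup _)); first by move=> i; have [] := UP i.
apply: lee_nneseries => i _ //; by have [] := UP i.
Qed.

HB.instance Definition _ := isOuterMeasure.Build R T outer_val
  outer_set0 outer_ge0 outer_mono outer_sigma_subadditive.

(** A compact [C] nearly exhausts [V] inside [U], and a compact [D] nearly exhausts the open set [V]
    minus [C], which still covers the part of [A] outside [U]. Being disjoint, [C] and [D] have
    additive contents, bounded together by the inner value of [V]. *)
Let open_caratheodory U : open U -> outer_val.-caratheodory U.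
Proof.
move=> oU; apply: le_caratheodory_measurable => A /=.
apply: le_ereal_inf_tmp => _ [V [oV AV] <-].
apply/lee_addgt0Pr => e e0.
have e2 : (0 < e / 2)%R by rewrite divr_gt0.
have [C [cC CU hC]] := inner_approx (V `&` U) e2.
have clC : closed C by apply: compact_closed => //; exact: norm_hausdorff.
have [D [cD DV hD]] := inner_approx (V `\` C) e2.
have oVC : open (V `\` C) by apply: openI => //; exact: closed_openC.
have h1 : outer_val (A `&` U) <= inner_val (V `&` U).
  by apply: outer_lb; [exact: openI|exact: setSI].
have h2 : outer_val (A `&` ~` U) <= inner_val (V `\` C).
  by apply: outer_lb => // x [Ax nUx]; split; [exact: AV|move=> /CU []].
apply: (le_trans (leeD h1 h2)).
have h3 : (nu C + nu D)%:E <= inner_val V.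
  rewrite -nu_add; last first.
    by rewrite -subset0 => x [Cx /DV []].
  apply: inner_ub; first exact: compactU.
  by move=> x [/CU []|/DV []].
move: h3 hC hD.
rewrite -(fineK (inner_fin (V `&` U))) -(fineK (inner_fin (V `\` C))).
rewrite -(fineK (inner_fin V)) -!EFinB -!EFinD !lee_fin; lra.
Qed.

(** [outer_val] retyped over the Borel sigma-algebra, so that a measure structure can be attached
    beside the outer measure structure on [outer_val]. *)
Definition regularization (A : set (g_sigma_algebraType (@open T))) : \bar R :=
  outer_val A.

Let measurable_caratheodory (A : set (g_sigma_algebraType (@open T))) :
  measurable A -> (outer_val : set T -> _).-cara.-measurable A.
Proof.
move=> mA; apply: mA; split; last by move=> U oU; exact: open_caratheodory.
exact: sigma_algebra_measurable.
Qed.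

Let regularization0 : regularization set0 = 0. Proof. exact: outer_set0. Qed.
Let regularization_ge0 A : 0 <= regularization A. Proof. exact: outer_ge0. Qed.
Let regularization_sigma : semi_sigma_additive regularization.
Proof.
move=> F mF tF mbF.
apply: (@caratheodory_measure_sigma_additive R T outer_val) => //.
- by move=> i; exact: measurable_caratheodory.
- exact: measurable_caratheodory.
Qed.

HB.instance Definition _ := isMeasure.Build _ _ R regularization
  regularization0 regularization_ge0 regularization_sigma.

Lemma regularization_open U : open U -> regularization U <= (nu U)%:E.
Proof. by move=> oU; rewrite /regularization outer_open. Qed.

Hypothesis nu1 : nu setT = 1%R.
Hypothesis tight : forall e, (0 < e)%R -> exists2 C, compact C & (1 - e <= nu C)%R.

Let regularization_setT : regularization setT = 1.
Proof.
apply/eqP; rewrite eq_le; apply/andP; split.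
  by apply: (le_trans (regularization_open (@openT T))); rewrite nu1.
apply/lee_addgt0Pr => e e0; have [C cC hC] := tight e0.
have := @inner_ub C setT cC (@subsetT _ _).
rewrite -(outer_open (@openT T)) => h.
apply: (@le_trans _ _ ((nu C)%:E + e%:E)); last by apply: leeD.
by rewrite -EFinD lee_fin; lra.
Qed.

HB.instance Definition _ := Measure_isProbability.Build _ _ R regularization
  regularization_setT.

Definition regular_probability : probability (g_sigma_algebraType (@open T)) R :=
  regularization.

End Regularization.

(** Tightness keeps mass from escaping to infinity, so the total mass stays one. Taking complements,
    the bound on open sets becomes [nu A <= mu A] on closed sets, the form applied to superlevel
    sets below. *)
Theorem tight_content_probability (R : realType) (T : normedModType R)
    (nu : set T -> R) :
  (forall A B, A `<=` B -> nu A <= nu B) ->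
  (forall A B, A `&` B = set0 -> nu (A `|` B) = nu A + nu B) ->
  nu setT = 1 ->
  (forall e, 0 < e -> exists2 C, compact C & 1 - e <= nu C) ->
  exists mu : probability (g_sigma_algebraType (@open T)) R,
    forall U, open U -> (mu U <= (nu U)%:E)%E.
Proof.
move=> mono add nu1 tight.
have nu0 : nu set0 = 0.
  by have := add set0 set0; rewrite setI0 setU0 => /(_ erefl) h; lra.
have sub A B : nu (A `|` B) <= nu A + nu B.
  have -> : A `|` B = A `|` (B `\` A).
    apply/seteqP; split=> x; last by move=> [|[Bx _]]; [left|right].
    by move=> ABx; have [Ax|nAx] := pselect (A x); [left|right; case: ABx].
  rewrite add; last by rewrite setDE setICA setICr setI0.
  by rewrite lerD2l mono// => x [].
exists (regular_probability nu0 mono sub add nu1 tight) => U oU.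
exact: regularization_open.
Qed.

(** * Representation of tight positive functionals by Borel probabilities *)

Lemma layer_sum_full (R : realType) (h t : R) N : 0 <= h -> t >= N%:R * h ->
  \sum_(k < N) h * (k.+1%:R * h <= t)%R%:R = N%:R * h.
Proof.
move=> h0; elim: N => [|N IH] ht; first by rewrite big_ord0 mul0r.
rewrite big_ord_recr/= IH ?ht ?mulr1; last first.
  by apply: le_trans ht; rewrite ler_wpM2r// ler_nat.
by rewrite -natr1 mulrDl mul1r.
Qed.

(** The sum is [h] times the number of levels among [h, 2 h, ..., N h] that do not exceed [t]: a
    step approximation of [t] from below. Its error is at most [h] while [t] stays under level
    [N + 1], which is [layer_sum_ge]. *)
Lemma layer_sum_le (R : realType) (h t : R) N : 0 <= h -> 0 <= t ->
  \sum_(k < N) h * (k.+1%:R * h <= t)%R%:R <= t.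
Proof.
move=> h0 t0; elim: N => [|N IH]; first by rewrite big_ord0.
have [ht|ht] := lerP (N.+1%:R * h) t; first by rewrite layer_sum_full.
by move: ht; rewrite ltNge big_ord_recr/= => /negbTE ->; rewrite mulr0 addr0.
Qed.

Lemma layer_sum_ge (R : realType) (h t : R) N : 0 <= h -> 0 <= t -> t < N.+1%:R * h ->
  t <= h + \sum_(k < N) h * (k.+1%:R * h <= t)%R%:R.
Proof.
move=> h0 t0; elim: N => [|N IH] ht.
  by rewrite big_ord0 addr0; move: ht; rewrite mul1r => /ltW.
have [ht'|ht'] := lerP (N.+1%:R * h) t.
  rewrite layer_sum_full//; move: ht; rewrite -[N.+2%:R]natr1 mulrDl mul1r; lra.
by rewrite big_ord_recr/= (leNgt (_ * h)) ht'/= mulr0 addr0; exact: IH.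
Qed.

Section Representation.
Context (R : realType) (T : normedModType R).

Definition bounded_function (f : T -> R) : Prop := exists M, forall x, `|f x| <= M.

Lemma subspace_bounded : subspace_set (bounded_function : set (T -> R)).
Proof.
split; first by exists 0 => x; rewrite normr0.
move=> a f g [M fM] [M' gM]; exists (`|a| * M + M') => x.
apply: (le_trans (ler_normD _ _)); apply: lerD => //.
by rewrite normrM ler_wpM2l.
Qed.

Variable L : (T -> R) -> R.
Hypothesis Llin : linear_on bounded_function L.
Hypothesis Lpos : forall f, bounded_function f -> (forall x, 0 <= f x) -> 0 <= L f.
Hypothesis L1 : L (fun=> 1) = 1.
Hypothesis Ltight : forall e, 0 < e -> exists2 C, compact C & L \1_(~` C) <= e.

Let B0 : bounded_function 0. Proof. by case: subspace_bounded. Qed.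
Let BZ a f : bounded_function f -> bounded_function (a *: f).
Proof. by move=> Bf; rewrite -[_ *: f]addr0; apply: subspace_bounded.2. Qed.
Let BD f g : bounded_function f -> bounded_function g -> bounded_function (f + g).
Proof. by move=> Bf Bg; rewrite -[f]scale1r; apply: subspace_bounded.2. Qed.
Let Bcst c : bounded_function (fun=> c). Proof. by exists `|c|. Qed.
Let Bind A : bounded_function \1_A.
Proof. by exists 1 => x; rewrite indicE ger0_norm ?ler0n// lern1 leq_b1. Qed.
Let L0 : L 0 = 0. Proof. by have := Llin 1 B0 B0; rewrite scale1r addr0; lra. Qed.
Let LZ a f : bounded_function f -> L (a *: f) = a * L f.
Proof. by move=> Bf; rewrite -[_ *: f]addr0 Llin// L0 addr0. Qed.
Let LD f g : bounded_function f -> bounded_function g -> L (f + g) = L f + L g.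
Proof. by move=> Bf Bg; rewrite -[f in LHS]scale1r Llin// mul1r. Qed.
Let Lle f g : bounded_function f -> bounded_function g ->
  (forall x, f x <= g x) -> L f <= L g.
Proof.
move=> Bf Bg fg; have BfN : bounded_function (-1 *: f) by exact: BZ.
have : 0 <= L (-1 *: f + g).
  apply: Lpos; first exact: BD.
  by move=> x /=; rewrite !fctE scaleN1r addrC subr_ge0.
by rewrite Llin// mulN1r addrC subr_ge0.
Qed.
Let Lcst c : L (fun=> c) = c.
Proof.
have -> : (fun=> c) = c *: (fun=> 1) :> (T -> R).
  by apply/funext => x; rewrite !fctE; apply/esym; exact: mulr1.
by rewrite LZ// L1 mulr1.
Qed.
Let Bsum N (F : nat -> T -> R) : (forall k, bounded_function (F k)) ->
  bounded_function (\sum_(k < N) F k).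
Proof.
move=> BF; elim: N => [|N IH]; first by rewrite big_ord0.
by rewrite big_ord_recr/=; apply: BD.
Qed.
Let Lsum N (F : nat -> T -> R) : (forall k, bounded_function (F k)) ->
  L (\sum_(k < N) F k) = \sum_(k < N) L (F k).
Proof.
move=> BF; elim: N => [|N IH]; first by rewrite !big_ord0.
by rewrite !big_ord_recr/= LD ?IH//; exact: Bsum.
Qed.

(** The measure comes from the content [A |-> L \1_A]. It is at least this content on closed sets,
    so step functions over closed superlevel sets give [L f <= Rintegral mu setT f]. The clause on
    open sets is what later places [mu] on the tube. *)
Theorem functional_representation :
  exists mu : probability (g_sigma_algebraType (@open T)) R,
    (forall U, open U -> L \1_U = 0 -> mu U = 0%E) /\
    forall f : T -> R, continuous f -> bounded_function f ->
      L f = Rintegral mu setT f.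
Proof.
pose nu (A : set T) := L \1_A.
have nuD A B : A `&` B = set0 -> nu (A `|` B) = nu A + nu B.
  move=> AB; rewrite /nu -LD//; congr L; apply/funext => x; rewrite fctE !indicE.
  rewrite in_setU; case: (boolP (x \in A)) => xA; case: (boolP (x \in B)) => xB //=.
  - exfalso; have : (A `&` B) x by split; exact: set_mem.
    by rewrite AB.
  - by rewrite addr0.
  - by rewrite add0r.
  - by rewrite addr0.
have nuM (A B : set T) : A `<=` B -> nu A <= nu B.
  move=> AB; apply: Lle => // x; rewrite !indicE ler_nat.
  by case: (boolP (x \in A)) => // /set_mem/AB/mem_set ->.
have nuT : nu setT = 1.
  by rewrite -L1; congr L; apply/funext => x; rewrite indicE in_setT.
have nuC A : nu (~` A) = 1 - nu A.
  by have := nuD A (~` A); rewrite setICr setUCr nuT => /(_ erefl) ->; lra.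
have tight e : 0 < e -> exists2 C, compact C & 1 - e <= nu C.
  by move=> /Ltight[C cC h]; exists C => //; move: h; rewrite -/(nu _) nuC; lra.
have [mu muU] := tight_content_probability nuM nuD nuT tight.
exists mu; split.
  move=> U oU LU; apply/eqP; rewrite eq_le measure_ge0 andbT.
  by apply: (le_trans (muU _ oU)); rewrite /nu LU.
pose mT := g_sigma_algebraType (@open T).
have mopen (U : set mT) : @open T U -> measurable U by exact: sub_sigma_algebra.
have mcont (f : T -> R) : continuous f -> measurable_fun setT (f : mT -> R).
  move=> /continuousP cf; apply: (measurability _ (RGenOpens.measurableE R)).
  move=> _ [_ [a [b ->] <-]]; rewrite setTI; apply: mopen.
  exact/cf/interval_open.
have intb (f : mT -> R) : measurable_fun setT f -> bounded_function f ->
    mu.-integrable setT (EFin \o f).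
  move=> mf [M fM]; apply: measurable_bounded_integrable => //.
    by apply: (le_lt_trans (probability_le1 mu (@measurableT _ mT))); rewrite ltry.
  exists M; split; first exact: num_real.
  by move=> M' MM' x _; apply: (le_trans (fM x)); exact: ltW.
have muC (A : set T) : closed A -> nu A <= fine (mu A).
  move=> cA; have mA : measurable (A : set mT).
    by rewrite -(setCK A); apply: measurableC; apply: mopen; exact: closed_openC.
  have := muU _ (closed_openC cA); rewrite probability_setC// nuC.
  rewrite -(fineK (fin_num_measure mu _ mA)) -EFinB lee_fin; lra.
(* One inequality suffices, because it can also be applied to [- f]. *)
suff main (f : T -> R) : continuous f -> bounded_function f -> L f <= Rintegral mu setT f.
  move=> f cf Bf; apply/eqP; rewrite eq_le main//=.
  have BfN : bounded_function (-1 *: f) by exact: BZ.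
  have : L (-1 *: f) <= Rintegral mu setT (-1 *: f).
    by apply: main => //; move=> x; exact: (@cvgZl_tmp _ R^o _ _ _ (-1) f _ (cf x)).
  rewrite LZ// RintegralZl//; last exact: (intb _ (mcont _ cf)).
  by rewrite !mulN1r lerN2.
move=> cf [M fM].
have M0 : 0 <= M by apply: le_trans (fM 0).
have Bf : bounded_function f by exists M.
(* Adding the constant [M] makes the function nonnegative and changes both sides by [M], since [L]
   and [mu] are both normalized. *)
suff main (g : T -> R) : continuous g -> (forall x, 0 <= g x <= 2 * M) ->
    L g <= Rintegral mu setT g.
  have BM : bounded_function (fun=> M) by exact: Bcst.
  have cfM : continuous (f + (fun=> M)).
    by move=> x; apply: cvgD; [exact: cf|exact: cvg_cst].
  have := main _ cfM; rewrite LD// Lcst RintegralD//; last 2 first.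
  - exact: intb (mcont _ cf) Bf.
  - exact: intb (mcont _ (@cst_continuous _ _ M)) BM.
  have -> : Rintegral mu setT (fun=> M) = M.
    have mu1 : fine (mu setT) = 1 by rewrite probability_setT.
    have := @Rintegral_cst _ _ _ mu _ (@measurableT _ mT) M.
    by move=> ->; rewrite -[RHS]mulr1 -mu1.
  rewrite lerD2r; apply=> x.
  by have := fM x; rewrite !fctE ler_norml; lra.
move=> cg g0.
have Bg : bounded_function g.
  by exists (2 * M) => x; have /andP[h1 h2] := g0 x; rewrite ger0_norm.
apply/ler_addgt0Pr => h h0.
(* Enough levels of height [h] that level [N + 1] lies above the bound [2 * M], as [layer_sum_ge]
   requires. *)
pose N := Num.trunc (2 * M / h).
have Nh : 2 * M < N.+1%:R * h.
  rewrite -ltr_pdivrMr//; exact: (truncnS_gt (2 * M / h)).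
(* The inequality is not strict so that these sets are closed, where [mu] is at least the
   content. *)
pose A k := [set x | k.+1%:R * h <= g x].
have cA k : closed (A k).
  by move/continuous_closedP : cg => /(_ [set y | k.+1%:R * h <= y]); apply; exact: closed_ge.
pose F k : T -> R := h *: \1_(A k).
have BF k : bounded_function (F k) by exact: BZ.
pose s := \sum_(k < N) F k.
have sE x : s x = \sum_(k < N) h * (k.+1%:R * h <= g x)%R%:R.
  rewrite /s fct_sumE; apply: eq_bigr => k _; transitivity (h * \1_(A k) x); first by [].
  rewrite indicE; congr (_ * _%:R).
  by congr nat_of_bool; apply/idP/idP => [/set_mem|hx]; last exact/mem_set.
have Bs : bounded_function s by exact: Bsum.
have Ls : L g <= h + L s.
  rewrite -[h in h + _]Lcst -LD//; apply: Lle => //; first exact: BD.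
  move=> x; rewrite fctE sE; have /andP[g1 g2] := g0 x.
  by apply: layer_sum_ge => //; [exact: ltW|exact: le_lt_trans Nh].
have mA k : measurable (A k : set mT).
  by rewrite -(setCK (A k)); apply: measurableC; apply: mopen; exact: closed_openC.
have mind k : measurable_fun setT (\1_(A k) : mT -> R) by apply: measurable_indic.
have [ms Is] : measurable_fun setT (s : mT -> R) /\
    Rintegral mu setT s = \sum_(k < N) h * fine (mu (A k)).
  rewrite /s; elim: (N) => [|m [mIH IH]].
    rewrite !big_ord0; split; first exact: measurable_cst.
    by rewrite (Rintegral_cst _ (@measurableT _ mT)) mul0r.
  have mhA : measurable_fun setT (F m : mT -> R).
    by apply: measurable_funM => //; exact: measurable_cst.
  rewrite !big_ord_recr/=; split; first exact: measurable_funD.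
  rewrite RintegralD//; last 2 first.
  - by apply: intb => //; exact: Bsum.
  - exact: intb.
  rewrite IH RintegralZl//; last exact: intb.
  by rewrite /Rintegral integral_indic// setIT.
apply: (le_trans Ls); rewrite addrC lerD2r; apply: (@le_trans _ _ (Rintegral mu setT s)).
  rewrite Is Lsum//.
  by apply: ler_sum => k _; rewrite LZ// ler_pM2l//; exact: muC.
apply: le_Rintegral => //; [exact: intb|exact: intb (mcont _ cg) Bg|].
move=> x _; apply: (le_trans (y := s x)); first exact: lexx.
rewrite sE; apply: layer_sum_le; first exact: ltW.
by have /andP[] := g0 x.
Qed.
End Representation.

(** * Directional derivatives and symmetry of second derivatives *)

Section Lines.
Context (R : realType) (V : normedModType R).
Implicit Types (u : V -> R) (p q v w : V).

Lemma is_derive_line u q v (t : R) : differentiable u (q + t *: v) ->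
  is_derive t (1 : R) (fun s : R => u (q + s *: v)) ('D_v u (q + t *: v)).
Proof.
move=> du; have du1 := @diff_derivable _ _ _ u _ v du.
have E : (fun h : R => h^-1 *: (u (q + (h *: (1 : R) + t) *: v) - u (q + t *: v))) =
         (fun h : R => h^-1 *: (u (h *: v + (q + t *: v)) - u (q + t *: v))).
  apply/funext => h; congr (_ *: (u _ - _)).
  by rewrite scalerDl scaler1 addrCA.
apply: DeriveDef; first by rewrite /derivable; move: du1; rewrite /derivable -E.
by rewrite /derive -E.
Qed.

Lemma derive_translate u q v w : 'D_v (fun p => u (p + w)) q = 'D_v u (q + w).
Proof.
rewrite /derive.
have -> : (fun h : R => h^-1 *: (u (h *: v + q + w) - u (q + w))) =
          (fun h : R => h^-1 *: (u (h *: v + (q + w)) - u (q + w))).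
  by apply/funext => h; rewrite addrA.
by [].
Qed.

Lemma deriveDv u q v w : differentiable u q -> 'D_(v + w) u q = 'D_v u q + 'D_w u q.
Proof. by move=> du; rewrite !deriveE// linearD. Qed.

Lemma deriveZv u q (a : R) v : differentiable u q -> 'D_(a *: v) u q = a * 'D_v u q.
Proof. by move=> du; rewrite !deriveE// linearZ. Qed.

Lemma derive_sumv u q n (v : 'I_n -> V) : differentiable u q ->
  'D_(\sum_i v i) u q = \sum_i 'D_(v i) u q.
Proof.
by move=> du; rewrite deriveE// linear_sum; apply: eq_bigr => i _; rewrite deriveE.
Qed.

Lemma mvt_line u q v (h : R) : 0 < h -> (forall p, differentiable u p) ->
  exists2 s, 0 < s < h & u (q + h *: v) - u q = h * 'D_v u (q + s *: v).
Proof.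
move=> h0 du; have dl t := is_derive_line (du (q + t *: v)).
have [|s sh E] := @MVT R (fun s => u (q + s *: v)) _ 0 h h0 (fun x _ => dl x).
  apply: derivable_within_continuous => x _; exact: (@ex_derive _ _ _ _ _ _ _ (dl x)).
exists s; first by move: sh; rewrite in_itv.
by move: E; rewrite scale0r addr0 subr0 mulrC.
Qed.

(* The second difference of u over a small parallelogram is symmetric in v
   and w, and two applications of the mean value theorem express it through
   either mixed derivative. *)
Lemma derive_comm u q v w : (forall p, differentiable u p) ->
  (forall v p, differentiable ('D_v u) p) ->
  (forall v w, continuous ('D_w ('D_v u))) ->
  'D_v ('D_w u) q = 'D_w ('D_v u) q.
Proof.
move=> du d2u c2u.
have rect (a b : V) (h : R) : 0 < h -> exists2 p, `|p| <= h * (`|a| + `|b|) &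
    u (q + h *: a + h *: b) - u (q + h *: a) - u (q + h *: b) + u q
    = h * h * 'D_b ('D_a u) (q + p).
  move=> h0; pose f p := u (p + h *: b) - u p.
  have df p : differentiable f p.
    apply: differentiableB; last exact: du.
    by apply: (@differentiable_comp _ _ _ _ (fun p => p + h *: b) u).
  have Df p : 'D_a f p = 'D_a u (p + h *: b) - 'D_a u p.
    rewrite deriveB; last 2 first.
    - exact/diff_derivable/(differentiable_comp _ (du _)).
    - exact/diff_derivable/du.
    by rewrite derive_translate.
  have [s /andP[s0 sh] E1] := mvt_line q a h0 df.
  have [t /andP[t0 th] E2] := mvt_line (q + s *: a) b h0 (d2u a).
  exists (s *: a + t *: b).
    apply: (le_trans (ler_normD _ _)); rewrite !normrZ !gtr0_norm// mulrDr.
    by apply: lerD; rewrite ler_wpM2r// ltW.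
  move: E1; rewrite Df E2 /f mulrA addrA => <-; ring.
apply/eqP; rewrite -subr_eq0 -normr_le0; apply/ler_addgt0Pr => e e0; rewrite add0r.
have e2 : 0 < e / 2 by rewrite divr_gt0.
have := c2u v w q => /cvgrPdist_le/(_ _ e2).
have := c2u w v q => /cvgrPdist_le/(_ _ e2).
move=> /nbhs_ballP[d1 /= d10 h1] /nbhs_ballP[d2 /= d20 h2].
pose d := Num.min d1 d2; have d0 : 0 < d by rewrite lt_min d10.
(* Both intermediate points lie within [h * (|v| + |w|)] of [q], which is then less than [d]; the
   summand 1 covers the case of two zero directions. *)
pose h := d / 2 / (`|v| + `|w| + 1).
have N0 : 0 < `|v| + `|w| + 1 by rewrite ltr_wpDl// addr_ge0.
have h0 : 0 < h by rewrite !divr_gt0.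
have hd : h * (`|v| + `|w|) < d.
  apply: (@lt_trans _ _ (h * (`|v| + `|w| + 1))); first by rewrite ltr_pM2l// ltrDl.
  by rewrite divfK ?gt_eqF//; rewrite ltr_pdivrMr//; lra.
have [p pN E1] := rect v w h h0.
have [p' pN' E2] := rect w v h h0.
have E : 'D_w ('D_v u) (q + p) = 'D_v ('D_w u) (q + p').
  apply: (mulfI (x := h * h)); first by rewrite mulf_neq0 ?gt_eqF.
  have hE : q + h *: v + h *: w = q + h *: w + h *: v by rewrite addrAC.
  rewrite hE in E1.
  have alg (x y z t k A B : R) :
      x - y - z + t = k * A -> x - z - y + t = k * B -> k * A = k * B.
    by move=> <- <-; ring.
  exact: alg E1 E2.
have b1 : `|'D_v ('D_w u) q - 'D_v ('D_w u) (q + p')| <= e / 2.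
  apply: h1; rewrite -ball_normE /= opprD addNKr normrN.
  by apply: (le_lt_trans pN'); rewrite addrC; apply: (lt_le_trans hd); rewrite ge_min lexx.
have b2 : `|'D_w ('D_v u) q - 'D_w ('D_v u) (q + p)| <= e / 2.
  apply: h2; rewrite -ball_normE /= opprD addNKr normrN.
  by apply: (le_lt_trans pN); apply: (lt_le_trans hd); rewrite ge_min lexx orbT.
rewrite -E in b1; move: b1 b2.
move: ('D_v ('D_w u) q) ('D_w ('D_v u) q) ('D_w ('D_v u) (q + p)) => x y z b1 b2.
rewrite [leRHS](splitr e); apply: (le_trans (ler_distD z _ _)).
by rewrite (distrC z y); exact: (lerD b1 b2).
Qed.

End Lines.

(** * Calculus of smooth functions and of [levi] *)

Section SmoothFunctions.
Context (R : realType) (n : nat).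
Local Notation C := (Cn R n).
Implicit Types (u w : C -> R) (v : C).

Lemma CkW k u : Ck k.+1 u -> Ck k u.
Proof.
elim: k u => [|k IH] u; first by case=> du _ q; exact/differentiable_continuous/du.
by case=> du dvu; split => // v; apply/IH/dvu.
Qed.

Lemma smooth_diff u q : smooth u -> differentiable u q.
Proof. by move=> /(_ 1%N)[]. Qed.

Lemma smooth_derive u v : smooth u -> smooth ('D_v u).
Proof. by move=> su k; have [_] := su k.+1; apply. Qed.

Lemma smooth_continuous u : smooth u -> continuous u.
Proof. by move=> /(_ 0%N). Qed.

Lemma smooth_derivable u q v : smooth u -> derivable u q v.
Proof. by move=> su; exact/diff_derivable/smooth_diff. Qed.

Lemma CkD k u w : Ck k u -> Ck k w -> Ck k (u + w).
Proof.
elim: k u w => [|k IH] u w; first by move=> cu cw q; apply: cvgD; [exact: cu|exact: cw].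
move=> [du hu] [dw hw]; split => [q|v]; first exact: differentiableD.
have -> : 'D_v (u + w) = 'D_v u + 'D_v w.
  by apply/funext => q; rewrite deriveD//; exact: diff_derivable.
by apply: IH; [exact: hu|exact: hw].
Qed.

Lemma CkM k u w : Ck k u -> Ck k w -> Ck k (u * w).
Proof.
elim: k u w => [|k IH] u w; first by move=> cu cw q; apply: cvgM; [exact: cu|exact: cw].
move=> Cu Cw; have [du hu] := Cu; have [dw hw] := Cw.
split => [q|v]; first exact: differentiableM.
have -> : 'D_v (u * w) = u * 'D_v w + w * 'D_v u.
  by apply/funext => q; rewrite deriveM//; exact: diff_derivable.
by apply: CkD; apply: IH; do ?[exact: CkW|exact: hu|exact: hw].
Qed.

Lemma smoothD u w : smooth u -> smooth w -> smooth (u + w).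
Proof. by move=> su sw k; exact: CkD. Qed.

Lemma smoothM u w : smooth u -> smooth w -> smooth (u * w).
Proof. by move=> su sw k; exact: CkM. Qed.

Lemma smooth_cst (c : R) : smooth (cst c : C -> R).
Proof.
move=> k; elim: k c => [|k IH] c; first exact: cst_continuous.
split=> [q|v]; first exact: differentiable_cst.
have -> : 'D_v (cst c) = cst 0 by apply/funext => q; rewrite derive_cst.
exact: IH.
Qed.

Lemma smoothZ (c : R) u : smooth u -> smooth (c *: u).
Proof.
move=> su; have -> : c *: u = cst c * u by [].
by apply: smoothM => //; exact: smooth_cst.
Qed.

Lemma smoothN u : smooth u -> smooth (- u).
Proof. by move=> su; rewrite -scaleN1r; exact: smoothZ. Qed.

Lemma smoothB u w : smooth u -> smooth w -> smooth (u - w).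
Proof. by move=> su sw; apply: smoothD => //; exact: smoothN. Qed.

Lemma smooth_sum I (r : seq I) (F : I -> C -> R) :
  (forall i, smooth (F i)) -> smooth (\sum_(i <- r) F i).
Proof.
move=> sF; elim: r => [|i r IH]; last by rewrite big_cons; exact: smoothD.
by rewrite big_nil; exact: smooth_cst.
Qed.

Lemma smooth_linear u : (forall q, differentiable u q) ->
  (forall v, exists c, 'D_v u = cst c) -> smooth u.
Proof.
move=> du hu [|k]; first by move=> q; exact/differentiable_continuous/du.
by split => // v; have [c ->] := hu v; exact: smooth_cst.
Qed.

Definition re_coord (j : 'I_n) (q : C) : R := q.1 0 j.
Definition im_coord (j : 'I_n) (q : C) : R := q.2 0 j.

Lemma derive_lin (f : C -> R) (q v : C) :
  (forall (a : R) x y, f (a *: x + y) = a * f x + f y) -> 'D_v f q = f v.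
Proof.
move=> fl; rewrite /derive; apply: cvg_lim => //.
apply: (@cvg_trans _ (cst (f v) @ (0 : R)^')); last exact: cvg_cst.
apply: near_eq_cvg; near=> h.
have h0 : h != 0 by near: h; exact: nbhs_dnbhs_neq.
by rewrite /= fl addrK [_ *: _]mulrA mulVf// mul1r.
Unshelve. all: by end_near. Qed.

Lemma re_coord_is_linear j : linear (re_coord j).
Proof. by move=> a x y; rewrite /re_coord/= !mxE. Qed.
HB.instance Definition _ j := GRing.isLinear.Build R C R _ (re_coord j) (re_coord_is_linear j).

Lemma im_coord_is_linear j : linear (im_coord j).
Proof. by move=> a x y; rewrite /im_coord/= !mxE. Qed.
HB.instance Definition _ j := GRing.isLinear.Build R C R _ (im_coord j) (im_coord_is_linear j).

Lemma continuous_re j : continuous (re_coord j).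
Proof.
move=> q; apply: (@continuous_comp _ _ _ fst (fun M : 'rV[R]_n => M 0 j)).
  exact: cvg_fst.
exact: coord_continuous.
Qed.

Lemma continuous_im j : continuous (im_coord j).
Proof.
move=> q; apply: (@continuous_comp _ _ _ snd (fun M : 'rV[R]_n => M 0 j)).
  exact: cvg_snd.
exact: coord_continuous.
Qed.

Lemma diff_re j q : differentiable (re_coord j) q.
Proof. exact/linear_differentiable/continuous_re. Qed.

Lemma diff_im j q : differentiable (im_coord j) q.
Proof. exact/linear_differentiable/continuous_im. Qed.

Lemma derive_re j v : 'D_v (re_coord j) = cst (re_coord j v).
Proof. by apply/funext => q; apply: derive_lin => a x y; rewrite /re_coord/= !mxE. Qed.

Lemma derive_im j v : 'D_v (im_coord j) = cst (im_coord j v).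
Proof. by apply/funext => q; apply: derive_lin => a x y; rewrite /im_coord/= !mxE. Qed.

Lemma smooth_re j : smooth (re_coord j).
Proof. by apply: smooth_linear => [q|v]; [exact: diff_re|rewrite derive_re; eexists]. Qed.

Lemma smooth_im j : smooth (im_coord j).
Proof. by apply: smooth_linear => [q|v]; [exact: diff_im|rewrite derive_im; eexists]. Qed.

Lemma derive_comp1 (h dh : R -> R) u q v : (forall t, is_derive t (1 : R) h (dh t)) ->
  differentiable u q -> differentiable (h \o u) q /\ 'D_v (h \o u) q = dh (u q) * 'D_v u q.
Proof.
move=> hd du.
have dfh : differentiable h (u q).
  by apply/derivable1_diffP; exact: (@ex_derive _ _ _ _ _ _ _ (hd (u q))).
split; first exact: differentiable_comp.
rewrite deriveE; last exact: differentiable_comp.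
by rewrite diff_comp// [LHS]/= (diff1E dfh) -deriveE// derive1E derive_val [LHS]mulrC.
Qed.

(** [H] lists a function of one variable together with all its derivatives. The index [m] must be
    free in the induction, since differentiating [H m \o u] produces [H m.+1 \o u]. *)
Lemma smooth_comp (H : nat -> R -> R) u :
  (forall k t, is_derive t (1 : R) (H k) (H k.+1 t)) -> smooth u ->
  forall m, smooth (H m \o u).
Proof.
move=> Hd su m k; elim: k m => [|k IH] m.
  move=> q; apply: differentiable_continuous.
  by have [] := derive_comp1 0 (Hd m) (smooth_diff q su).
split=> [q|v]; first by have [] := derive_comp1 0 (Hd m) (smooth_diff q su).
have -> : 'D_v (H m \o u) = (H m.+1 \o u) * 'D_v u.
  by apply/funext => q; have [_ ->] := derive_comp1 v (Hd m) (smooth_diff q su).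
by apply: CkM => //; exact: smooth_derive.
Qed.

Definition levi u (q v : C) : R := 'D_v ('D_v u) q + 'D_(cJ v) ('D_(cJ v) u) q.

Lemma smooth_deriveC u (q v v1 : C) : smooth u -> 'D_v ('D_v1 u) q = 'D_v1 ('D_v u) q.
Proof.
move=> su; apply: derive_comm.
- by move=> p; exact: smooth_diff.
- by move=> v' p; exact/smooth_diff/smooth_derive.
- by move=> v' w'; exact/smooth_continuous/smooth_derive/smooth_derive.
Qed.

Lemma leviD u w q v : smooth u -> smooth w -> levi (u + w) q v = levi u q v + levi w q v.
Proof.
move=> su sw; have E v' : 'D_v' (u + w) = 'D_v' u + 'D_v' w.
  by apply/funext => p; rewrite deriveD//; exact: smooth_derivable.
have E2 v' : 'D_v' ('D_v' (u + w)) q = 'D_v' ('D_v' u) q + 'D_v' ('D_v' w) q.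
  by rewrite E deriveD//; exact/smooth_derivable/smooth_derive.
have -> : levi (u + w) q v = 'D_v ('D_v (u + w)) q + 'D_(cJ v) ('D_(cJ v) (u + w)) q by [].
rewrite (E2 v).
rewrite (E2 (cJ v)).
exact: addrACA.
Qed.

Lemma leviZ c u q v : smooth u -> levi (c *: u) q v = c * levi u q v.
Proof.
move=> su; have E v' : 'D_v' (c *: u) = c *: 'D_v' u.
  by apply/funext => p; rewrite deriveZ//; exact: smooth_derivable.
have E2 v' : 'D_v' ('D_v' (c *: u)) q = c * 'D_v' ('D_v' u) q.
  by rewrite E deriveZ//; exact/smooth_derivable/smooth_derive.
have -> : levi (c *: u) q v = 'D_v ('D_v (c *: u)) q + 'D_(cJ v) ('D_(cJ v) (c *: u)) q by [].
rewrite (E2 v).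
rewrite (E2 (cJ v)).
by rewrite -mulrDr.
Qed.

Lemma levi_cst c q v : levi (cst c) q v = 0.
Proof.
have E v' : 'D_v' (cst c : C -> R) = cst 0 by apply/funext => p; rewrite derive_cst.
by rewrite /levi !E !derive_cst addr0.
Qed.

Lemma levi_sum I (r : seq I) (F : I -> C -> R) q v : (forall i, smooth (F i)) ->
  levi (\sum_(i <- r) F i) q v = \sum_(i <- r) levi (F i) q v.
Proof.
move=> sF; elim: r => [|i r IH]; first by rewrite !big_nil; exact: levi_cst.
by rewrite !big_cons leviD ?IH//; exact: smooth_sum.
Qed.

(** For [h] convex and increasing both coefficients are nonnegative, which is why composing with
    such an [h] preserves [levi >= 0]. *)
Lemma levi_comp (h dh ddh : R -> R) u q v :
  (forall t, is_derive t (1 : R) h (dh t)) -> (forall t, is_derive t (1 : R) dh (ddh t)) ->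
  smooth u ->
  levi (h \o u) q v = ddh (u q) * ('D_v u q ^+ 2 + 'D_(cJ v) u q ^+ 2)
                      + dh (u q) * levi u q v.
Proof.
move=> hd dhd su.
have E v' : 'D_v' ('D_v' (h \o u)) q =
    ddh (u q) * 'D_v' u q ^+ 2 + dh (u q) * 'D_v' ('D_v' u) q.
  have -> : 'D_v' (h \o u) = (dh \o u) * 'D_v' u.
    by apply/funext => p; have [_ ->] := derive_comp1 v' hd (smooth_diff p su).
  have [dd Ed] := derive_comp1 v' dhd (smooth_diff q su).
  rewrite deriveM; [|exact: diff_derivable|exact/smooth_derivable/smooth_derive].
  rewrite Ed; move: ('D_v' ('D_v' u) q) ('D_v' u q) (ddh (u q)) => a b c.
  by rewrite -[LHS]/(dh (u q) * a + b * (c * b)); ring.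
have -> : levi (h \o u) q v =
  'D_v ('D_v (h \o u)) q + 'D_(cJ v) ('D_(cJ v) (h \o u)) q by [].
rewrite (E v).
rewrite (E (cJ v)).
have alg (x y a b c d : R) : x * a ^+ 2 + y * b + (x * c ^+ 2 + y * d) =
  x * (a ^+ 2 + c ^+ 2) + y * (b + d) by ring.
exact: alg.
Qed.

Lemma levi_sqr u q v : smooth u -> (forall v, exists c, 'D_v u = cst c) ->
  levi (u * u) q v = 2 * ('D_v u q ^+ 2 + 'D_(cJ v) u q ^+ 2).
Proof.
move=> su hu.
have E v' : 'D_v' ('D_v' (u * u)) q = 2 * 'D_v' u q ^+ 2.
  have [c hc0] := hu v'.
  have hc p : 'D_v' u p = c by have := congr1 (fun f => f p) hc0.
  have -> : 'D_v' (u * u) = (2 * c) *: u.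
    apply/funext => p; rewrite deriveM; do ?exact: smooth_derivable.
    by rewrite hc -[LHS]/(u p * c + u p * c) -[RHS]/(2 * c * u p); ring.
  rewrite deriveZ ?hc; last exact: smooth_derivable.
  by rewrite -[LHS]/(2 * c * c); ring.
have -> : levi (u * u) q v = 'D_v ('D_v (u * u)) q + 'D_(cJ v) ('D_(cJ v) (u * u)) q by [].
rewrite (E v).
rewrite (E (cJ v)).
by move: ('D_v u q) ('D_(cJ v) u q) => a b; ring.
Qed.

End SmoothFunctions.

(** * Convex hulls and Caratheodory's theorem *)

Section ConvexSets.
Context (R : realType) (n : nat).
Local Notation E := 'rV[R]_n.
Implicit Types (K H : set E) (x y k : E).

Lemma convex_setP H : @convex_set R E H <->
  forall x y (t : R), 0 <= t <= 1 -> H x -> H y -> H (t *: x + (1 - t) *: y).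
Proof.
split=> h.
  move=> x y t /andP[t0 t1] Hx Hy.
  have := h x y (Itv01 t0 t1) (mem_set Hx) (mem_set Hy).
  by move=> /set_mem.
move=> x y l /set_mem Hx /set_mem Hy; apply/mem_set.
by apply: h => //; apply/andP; split; [exact: ge0|exact: le1].
Qed.

Lemma convex_hull_convex K : @convex_set R E (convex_hull K).
Proof.
apply/convex_setP => x y t t01 hx hy A [cA KA].
by move/convex_setP : (cA); apply => //; [exact: hx|exact: hy].
Qed.

Lemma sub_convex_hull K : K `<=` convex_hull K.
Proof. by move=> x Kx A [_]; apply. Qed.

Lemma convex_hull_min K H : @convex_set R E H -> K `<=` H -> convex_hull K `<=` H.
Proof. by move=> cH KH x; apply; split. Qed.

(** The combinations of [m + 1] points of [K]. Adding one point at a time presents each step as a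
    continuous image of a product with [[0, 1]], so compactness passes from one step to the next. *)
Fixpoint hull_step K m : set E :=
  if m is m'.+1 then [set p.1.1 *: p.1.2 + (1 - p.1.1) *: p.2 |
    p in (`[0, 1]%classic `*` hull_step K m') `*` K] else K.

Lemma compact_hull_step K m : compact K -> compact (hull_step K m).
Proof.
move=> cK; elim: m => [//|m IH] /=; apply: continuous_compact.
  apply: continuous_subspaceT => p; apply: cvgD.
    apply: cvgZ; [exact: (cvg_comp _ _ cvg_fst cvg_fst)|].
    exact: (cvg_comp _ _ cvg_fst cvg_snd).
  apply: cvgZ; last exact: cvg_snd.
  by apply: cvgB; [exact: cvg_cst|exact: (cvg_comp _ _ cvg_fst cvg_fst)].
by apply: compact_setX => //; apply: compact_setX => //; exact: segment_compact.
Qed.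

Lemma sub_hull_step K m : K `<=` hull_step K m.
Proof.
elim: m => [//|m IH] x Kx; exists ((0, x), x) => /=.
  by split => //; split; [rewrite /= in_itv/= lexx ler01|exact: IH].
by rewrite scale0r add0r subr0 scale1r.
Qed.

Lemma hull_step_hull K m : hull_step K m `<=` convex_hull K.
Proof.
elim: m => [|m IH]; first exact: sub_convex_hull.
move=> _ [[[t a] k] [[t01 ha] Kk] <-] /=.
move/convex_setP : (@convex_hull_convex K); apply => //; first exact: IH.
exact: sub_convex_hull.
Qed.

Lemma hull_stepS K m x k (t : R) : 0 <= t <= 1 -> hull_step K m x -> K k ->
  hull_step K m.+1 (t *: x + (1 - t) *: k).
Proof. by move=> t01 hx Kk; exists ((t, x), k). Qed.

Lemma convex_hull_steps K : convex_hull K `<=` \bigcup_m hull_step K m.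
Proof.
apply: convex_hull_min; last by move=> x Kx; exists 0%N.
apply/convex_setP => x y s s01 [m _ hx] [p _].
elim: p y s s01 => [|p IH] y s s01 hy.
  by exists m.+1 => //; exact: hull_stepS.
case: hy => [[[t b] k] [[/= t01 hb] Kk] <-] /=.
have {}t01 : 0 <= t <= 1 by move: t01; rewrite in_itv.
(* [r] is the total weight of everything except [k]: the combination equals [r] times the point
   dividing [x] and [b] in ratio [s / r], plus [(1 - r) *: k]. If [r = 0] it is [k] itself. *)
pose r := s + (1 - s) * t.
have r01 : 0 <= r <= 1.
  rewrite /r; have := mulr_ge0 (x := 1 - s) (y := 1 - t).
  have := mulr_ge0 (x := 1 - s) (y := t); lra.
have [r0|r0] := eqVneq r 0.
  have s0 : s = 0.
    have := mulr_ge0 (x := 1 - s) (y := t); move: r0; rewrite /r; lra.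
  have t0 : t = 0 by move: r0; rewrite /r s0; lra.
  exists 0%N => //=; rewrite s0 t0 !scale0r !add0r subr0 !scale1r.
  exact: Kk.
have sr01 : 0 <= s / r <= 1.
  have rp : 0 < r by rewrite lt_neqAle eq_sym r0; case/andP : r01.
  apply/andP; split; first by rewrite divr_ge0//; lra.
  by rewrite ler_pdivrMr// mul1r /r lerDl mulr_ge0//; lra.
have [q _ hq] := IH b (s / r) sr01 hb.
exists q.+1 => //; have := hull_stepS r01 hq Kk; congr (hull_step _ _ _).
rewrite !scalerDr !scalerA addrA; congr (_ + _ + _).
- by rewrite mulrCA divff// mulr1.
- by congr (_ *: _); rewrite /r; field.
- by congr (_ *: _); rewrite /r; ring.
Qed.

Definition combination K m x : Prop := exists (t : 'I_m -> R) (k : 'I_m -> E),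
  [/\ forall i, 0 <= t i, \sum_i t i = 1, forall i, K (k i) & x = \sum_i t i *: k i].

Lemma step_combination K m : hull_step K m `<=` combination K m.+1.
Proof.
elim: m => [|m IH] x.
  move=> Kx; exists (fun=> 1), (fun=> x); split => //; first by rewrite big_ord1.
  by rewrite big_ord1 scale1r.
move=> [[[t a] k] [[/= t01 ha] Kk] <-] /=.
have {}t01 : 0 <= t <= 1 by move: t01; rewrite in_itv.
have [s [l [s0 s1 Kl ->]]] := IH _ ha.
exists (fun i => if unlift ord0 i is Some j then t * s j else 1 - t).
exists (fun i => if unlift ord0 i is Some j then l j else k).
split.
- by move=> i; case: (unlift ord0 i) => [j|]; [rewrite mulr_ge0//; lra|lra].
- rewrite big_ord_recl/= unlift_none; under eq_bigr do rewrite liftK.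
  by rewrite -mulr_sumr s1; ring.
- by move=> i; case: (unlift ord0 i).
- rewrite [RHS]big_ord_recl unlift_none [RHS]addrC; congr (_ + _).
  by rewrite scaler_sumr; apply: eq_bigr => i _; rewrite liftK scalerA.
Qed.

(** One point is split off and the other weights are divided by their sum [r]; if [r = 0] these
    weights all vanish and only the split point is left. *)
Lemma combination_step K m : combination K m.+1 `<=` hull_step K m.
Proof.
elim: m => [|m IH] x [t [k [t0 t1 Kk ->]]].
  by move: t1; rewrite !big_ord1 => ->; rewrite scale1r; exact: Kk.
rewrite big_ord_recl addrC.
pose r := \sum_(i < m.+1) t (lift ord0 i).
have t0r : t ord0 = 1 - r by move: t1; rewrite big_ord_recl -/r => <-; rewrite addrK.
have r0 : 0 <= r by apply: sumr_ge0.
have r01 : 0 <= r <= 1 by have := t0 ord0; rewrite t0r; lra.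
have [rz|rnz] := eqVneq r 0.
  have -> : \sum_(i < m.+1) t (lift ord0 i) *: k (lift ord0 i) = 0.
    apply: big1 => i _; have /eqP := rz; rewrite psumr_eq0//.
    by move=> /allP/(_ i (mem_index_enum _))/eqP ->; rewrite scale0r.
  by rewrite add0r t0r rz subr0 scale1r; apply: sub_hull_step.
rewrite t0r.
have -> : \sum_(i < m.+1) t (lift ord0 i) *: k (lift ord0 i) =
    r *: \sum_(i < m.+1) (t (lift ord0 i) / r) *: k (lift ord0 i).
  rewrite scaler_sumr; apply: eq_bigr => i _; rewrite scalerA; congr (_ *: _).
  by rewrite mulrCA divff// mulr1.
apply: hull_stepS => //; apply: IH.
exists (fun i => t (lift ord0 i) / r), (fun i => k (lift ord0 i)); split => //.
  by move=> i; rewrite divr_ge0.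
by rewrite -mulr_suml divff.
Qed.

(* Caratheodory: an affine dependence among more than n + 1 points lets one
   of them be dropped. *)
Lemma combination_reduce K m : (n < m)%N -> combination K m.+1 `<=` combination K m.
Proof.
move=> nm x [t [k [t0 t1 Kk ->]]].
(* The extra column of ones makes a row vector in the left kernel an affine dependence: its entries
   sum to zero. It exists because there are more rows than columns. *)
pose M : 'M[R]_(m.+1, n + 1) := \matrix_(i < m.+1) row_mx (k i) (1 : 'rV_1).
have [c c0 cM] : exists2 c : 'rV[R]_m.+1, c != 0 & c *m M = 0.
  have : (\rank M < m.+1)%N.
    by apply: (leq_ltn_trans (rank_leq_col _)); rewrite addn1 ltnS.
  move=> rM; have : kermx M != 0.
    rewrite -mxrank_eq0 mxrank_ker -lt0n subn_gt0//.
  move=> /rowV0Pn[c /sub_kermxP cM c0]; exists c => //.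
have ck : \sum_i c 0 i *: k i = 0.
  apply/rowP => j; have := congr1 (fun A : 'rV_(n + 1) => A 0 (lshift 1 j)) cM.
  rewrite !mxE summxE => h; rewrite -[RHS]h; apply: eq_bigr => i _.
  by rewrite !mxE (unsplitK (inl j)).
have cs : \sum_i c 0 i = 0.
  have := congr1 (fun A : 'rV_(n + 1) => A 0 (rshift n ord0)) cM.
  rewrite !mxE => h; rewrite -[RHS]h; apply: eq_bigr => i _.
  by rewrite !mxE (unsplitK (inr ord0)) mxE mulr1.
have [i1 ci1] : exists i, 0 < c 0 i.
  apply: contrapT => hn; move/negP : c0; apply; apply/eqP/rowP => i; rewrite mxE.
  have hle j : c 0 j <= 0 by rewrite leNgt; apply/negP => h; apply: hn; exists j.
  have /eqP := cs; rewrite -oppr_eq0 -sumrN psumr_eq0; last by move=> j _; rewrite oppr_ge0.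
  by move=> /allP/(_ i (mem_index_enum _)); rewrite oppr_eq0 => /eqP.
(* Subtracting the smallest ratio [t i / c 0 i] times the dependence keeps all weights nonnegative
   and annihilates the one at [i0]. *)
have [i0 ci0 hmin] := @Order.TotalTheory.arg_minP _ _ _ i1 (fun i => 0 < c 0 i)
  (fun i => t i / c 0 i) ci1.
pose l := t i0 / c 0 i0.
have l0 : 0 <= l by rewrite divr_ge0// ltW.
pose s i := t i - l * c 0 i.
have s0 i : 0 <= s i.
  rewrite /s subr_ge0; have [ci|ci] := ltrP 0 (c 0 i).
    by rewrite -ler_pdivlMr//; exact: hmin.
  by apply: le_trans (t0 i); rewrite mulr_ge0_le0.
have si0 : s i0 = 0 by rewrite /s /l divfK ?gt_eqF// subrr.
have ss : \sum_i s i = 1 by rewrite sumrB -mulr_sumr cs mulr0 subr0.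
have sk : \sum_i s i *: k i = \sum_i t i *: k i.
  rewrite (eq_bigr (fun i => t i *: k i - l *: (c 0 i *: k i))).
    by rewrite sumrB -scaler_sumr ck scaler0 subr0.
  by move=> i _; rewrite scalerBl scalerA.
exists (s \o lift i0), (k \o lift i0); split => //.
- by move=> i; exact: s0.
- by rewrite -ss (bigD1_ord i0)//= si0 add0r.
- by move=> i; exact: Kk.
- by rewrite -sk (bigD1_ord i0)//= si0 scale0r add0r.
Qed.

(** The hull is the single step [hull_step K n]: longer combinations are shortened to [n + 1]
    points, shorter ones are padded with points of weight zero. *)
Theorem compact_convex_hull K : compact K -> compact (convex_hull K).
Proof.
move=> cK; suff -> : convex_hull K = hull_step K n by exact: compact_hull_step.
apply/seteqP; split; last exact: hull_step_hull.
move=> x /convex_hull_steps[m _] /step_combination h.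
apply: combination_step.
have red p : combination K (n.+1 + p) `<=` combination K n.+1.
  elim: p => [|p IH]; first by rewrite addn0.
  move=> y; rewrite addnS => /combination_reduce hy; apply: IH; apply: hy.
  by rewrite leq_addr.
have [mn|nm] := leqP m n.
  have up p : combination K m.+1 `<=` hull_step K (m + p).
    elim: p => [|p IH]; first by rewrite addn0; exact: combination_step.
    move=> y hy; rewrite addnS; have [t [k [_ t1 Kk _]]] := hy.
    have := hull_stepS (x := y) (k := k ord0) (t := 1) _ (IH _ hy) (Kk _).
    by rewrite ler01 lexx scale1r subrr scale0r addr0; apply.
  by apply: step_combination; rewrite -(subnKC mn); exact: up.
by apply: (red (m - n)%N); rewrite addSn subnKC// ltnW.
Qed.

End ConvexSets.

(** * Separation of a point from a compact convex set by a ball *)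

Section BallSeparation.
Context (R : realType) (n : nat).
Local Notation E := 'rV[R]_n.
Implicit Types (H : set E) (x y : E).

Definition rsq x : R := \sum_j x 0 j ^+ 2.
Definition rdot x y : R := \sum_j x 0 j * y 0 j.

Lemma rsq_ge0 x : 0 <= rsq x.
Proof. by apply: sumr_ge0 => j _; exact: sqr_ge0. Qed.

Lemma rsq_eq0 x : rsq x = 0 -> x = 0.
Proof.
move=> /eqP; rewrite psumr_eq0; last by move=> j _; exact: sqr_ge0.
move=> /allP h; apply/rowP => j; rewrite mxE.
by have := h j (mem_index_enum _); rewrite sqrf_eq0 => /eqP.
Qed.

Lemma rsqD x y (t : R) : rsq (x + t *: y) = rsq x + 2 * t * rdot x y + t ^+ 2 * rsq y.
Proof.
rewrite /rsq /rdot !mulr_sumr -!big_split/=; apply: eq_bigr => j _.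
by rewrite !mxE; ring.
Qed.

Lemma continuous_rsq (c : E) : continuous (fun x => rsq (x - c)).
Proof.
move=> x; rewrite /rsq.
have -> : (fun y : E => \sum_j (y - c) 0 j ^+ 2) =
   \sum_j (fun y : E => (y 0 j - c 0 j) * (y 0 j - c 0 j)).
  by apply/funext => y; rewrite fct_sumE; apply: eq_bigr => j _; rewrite !mxE expr2.
apply: (big_ind (fun f : E -> R => {for x, continuous f})).
- exact: (@cst_continuous E R 0).
- by move=> f g cf cg; exact: (cvgD cf cg).
- move=> j _; have h : {for x, continuous (fun y : E => y 0 j - c 0 j)}.
    exact: (cvgB (@coord_continuous _ _ _ 0 j x) (@cvg_cst _ _ _ _ _)).
  exact: (cvgM h h).
Qed.

Lemma compact_rsq_bound H (c : E) : compact H -> exists2 M, 0 <= M &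
  forall x, H x -> rsq (x - c) <= M.
Proof.
move=> cH; have [[h Hh]|He] := pselect (H !=set0); last first.
  by exists 0 => // x Hx; exfalso; apply: He; exists x.
have [||p _ hp] := compact_EVT_max (f := fun x => rsq (x - c)) _ cH; first by exists h.
  by apply: continuous_subspaceT; exact: continuous_rsq.
by exists (rsq (p - c)); [exact: rsq_ge0|move=> x Hx; apply: hp; exact: mem_set].
Qed.

(* The ball is centred far away on the line through x0 and its nearest point
   in H. *)
Lemma ball_separation H x0 : compact H -> @convex_set R E H -> ~ H x0 ->
  exists (c : E) (r : R), (forall x, H x -> rsq (x - c) < r) /\ r < rsq (x0 - c).
Proof.
move=> cH /convex_setP cvH nH.
have [[h Hh]|He] := pselect (H !=set0); last first.
  exists x0, (-1); split; last by rewrite (lt_le_trans _ (rsq_ge0 _)).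
  by move=> x Hx; exfalso; apply: He; exists x.
have [||p /set_mem Hp hp] := compact_EVT_min (f := fun x => rsq (x - x0)) _ cH.
- by exists h.
- by apply: continuous_subspaceT; exact: continuous_rsq.
pose d := p - x0.
have d0 : 0 < rsq d.
  rewrite lt_neqAle rsq_ge0 andbT eq_sym; apply/eqP => /rsq_eq0 /eqP.
  by rewrite subr_eq0 => /eqP px; apply: nH; rewrite -px.
(* The variational inequality at the nearest point [p]: otherwise a short move from [p] towards [x]
   would come closer to [x0]. *)
have dotge x : H x -> 0 <= rdot d (x - p).
  move=> Hx; rewrite leNgt; apply/negP => hlt.
  pose a := - rdot d (x - p); have a0 : 0 < a by rewrite oppr_gt0.
  pose b := rsq (x - p); have b0 : 0 <= b by exact: rsq_ge0.
  (* The squared distance changes by [- 2 * t * a + t ^+ 2 * b], which is negative as soon as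
     [t * b < 2 * a]; [b + 1] avoids a division by zero. *)
  pose t := Num.min 1 (a / (b + 1)).
  have t0 : 0 < t by rewrite lt_min ltr01 divr_gt0// ltr_wpDl.
  have t1 : t <= 1 by rewrite ge_min lexx.
  have tb : t * b < 2 * a.
    have : t <= a / (b + 1) by rewrite ge_min lexx orbT.
    by rewrite ler_pdivlMr ?ltr_wpDl//; nra.
  have Ht : H (t *: x + (1 - t) *: p) by apply: cvH => //; rewrite (ltW t0).
  have := hp _ (mem_set Ht).
  have -> : t *: x + (1 - t) *: p - x0 = d + t *: (x - p).
    by apply/rowP => j; rewrite /d !mxE; ring.
  rewrite rsqD -/d -/b; rewrite -/a in tb *; rewrite /a in tb; nra.
have [D D0 hD] := compact_rsq_bound p cH.
(* Chosen so that [2 * l * rsq d = D + 1]. Points of [H] have squared distance at most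
   [D + l ^+ 2 * rsq d] from the centre, while [x0] has [rsq d + (D + 1) + l ^+ 2 * rsq d]; the
   radius fits strictly between. *)
pose l := (D + 1) / (2 * rsq d).
have l0 : 0 <= l by rewrite divr_ge0// ?addr_ge0// mulr_ge0// ltW.
have l2 : 2 * l * rsq d = D + 1 by rewrite /l; field; rewrite gt_eqF.
exists (p + l *: d), (D + l ^+ 2 * rsq d + rsq d / 2); split.
  move=> x Hx; have -> : x - (p + l *: d) = (x - p) + (- l) *: d.
    by rewrite opprD addrA scaleNr.
  rewrite rsqD; have := hD _ Hx; have := dotge _ Hx.
  have -> : rdot (x - p) d = rdot d (x - p) by apply: eq_bigr => j _; rewrite mulrC.
  move=> h1 h2; have h3 : 0 <= l * rdot d (x - p) by rewrite mulr_ge0.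
  rewrite sqrrN; lra.
have -> : x0 - (p + l *: d) = - (1 + l) *: d.
  by apply/rowP => j; rewrite /d !mxE; ring.
have -> : rsq (- (1 + l) *: d) = (1 + l) ^+ 2 * rsq d.
  by rewrite /rsq mulr_sumr; apply: eq_bigr => j _; rewrite mxE; ring.
rewrite sqrrD expr1n !mulrDl mul1r; lra.
Qed.

End BallSeparation.

(** * Maximum principle and three lines argument *)

Section MaximumPrinciple.
Context (R : realType).

(** If [d2 > 0], then [df], which vanishes at the maximum, is positive just to the right of [c], and
    the mean value theorem makes [f] exceed [f c]. *)
Lemma second_derivative_max (f df : R -> R) (c d2 e : R) : 0 < e ->
  (forall t, is_derive t (1 : R) f (df t)) -> is_derive c (1 : R) df d2 ->
  (forall t, `|t - c| < e -> f t <= f c) -> d2 <= 0.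
Proof.
move=> e0 fd dfd fmax; rewrite leNgt; apply/negP => d20.
have dfc : df c = 0.
  have h : is_derive c (1 : R) f 0.
    apply: (@derive1_at_max _ f (c - e) (c + e)).
    - lra.
    - by move=> t _; exact: (@ex_derive _ _ _ _ _ _ _ (fd t)).
    - by rewrite in_itv/=; lra.
    - by move=> t; rewrite in_itv/= => tc; apply: fmax; rewrite ltr_norml; lra.
  by rewrite -(@derive_val _ _ _ _ _ _ _ h) (@derive_val _ _ _ _ _ _ _ (fd c)).
have [dd dv] := dfd; move: dd; rewrite /derivable => dd.
have : (fun h : R => h^-1 *: (df (h *: (1 : R) + c) - df c)) @ (0 : R)^' --> d2.
  by rewrite -dv.
move=> /cvgrPdist_lt/(_ _ d20) /nbhs_ballP[r /= r0 hr].
pose h := Num.min r e / 2.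
have m0 : 0 < Num.min r e by rewrite lt_min r0.
have h0 : 0 < h by rewrite divr_gt0.
have hr' : h < r by rewrite /h; have : Num.min r e <= r; [rewrite ge_min lexx|lra].
have he : h < e by rewrite /h; have : Num.min r e <= e; [rewrite ge_min lexx orbT|lra].
have [s sh E] := @MVT R f df c (c + h) (ltac:(lra)) (fun x _ => fd x)
   (derivable_within_continuous (fun x _ => @ex_derive _ _ _ _ _ _ _ (fd x))).
have := fmax (c + h); rewrite addrAC subrr add0r gtr0_norm// => /(_ he).
have sc : 0 < s - c < h by move: sh; rewrite in_itv/=; lra.
have : 0 < df s.
  have := hr (s - c); rewrite /ball/= sub0r normrN gtr0_norm; last lra.
  move=> /(_ (ltac:(lra))) => hh.
  have {}hh := hh (ltac:(by rewrite gt_eqF//; lra)).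
  move: hh; rewrite dfc subr0 [_%:A]mulr1 subrK => hh.
  have h2 : 0 < (s - c)^-1 * df s by move: hh; rewrite ltr_norml -[_ *: _]/(_ * _); lra.
  by rewrite pmulr_rgt0 in h2 => //; rewrite invr_gt0; lra.
move=> dfs; rewrite leNgt => /negP; apply; rewrite -subr_gt0 E mulr_gt0//; lra.
Qed.

End MaximumPrinciple.

Section ThreeLines.
Context (R : realType) (n : nat).
Local Notation C := (Cn R n).

Lemma three_lines (u : C -> R) (p y d : 'rV[R]_n) (B : R) : smooth u ->
  let w s t : C := (p + s *: d, y + t *: d) in
  (forall s t, 0 <= s <= 1 -> 0 <= levi u (w s t) (d, 0)) ->
  (forall t, u (w 0 t) <= 0) -> (forall t, u (w 1 t) <= 0) ->
  (forall s t, 0 <= s <= 1 -> u (w s t) <= B) ->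
  forall s, 0 <= s <= 1 -> u (w s 0) <= 0.
Proof.
move=> su w hlevi h0 h1 hB s0 s01; apply/ler_addgt0Pr => e e0; rewrite add0r.
have alg (x z : R) : x + 2 * e <= 0 -> z + 2 * - (e / 2) <= 0 -> 0 <= x + z -> False by lra.
(* The perturbation has Laplacian [2 * e - e > 0], which forbids an interior maximum. On the sides
   of the strip it is at most [e], and its decay in [z.2] defeats the bound [B] far out. *)
pose g (z : R * R) := u (w z.1 z.2) + e * (z.1 * z.1) - e / 2 * (z.2 * z.2).
(* Large enough that [g] is nonpositive at height [M] of the strip, which is [MB] below. *)
pose M := 1 + 2 * `|B| / e + 2.
have a0 : 0 <= 2 * `|B| / e by rewrite divr_ge0// ?mulr_ge0// ltW.
have M0 : 0 < M by rewrite /M; lra.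
have MB : B + e <= e / 2 * (M * M).
  have Be : e * (2 * `|B| / e) = 2 * `|B| by rewrite mulrC divfK// gt_eqF.
  have : M <= M * M by rewrite ler_peMr//; [exact: ltW|rewrite /M; lra].
  move=> MM; apply: (@le_trans _ _ (e / 2 * M)); last by rewrite ler_pM2l// divr_gt0.
  have := ler_norm B; rewrite /M; nra.
have cg : continuous g.
  move=> z; have cw : {for z, continuous (fun z : R * R => w z.1 z.2)}.
    have c1 : {for z, continuous (fun z : R * R => p + z.1 *: d)}.
      exact: (cvgD (cvg_cst _) (cvgZr_tmp cvg_fst)).
    have c2 : {for z, continuous (fun z : R * R => y + z.2 *: d)}.
      exact: (cvgD (cvg_cst _) (cvgZr_tmp cvg_snd)).
    exact: (cvg_pair c1 c2).
  have cu : {for z, continuous (fun z : R * R => u (w z.1 z.2))}.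
    by apply: (continuous_comp cw); exact: smooth_continuous.
  have c1 : {for z, continuous (fun z : R * R => e * (z.1 * z.1))}.
    exact: (cvgM (cvg_cst _) (cvgM cvg_fst cvg_fst)).
  have c2 : {for z, continuous (fun z : R * R => e / 2 * (z.2 * z.2))}.
    exact: (cvgM (cvg_cst _) (cvgM cvg_snd cvg_snd)).
  exact: (cvgB (cvgD cu c1) c2).
pose D := `[0 : R, 1]%classic `*` `[- M, M]%classic.
have cD : compact D by apply: compact_setX; exact: segment_compact.
have [||[s t] /set_mem[/= hs ht] hmax] := compact_EVT_max (f := g) _ cD.
- by exists (0, 0); split; rewrite /= in_itv/=; lra.
- exact: continuous_subspaceT.
have {}hs : 0 <= s <= 1 by move: hs; rewrite in_itv.
have {}ht : - M <= t <= M by move: ht; rewrite in_itv.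
suff gm : g (s, t) <= e.
  have : g (s0, 0) <= g (s, t).
    apply: hmax; apply/mem_set; split; rewrite /= in_itv/=; first exact: s01.
    by rewrite oppr_le0 !(ltW M0).
  rewrite {1}/g /= => h.
  have : 0 <= e * (s0 * s0) by apply: mulr_ge0; [exact: ltW|rewrite -expr2 sqr_ge0].
  lra.
have t2 : 0 <= e / 2 * (t * t) by apply: mulr_ge0; [rewrite divr_ge0// ltW|rewrite -expr2 sqr_ge0].
have [->|sn0] := eqVneq s 0; first by rewrite /g/=; have := h0 t; lra.
have [->|sn1] := eqVneq s 1; first by rewrite /g/=; have := h1 t; lra.
have [tM|tM] := eqVneq (t * t) (M * M).
  rewrite /g/= tM; have := hB s t hs.
  have : e * (s * s) <= e by rewrite ger_pMr//; nra.
  lra.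
have hs01 := hs.
have {}hs : 0 < s < 1 by rewrite !lt_neqAle eq_sym sn0 sn1.
have {}ht : - M < t < M.
  rewrite !lt_neqAle; case/andP : ht => -> ->; rewrite !andbT; apply/andP; split.
    by apply: contra tM => /eqP <-; rewrite mulrNN.
  by apply: contra tM => /eqP ->.
exfalso.
pose v : C := (d, 0); pose v' : C := (0, d).
have wv h : w (s + h) t = w s t + h *: v.
  by rewrite /w /v; congr pair; rewrite /= ?scaler0 ?addr0// scalerDl addrA.
have wv' h : w s (t + h) = w s t + h *: v'.
  by rewrite /w /v; congr pair; rewrite /= ?scaler0 ?addr0// scalerDl addrA.
have gmax s' t' : 0 <= s' <= 1 -> - M <= t' <= M -> g (s', t') <= g (s, t).
  by move=> ? ?; apply: hmax; apply/mem_set; split; rewrite /= in_itv.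
have du q : differentiable u q by exact: smooth_diff.
have d2u z q : differentiable ('D_z u) q by exact/smooth_diff/smooth_derive.
have L1 := is_derive_line (q := w s t) (v := v) (du _).
have L2 := is_derive_line (q := w s t) (v := v) (d2u v _).
have L1' := is_derive_line (q := w s t) (v := v') (du _).
have L2' := is_derive_line (q := w s t) (v := v') (d2u v' _).
(* The second derivative test for [f] plus a quadratic term. It is used with [k = e] along [v] and
   [k = - (e / 2)] along [v']; the sum of the two inequalities contradicts [levi >= 0]. *)
have key (f df : R -> R) (a b k z : R) : (forall r, is_derive r (1 : R) f (df r)) ->
   is_derive (0 : R) (1 : R) df z -> 0 < a ->
   (forall r, `|r| < a -> f r + k * (b + r) ^+ 2 <= f 0 + k * b ^+ 2) ->
   z + 2 * k <= 0.
  move=> fd dfd ap fm.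
  have qd r : is_derive r (1 : R) (fun r => k * (b + r) ^+ 2) (2 * k * (b + r)).
    apply: is_derive_eq; have alg1 (x : R) : k * (x * ((0 + 1) * 1) + x * (0 + 1)) = 2 * k * x.
      by ring.
    exact: alg1.
  have ld : is_derive (0 : R) (1 : R) (fun r => 2 * k * (b + r)) (2 * k).
    by apply: is_derive_eq; rewrite add0r [LHS]mulr1.
  apply: (@second_derivative_max R (fun r => f r + k * (b + r) ^+ 2)
     (fun r => df r + 2 * k * (b + r)) 0 _ a) => //.
  by move=> r; rewrite subr0 addr0; exact: fm.
have K1 := key _ _ (Num.min s (1 - s)) s e _ L1 (L2 0).
have K2 := key _ _ (Num.min (t + M) (M - t)) t (- (e / 2)) _ L1' (L2' 0).
have {}K1 : 'D_v ('D_v u) (w s t) + 2 * e <= 0.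
  rewrite scale0r addr0 in K1; apply: K1; first by rewrite lt_min; lra.
  move=> r; rewrite lt_min !ltr_norml => hr.
  have := gmax (s + r) t; rewrite /g /= wv !expr2 => h; have := h (ltac:(lra)) (ltac:(lra)); lra.
have {}K2 : 'D_v' ('D_v' u) (w s t) + 2 * - (e / 2) <= 0.
  rewrite scale0r addr0 in K2; apply: K2; first by rewrite lt_min; lra.
  move=> r; rewrite lt_min !ltr_norml => hr.
  have := gmax s (t + r); rewrite /g /= wv' !expr2 => h; have := h (ltac:(lra)) (ltac:(lra)); lra.
have hl := hlevi s t hs01.
have vE : cJ (d, 0) = v' by rewrite /cJ /v' /= oppr0.
rewrite /levi vE in hl.
exact: alg K1 K2 hl.
Qed.

End ThreeLines.

(** * Smooth functions flat at the origin *)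

Section FlatFunctions.
Context (R : realType).
Implicit Types (P : {poly R}) (t : R).

(** With a polynomial factor in [1 / t] the family is closed under differentiation, through
    [flat_deriv]; one estimate at 0, valid for every [P], then yields derivatives of all orders. *)
Definition flat P t : R := if 0 < t then P.[t^-1] * expR (- t^-1) else 0.

Definition flat_deriv P : {poly R} := 'X^2 * (P - P^`()).

Lemma flat_le0 P t : t <= 0 -> flat P t = 0.
Proof. by rewrite /flat leNgt => /negbTE ->. Qed.

Lemma flat_gt0 P t : 0 < t -> flat P t = P.[t^-1] * expR (- t^-1).
Proof. by rewrite /flat => ->. Qed.

(** For [s = 1 / t >= 1] the polynomial is at most a constant times [s ^+ m], and the exponential
    series gives [expR (- s) <= (m.+2)! / s ^+ m.+2]. The two spare powers give a zero derivative at
    the origin. *)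
Lemma flat_bound P : exists2 C, 0 <= C & forall t, 0 < t <= 1 -> `|flat P t| <= C * t ^+ 2.
Proof.
pose S := \sum_(i < size P) `|P`_i|; pose m := size P.
have S0 : 0 <= S by apply: sumr_ge0.
exists (S * (m.+2)`!%:R); first by rewrite mulr_ge0.
move=> t /andP[t0 t1]; rewrite flat_gt0//.
set s := t^-1; have s0 : 0 < s by rewrite invr_gt0.
have s1 : 1 <= s by rewrite invf_ge1.
have hP : `|P.[s]| <= S * s ^+ m.
  rewrite horner_coef /S mulr_suml; apply: (le_trans (ler_norm_sum _ _ _)).
  apply: ler_sum => i _; rewrite normrM ler_wpM2l// normrX gtr0_norm//.
  by rewrite ler_weXn2l// ltnW.
have f0 : 0 < (m.+2)`!%:R :> R by rewrite ltr0n fact_gt0.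
have sp : 0 < s ^+ m.+2 by rewrite exprn_gt0.
have he : expR (- s) <= (m.+2)`!%:R / s ^+ m.+2.
  rewrite expRN -[leRHS]invrK lef_pV2 ?posrE ?expR_gt0 ?invr_gt0 ?divr_gt0//.
  rewrite invf_div; have := expR_ge1Dxn m.+1 (ltW s0); lra.
rewrite normrM (ger0_norm (expR_ge0 _)).
apply: (le_trans (ler_pM _ _ hP he)) => //.
have -> : t ^+ 2 = (s ^+ 2)^-1 by rewrite -exprVn /s invrK.
have -> : s ^+ m.+2 = s ^+ m * s ^+ 2 by rewrite -exprD addn2.
by rewrite le_eqVlt; apply/orP; left; apply/eqP; field; rewrite !expf_neq0// gt_eqF.
Qed.

Lemma is_derive_flat P t : is_derive t (1 : R) (flat P) (flat (flat_deriv P) t).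
Proof.
have [t0|t0|->] := ltgtP t 0.
- rewrite (flat_le0 _ (ltW t0)).
  apply: (@near_eq_is_derive _ _ _ (cst 0)).
  have := open_nbhs_nbhs (conj (@open_lt R 0) t0).
  by apply: filterS => s /= s0; rewrite flat_le0// ltW.
- have tn : t != 0 by rewrite gt_eqF.
  have dV : is_derive t (1 : R) (fun s : R => s^-1) (- t ^- 2 * 1).
    exact: (@is_deriveV _ id t 1 1 tn (is_derive_id _ _)).
  have dP := @is_derive1_comp _ (horner P) (fun s : R => s^-1) t _ _ (is_derive_poly P _) dV.
  have dE := @is_derive1_comp _ expR (fun s : R => - s^-1) t _ _ (is_derive_expR _)
    (is_deriveN dV).
  have dM := is_deriveM dP dE.
  have -> : flat (flat_deriv P) t = (horner P \o (fun s : R => s^-1)) t *: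
      (expR (- t^-1) * - (- t ^- 2 * 1)) +
      (expR \o (fun s : R => - s^-1)) t *: (P^`().[t^-1] * (- t ^- 2 * 1)).
    rewrite flat_gt0// /flat_deriv hornerM hornerXn hornerD hornerN expr2.
    have alg (p p' x e : R) : x * x * (p - p') * e =
      p * (e * - (- (x * x) * 1)) + e * (p' * (- (x * x) * 1)) by ring.
    have -> : t ^- 2 = t^-1 * t^-1 by rewrite -exprVn expr2.
    exact: alg.
  apply: (@near_eq_is_derive _ _ _ _ _ _ _ _ _ dM).
  have := open_nbhs_nbhs (conj (@open_gt R 0) t0).
  by apply: filterS => s /= s0; rewrite flat_gt0.
- rewrite (flat_le0 _ (lexx 0)).
  have [C C0 hC] := flat_bound P.
  have lim0 : (fun h : R => h^-1 *: (flat P (h *: (1 : R) + 0) - flat P 0)) @ (0 : R)^' --> (0 : R).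
    apply/cvgrPdist_le => e e0; apply/nbhs_ballP.
    have d0 : 0 < e / (C + 1) by rewrite divr_gt0// ltr_wpDl.
    have [m [m0 m1 m2]] : exists m, [/\ 0 < m, m <= 1 & m <= e / (C + 1)].
      exists (Num.min 1 (e / (C + 1))).
      by rewrite lt_min ltr01 d0 !ge_min !lexx orbT.
    exists m; first exact: m0.
    move=> h; rewrite /ball/= !sub0r !normrN => hh hn.
    rewrite addr0 [_%:A]mulr1 (flat_le0 _ (lexx 0)) subr0 -[_ *: _]/(_ * _) normrM.
    have [hp|hp] := ltrP 0 h; last by rewrite (flat_le0 _ hp) normr0 mulr0 ltW.
    rewrite gtr0_norm ?invr_gt0// ler_pdivrMl//.
    move: hh; rewrite (gtr0_norm hp) => hm.
    apply: (le_trans (hC h _)); first by rewrite hp (le_trans (ltW hm)).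
    rewrite expr2 mulrCA ler_pM2l//.
    have := lt_le_trans hm m2; rewrite ltr_pdivlMr ?ltr_wpDl// => h2; nra.
  apply: DeriveDef; first by rewrite /derivable; apply/cvg_ex; exists 0.
  by rewrite /derive; apply: cvg_lim.
Qed.

(* Unlike exp (- 1 / t), the function t * exp (- 1 / t) is convex on the whole line. *)
Definition ramp t : R := t * flat 1 t.

Lemma is_derive_ramp t : is_derive t (1 : R) ramp (flat (1 + 'X) t).
Proof.
have d := is_deriveM (is_derive_id t (1 : R)) (is_derive_flat 1 t).
have -> : flat (1 + 'X) t = t *: flat (flat_deriv 1) t + flat 1 t *: 1.
  have [t0|t0] := ltrP 0 t; last by rewrite !(flat_le0 _ t0) scaler0 scale0r addr0.
  rewrite !flat_gt0// /flat_deriv derivC subr0 mulr1 hornerD hornerXn hornerC hornerX.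
  have alg (x y e : R) : x * y = 1 -> (1 + y) * e = x * (y ^+ 2 * e) + (1 * e) * 1.
    by move=> xy; rewrite expr2 !mulrA xy; ring.
  by apply: alg; rewrite divff// gt_eqF.
exact: d.
Qed.

(** All derivatives of [ramp], in the form expected by [smooth_comp]. Index 0 is separate because
    the factor [t] is not a polynomial in [1 / t]. *)
Definition ramp_family k : R -> R :=
  if k is k'.+1 then flat (iter k' flat_deriv (1 + 'X)) else ramp.

Lemma is_derive_ramp_family k t :
  is_derive t (1 : R) (ramp_family k) (ramp_family k.+1 t).
Proof. by case: k => [|k]; [exact: is_derive_ramp|exact: is_derive_flat]. Qed.

Lemma ramp_le0 t : t <= 0 -> ramp t = 0.
Proof. by move=> t0; rewrite /ramp flat_le0// mulr0. Qed.

Lemma ramp_gt0 t : 0 < t -> 0 < ramp t.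
Proof. by move=> t0; rewrite /ramp flat_gt0// hornerC mul1r mulr_gt0// expR_gt0. Qed.

Lemma ramp_ge0 t : 0 <= ramp t.
Proof. by have [/ramp_gt0/ltW//|/ramp_le0 ->] := ltrP 0 t. Qed.

(** From [expR (- t^-1) >= 1 - t^-1]. This linear growth later makes the region where the corrected
    [rho] is nonnegative bounded. *)
Lemma ramp_ge t : t - 1 <= ramp t.
Proof.
have [t0|t0] := ltrP 0 t; last by rewrite ramp_le0//; lra.
rewrite /ramp flat_gt0// hornerC mul1r.
have := expR_ge1Dx (- t^-1); rewrite -(ler_pM2l t0) mulrDr mulr1 mulrN divff ?gt_eqF//.
Qed.

Lemma ramp1_ge0 t : 0 <= ramp_family 1 t.
Proof.
have [t0|t0] := ltrP 0 t; last by rewrite /= flat_le0.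
rewrite /= flat_gt0// hornerD hornerC hornerX mulr_ge0 ?expR_ge0//.
by rewrite addr_ge0// invr_ge0 ltW.
Qed.

Lemma ramp1_gt0 t : 0 < t -> 0 < ramp_family 1 t.
Proof.
move=> t0; rewrite /= flat_gt0// hornerD hornerC hornerX mulr_gt0 ?expR_gt0//.
by rewrite addr_gt0// invr_gt0.
Qed.

(** The polynomial of the second derivative is ['X^2 * ((1 + 'X) - 1)], that is, the cube of
    ['X]. *)
Lemma ramp2_ge0 t : 0 <= ramp_family 2 t.
Proof.
have [t0|t0] := ltrP 0 t; last by rewrite /= flat_le0.
rewrite /= flat_gt0// mulr_ge0 ?expR_ge0//.
rewrite /flat_deriv derivD derivC derivX add0r hornerM hornerXn addrAC subrr add0r hornerX.
by rewrite mulr_ge0 ?sqr_ge0// invr_ge0 ltW.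
Qed.

End FlatFunctions.

Local Open Scope complex_scope.

(** * Complex parts and pointwise algebra of (1,1)-covectors *)

Section ComplexParts.
Context (R : realType).
Implicit Types x y : R[i].

Lemma cReD x y : complex.Re (x + y) = complex.Re x + complex.Re y.
Proof. by case: x; case: y. Qed.
Lemma cImD x y : complex.Im (x + y) = complex.Im x + complex.Im y.
Proof. by case: x; case: y. Qed.
Lemma Re_sum I (r : seq I) (F : I -> R[i]) :
  complex.Re (\sum_(i <- r) F i) = \sum_(i <- r) complex.Re (F i).
Proof. by apply: (big_morph _ cReD). Qed.
Lemma Im_sum I (r : seq I) (F : I -> R[i]) :
  complex.Im (\sum_(i <- r) F i) = \sum_(i <- r) complex.Im (F i).
Proof. by apply: (big_morph _ cImD). Qed.
Lemma cReM x y : complex.Re (x * y) =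
  complex.Re x * complex.Re y - complex.Im x * complex.Im y.
Proof. by case: x => a b; case: y. Qed.
Lemma cImM x y : complex.Im (x * y) =
  complex.Re x * complex.Im y + complex.Im x * complex.Re y.
Proof. by case: x => a b; case: y. Qed.

Lemma complex_eq x y : complex.Re x = complex.Re y -> complex.Im x = complex.Im y -> x = y.
Proof. by case: x => a b; case: y => c d /= -> ->. Qed.

Lemma normc_ReIm x : Normc.normc x = Num.sqrt (complex.Re x ^+ 2 + complex.Im x ^+ 2).
Proof. by case: x. Qed.

Lemma normRe_le x : `|complex.Re x| <= Normc.normc x.
Proof.
rewrite normc_ReIm -sqrtr_sqr ler_sqrt ?lerDl ?sqr_ge0//.
by rewrite addr_ge0 ?sqr_ge0.
Qed.

Lemma normIm_le x : `|complex.Im x| <= Normc.normc x.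
Proof.
rewrite normc_ReIm -sqrtr_sqr ler_sqrt ?lerDr ?sqr_ge0//.
by rewrite addr_ge0 ?sqr_ge0.
Qed.

Lemma normc_le x : Normc.normc x <= `|complex.Re x| + `|complex.Im x|.
Proof.
rewrite normc_ReIm -[leRHS]ger0_norm ?addr_ge0// -sqrtr_sqr ler_sqrt ?sqr_ge0//.
rewrite sqrrD !real_normK ?num_real// lerD2r lerDl.
by rewrite mulrn_wge0// mulr_ge0.
Qed.

Lemma real_ge0 x : (0 <= x) = (complex.Im x == 0) && (0 <= complex.Re x).
Proof. by rewrite lecE/=. Qed.

End ComplexParts.

Section Covectors.
Context (R : realType) (n : nat).
Local Notation C := (Cn R n).
Implicit Types (A B : 'M[R[i]]_n) (v w : C).

Definition sqnorm v : R := \sum_j (v.1 0 j ^+ 2 + v.2 0 j ^+ 2).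

Lemma sqnorm_ge0 v : 0 <= sqnorm v.
Proof. by apply: sumr_ge0 => j _; rewrite addr_ge0 ?sqr_ge0. Qed.

(** The quadratic form whose sign defines positivity; a coefficient matrix enters the estimates
    below only through it. *)
Definition phi A v : R[i] := covector_eval A v (cJ v).

Lemma phi_Re A v : complex.Re (phi A v) = \sum_j \sum_k
  2 * (complex.Im (A j k) * (v.1 0 j * v.1 0 k + v.2 0 j * v.2 0 k)
       + complex.Re (A j k) * (v.2 0 j * v.1 0 k - v.1 0 j * v.2 0 k)).
Proof.
rewrite /phi /covector_eval Re_sum; apply: eq_bigr => j _.
rewrite Re_sum; apply: eq_bigr => k _.
rewrite /zcoord /cJ /= !mxE; case: (A j k) => a b /=; ring.
Qed.

Lemma phi_Im A v : complex.Im (phi A v) = \sum_j \sum_k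
  (- 2) * (complex.Re (A j k) * (v.1 0 j * v.1 0 k + v.2 0 j * v.2 0 k)
       - complex.Im (A j k) * (v.2 0 j * v.1 0 k - v.1 0 j * v.2 0 k)).
Proof.
rewrite /phi /covector_eval Im_sum; apply: eq_bigr => j _.
rewrite Im_sum; apply: eq_bigr => k _.
rewrite /zcoord /cJ /= !mxE; case: (A j k) => a b /=; ring.
Qed.

Lemma phiD A B v : phi (A + B) v = phi A v + phi B v.
Proof.
rewrite /phi /covector_eval -big_split/=; apply: eq_bigr => j _.
by rewrite -big_split/=; apply: eq_bigr => k _; rewrite mxE mulrDl.
Qed.

Lemma phiZ (c : R[i]) A v : phi (c *: A) v = c * phi A v.
Proof.
rewrite /phi /covector_eval mulr_sumr; apply: eq_bigr => j _.
by rewrite mulr_sumr; apply: eq_bigr => k _; rewrite mxE mulrA.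
Qed.

Lemma phi0 v : phi 0 v = 0.
Proof. by rewrite -(scale0r (0 : 'M[R[i]]_n)) phiZ mul0r. Qed.

(* dz_j /\ dzbar_k has conjugate - dz_k /\ dzbar_j. *)
Definition conj_form A : 'M[R[i]]_n := \matrix_(j, k) (- (A k j)^*).

Lemma phi_conj A v : phi (conj_form A) v = (phi A v)^*.
Proof.
apply: complex_eq.
  have -> : complex.Re (phi A v)^* = complex.Re (phi A v) by case: (phi A v).
  rewrite !phi_Re exchange_big; apply: eq_bigr => j _; apply: eq_bigr => k _.
  by rewrite !mxE; case: (A j k) => a b /=; ring.
have -> : complex.Im (phi A v)^* = - complex.Im (phi A v) by case: (phi A v).
rewrite !phi_Im exchange_big -sumrN; apply: eq_bigr => j _.
rewrite -sumrN; apply: eq_bigr => k _.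
by rewrite !mxE; case: (A j k) => a b /=; ring.
Qed.

(** The standard Kaehler form, normalized so that [phi] is the squared Euclidean norm. *)
Definition std_form : 'M[R[i]]_n := (('i%C : R[i]) / 2)%:M.

Lemma phi_std v : phi std_form v = (sqnorm v)%:C.
Proof.
have h : ('i%C : R[i]) / 2 = 0 +i* (2^-1).
  apply: (mulIf (x := 2)); first by rewrite pnatr_eq0.
  rewrite divfK ?pnatr_eq0//; apply: complex_eq; rewrite ?cReM ?cImM/=; lra.
have E j k : std_form j k = 0 +i* ((j == k)%:R / 2).
  by rewrite mxE h; case: eqP => _; rewrite ?mulr1n ?mulr0n ?mul1r ?mul0r.
apply: complex_eq.
  rewrite phi_Re; apply: eq_bigr => j _; rewrite (bigD1 j)//= big1 ?addr0.
    by rewrite E eqxx/=; field.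
  by move=> k kj; rewrite E eq_sym (negbTE kj)/=; ring.
rewrite phi_Im; apply: big1 => j _; rewrite (bigD1 j)//= big1 ?addr0.
  by rewrite E eqxx/=; ring.
by move=> k kj; rewrite E eq_sym (negbTE kj)/=; ring.
Qed.

Lemma zcoord_le v j : Normc.normc (zcoord v j) ^+ 2 <= sqnorm v.
Proof.
rewrite normc_ReIm sqr_sqrtr ?addr_ge0 ?sqr_ge0//= /sqnorm (bigD1 j)//= lerDl.
by apply: sumr_ge0 => k _; rewrite addr_ge0 ?sqr_ge0.
Qed.

Lemma phi_le A (b : R) v : (forall j k, Normc.normc (A j k) <= b) ->
  Normc.normc (phi A v) <= n%:R * n%:R * (2 * b) * sqnorm v.
Proof.
move=> Ab.
have normc_sum I (r : seq I) (F : I -> R[i]) :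
    Normc.normc (\sum_(i <- r) F i) <= \sum_(i <- r) Normc.normc (F i).
  elim: r => [|i r IH]; first by rewrite !big_nil /Normc.normc/= !expr0n/= addr0 sqrtr0.
  by rewrite !big_cons; apply: (le_trans (le_normcD _ _)); rewrite lerD2l.
have -> : n%:R * n%:R * (2 * b) * sqnorm v = \sum_(j < n) \sum_(k < n) b * (2 * sqnorm v).
  by rewrite !sumr_const !card_ord -mulrnA -[RHS]mulr_natr natrM; ring.
apply: (le_trans (normc_sum _ _ _)); apply: ler_sum => j _.
apply: (le_trans (normc_sum _ _ _)); apply: ler_sum => k _.
rewrite Normc.normcM; apply: ler_pM => //; [by case: (A j k) => *; exact: sqrtr_ge0| |].
  by case: (_ - _) => *; exact: sqrtr_ge0.
(* [cJ] multiplies coordinates by [i], so the two products coincide up to sign and add up. *)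
have -> : zcoord v j * (zcoord (cJ v) k)^* - zcoord (cJ v) j * (zcoord v k)^* =
   (- 2%:R * 'i%C) * (zcoord v j * (zcoord v k)^*).
  by apply: complex_eq; rewrite /zcoord /cJ /= !mxE; ring.
rewrite !Normc.normcM; set x := zcoord v j; set y := zcoord v k.
have -> : Normc.normc (- 2%:R : R[i]) = 2.
  have -> : - 2%:R = (- 2)%:C :> R[i] by rewrite rmorphN rmorph_nat.
  by rewrite normc_ReIm/= expr0n/= addr0 sqrtr_sqr normrN ger0_norm.
have -> : Normc.normc ('i%C : R[i]) = 1.
  by rewrite normc_ReIm/= expr0n/= add0r expr1n sqrtr1.
have -> : Normc.normc y^* = Normc.normc y.
  by rewrite !normc_ReIm; case: y => c d /=; rewrite sqrrN.
rewrite mulr1 ler_pM2l//.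
have := zcoord_le v j; have := zcoord_le v k; rewrite -/x -/y => h1 h2.
have := sqr_ge0 (Normc.normc x - Normc.normc y); nra.
Qed.

Lemma eucl_normE v : eucl_norm v = Num.sqrt (sqnorm v).
Proof. by []. Qed.

Lemma sqnormZ (a : R) v : sqnorm (a *: v) = a ^+ 2 * sqnorm v.
Proof.
rewrite /sqnorm mulr_sumr; apply: eq_bigr => j _; rewrite /= !mxE; ring.
Qed.

Lemma sqnormJ v : sqnorm (cJ v) = sqnorm v.
Proof. by apply: eq_bigr => j _; rewrite /= mxE sqrrN addrC. Qed.

Lemma phiZv A (a : R) v : phi A (a *: v) = (a ^+ 2)%:C * phi A v.
Proof.
rewrite /phi /covector_eval mulr_sumr; apply: eq_bigr => j _.
rewrite mulr_sumr; apply: eq_bigr => k _.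
apply: complex_eq; rewrite /zcoord /cJ /= !mxE; case: (A j k) => p q /=; ring.
Qed.

Lemma sqnorm_eq0 v : sqnorm v = 0 -> v = 0.
Proof.
move=> /eqP; rewrite psumr_eq0; last by move=> j _; rewrite addr_ge0 ?sqr_ge0.
move=> /allP h; case: v h => x y h.
have E j : x 0 j = 0 /\ y 0 j = 0.
  have /= := h j (mem_index_enum _); rewrite paddr_eq0 ?sqr_ge0// !sqrf_eq0.
  by move=> /andP[/eqP -> /eqP ->].
by congr pair; apply/rowP => j; have [h1 h2] := E j; rewrite mxE.
Qed.

(** [cJ] is an isometry and [phi] is homogeneous of degree 2, so a nonzero [v] can be scaled to unit
    length, where [v] and [cJ v] compete in the comass. *)
Lemma phi_comass A v : (comass A <= 1)%E -> Normc.normc (phi A v) <= sqnorm v.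
Proof.
move=> cA; have [v0|v0] := eqVneq (sqnorm v) 0.
  by rewrite v0 (sqnorm_eq0 v0) -(scale0r (0 : C)) phiZv expr0n/= mul0r normc_ReIm/=
     expr0n/= addr0 sqrtr0.
have vp : 0 < sqnorm v by rewrite lt_neqAle eq_sym v0 sqnorm_ge0.
pose t := (Num.sqrt (sqnorm v))^-1.
have t2 : t ^+ 2 = (sqnorm v)^-1 by rewrite exprVn sqr_sqrtr// ltW.
have e1 : eucl_norm (t *: v) <= 1.
  by rewrite eucl_normE sqnormZ t2 mulVf// sqrtr1.
have e2 : eucl_norm (cJ (t *: v)) <= 1 by rewrite eucl_normE sqnormJ -eucl_normE.
have : ((Normc.normc (phi A (t *: v)))%:E <= comass A)%E.
  by apply: ereal_sup_ubound; exists (t *: v), (cJ (t *: v)).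
move=> /le_trans/(_ cA); rewrite lee_fin phiZv Normc.normcM t2.
have -> : Normc.normc ((sqnorm v)^-1)%:C = (sqnorm v)^-1.
  by rewrite normc_ReIm/= expr0n/= addr0 sqrtr_sqr ger0_norm// invr_ge0 ltW.
by rewrite mulrC ler_pdivrMr// mul1r.
Qed.

End Covectors.

(** * The form [ddc u] and its values on complex lines *)

Section Ddc.
Context (R : realType) (n : nat).
Local Notation C := (Cn R n).
Implicit Types (u : C -> R) (v : C).
Local Notation dx j := (dir_x j : C).
Local Notation dy j := (dir_y j : C).

Lemma vec_expand v : v = \sum_j (v.1 0 j *: dx j + v.2 0 j *: dy j).
Proof.
rewrite [LHS]surjective_pairing [RHS]surjective_pairing.
have h1 (F : 'I_n -> C) : (\sum_j F j).1 = \sum_j (F j).1.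
  by apply: (big_morph fst (id1 := 0) (op1 := +%R)).
have h2 (F : 'I_n -> C) : (\sum_j F j).2 = \sum_j (F j).2.
  by apply: (big_morph snd (id1 := 0) (op1 := +%R)).
rewrite h1 h2; congr pair; rewrite [LHS]row_sum_delta; apply: eq_bigr => j _ /=.
  by rewrite scaler0 addr0.
by rewrite scaler0 add0r.
Qed.

Lemma derive_half u q w (a : R) : smooth u ->
  'D_w (fun p => a * u p) q = a * 'D_w u q.
Proof. by move=> su; rewrite -[fun p => _]/(a *: u) deriveZ//; exact: smooth_derivable. Qed.

Lemma d_zbarE u k p : d_zbar k (fun p => (u p)%:C) p =
  (2^-1 * 'D_(dx k) u p) +i* (2^-1 * 'D_(dy k) u p).
Proof.
have h : (2%:R : R[i])^-1 = (2^-1)%:C by rewrite fmorphV rmorph_nat.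
rewrite /d_zbar h /cderive.
have E0 w : 'D_w (fun q : C => complex.Im (u q)%:C) p = 0.
  have -> : (fun q : C => complex.Im (u q)%:C) = cst 0 by [].
  exact: derive_cst.
have -> : (fun q : C => complex.Re (u q)%:C) = u by [].
rewrite (E0 (dx k)) (E0 (dy k)).
apply: complex_eq => /=; move: ('D_(dx k) _ p) ('D_(dy k) _ p) => a b; ring.
Qed.

Lemma ddcE u q j k : smooth u -> ddc u q j k =
  (2^-1 * ('D_(dy j) ('D_(dx k) u) q - 'D_(dx j) ('D_(dy k) u) q)) +i*
  (2^-1 * ('D_(dx j) ('D_(dx k) u) q + 'D_(dy j) ('D_(dy k) u) q)).
Proof.
move=> su; rewrite mxE.
have h : (2%:R : R[i])^-1 = (2^-1)%:C by rewrite fmorphV rmorph_nat.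
have -> : d_zbar k (fun p => (u p)%:C) =
    (fun p => (2^-1 * 'D_(dx k) u p) +i* (2^-1 * 'D_(dy k) u p)).
  by apply/funext => p; exact: d_zbarE.
have sx := smooth_derive (dx k) su; have sy := smooth_derive (dy k) su.
have E w : cderive w (fun p => (2^-1 * 'D_(dx k) u p) +i* (2^-1 * 'D_(dy k) u p)) q =
    (2^-1 * 'D_w ('D_(dx k) u) q) +i* (2^-1 * 'D_w ('D_(dy k) u) q).
  by apply: complex_eq; [exact: (derive_half q w _ sx)|exact: (derive_half q w _ sy)].
rewrite /d_z h (E (dx j)) (E (dy j)).
have alg (a b c d : R) : 2%:R * 'i%C * (((2^-1 * a) +i* (2^-1 * b)
    - 'i%C * ((2^-1 * c) +i* (2^-1 * d))) * (2^-1)%:C) =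
    (2^-1 * (c - b)) +i* (2^-1 * (a + d)) :> R[i].
  by apply: complex_eq => /=; field.
exact: alg.
Qed.

Lemma derive_expand u q v : differentiable u q -> 'D_v u q =
  \sum_j (v.1 0 j * 'D_(dx j) u q + v.2 0 j * 'D_(dy j) u q).
Proof.
move=> du; rewrite {1}(vec_expand v) derive_sumv//; apply: eq_bigr => j _.
by rewrite deriveDv// !deriveZv.
Qed.

Lemma derive2_expand u q v : smooth u -> 'D_v ('D_v u) q =
  \sum_j \sum_k (v.1 0 j * v.1 0 k * 'D_(dx j) ('D_(dx k) u) q
    + v.1 0 j * v.2 0 k * 'D_(dx j) ('D_(dy k) u) q
    + v.2 0 j * v.1 0 k * 'D_(dy j) ('D_(dx k) u) q
    + v.2 0 j * v.2 0 k * 'D_(dy j) ('D_(dy k) u) q).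
Proof.
move=> su; have sd w := smooth_derive w su.
have Dw w : 'D_w ('D_v u) q =
    \sum_k (v.1 0 k * 'D_w ('D_(dx k) u) q + v.2 0 k * 'D_w ('D_(dy k) u) q).
  have -> : 'D_v u = \sum_k (v.1 0 k *: 'D_(dx k) u + v.2 0 k *: 'D_(dy k) u).
    apply/funext => p; rewrite derive_expand; last exact: smooth_diff.
    by rewrite fct_sumE; apply: eq_bigr.
  rewrite derive_sum; last first.
    by move=> k; apply: derivableD; apply: derivableZ; exact/smooth_derivable/sd.
  apply: eq_bigr => k _; rewrite deriveD; last 2 first.
  - by apply: derivableZ; exact/smooth_derivable/sd.
  - by apply: derivableZ; exact/smooth_derivable/sd.
  rewrite deriveZ; last exact/smooth_derivable/sd.
  by rewrite deriveZ; last exact/smooth_derivable/sd.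
transitivity (\sum_j (v.1 0 j * 'D_(dx j) ('D_v u) q + v.2 0 j * 'D_(dy j) ('D_v u) q)).
  exact/derive_expand/smooth_diff/sd.
pose G w := \sum_k (v.1 0 k * 'D_w ('D_(dx k) u) q + v.2 0 k * 'D_w ('D_(dy k) u) q).
transitivity (\sum_j (v.1 0 j * G (dx j) + v.2 0 j * G (dy j))).
  by apply: eq_bigr => j _; congr (_ * _ + _ * _); exact: Dw.
apply: eq_bigr => j _; rewrite /G !mulr_sumr -big_split/=.
apply: eq_bigr => k _.
have alg (x y x' y' a b c d : R) : x * (x' * a + y' * b) + y * (x' * c + y' * d) =
  x * x' * a + x * y' * b + y * x' * c + y * y' * d by ring.
exact: alg.
Qed.

(** The real part is the expansion of the second derivatives along [v] and [cJ v] in coordinates.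
    The imaginary part vanishes because, by symmetry of second derivatives, its summand [F] is
    antisymmetric in the two indices. *)
Lemma phi_ddc u q v : smooth u -> phi (ddc u q) v = (levi u q v)%:C.
Proof.
move=> su; apply: complex_eq.
  rewrite phi_Re; apply/esym.
  apply: etrans (congr2 +%R (derive2_expand q v su) (derive2_expand q (cJ v) su)) _.
  apply/esym; rewrite -big_split/=; apply: eq_bigr => j _.
  rewrite -big_split/=; apply: eq_bigr => k _.
  rewrite (ddcE q j k su) /= !mxE.
  have alg (x y x' y' a b c d : R) :
    2 * (2^-1 * (a + d) * (x * x' + y * y') + 2^-1 * (c - b) * (y * x' - x * y')) =
    x * x' * a + x * y' * b + y * x' * c + y * y' * d +
    (- y * - y' * a + - y * x' * b + x * - y' * c + x * x' * d) by field.
  exact: alg.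
rewrite phi_Im [RHS]/=.
pose F j k := - 2 * (complex.Re (ddc u q j k) * (v.1 0 j * v.1 0 k + v.2 0 j * v.2 0 k)
       - complex.Im (ddc u q j k) * (v.2 0 j * v.1 0 k - v.1 0 j * v.2 0 k)).
have anti j k : F j k = - F k j.
  rewrite /F (ddcE q j k su) (ddcE q k j su).
  have alg (x y x' y' a b c d a' b' c' d' : R) :
      a = a' -> b = b' -> c = c' -> d = d' ->
      - 2 * (2^-1 * (c - b) * (x * x' + y * y') - 2^-1 * (a + d) * (y * x' - x * y')) =
      - (- 2 * (2^-1 * (b' - c') * (x' * x + y' * y) - 2^-1 * (a' + d') * (y' * x - x' * y))).
    by move=> -> -> -> ->; field.
  exact: alg (smooth_deriveC q (dx j) (dx k) su) (smooth_deriveC q (dx j) (dy k) su)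
    (smooth_deriveC q (dy j) (dx k) su) (smooth_deriveC q (dy j) (dy k) su).
suff : \sum_j \sum_k F j k = - \sum_j \sum_k F j k.
  move=> h; transitivity (\sum_j \sum_k F j k) => //; lra.
rewrite {1}exchange_big -sumrN; apply: eq_bigr => j _.
by rewrite -sumrN; apply: eq_bigr => k _; rewrite [LHS]anti.
Qed.

Lemma smooth_ddc u : smooth u -> forall j k,
  smooth (fun q => complex.Re (ddc u q j k)) /\ smooth (fun q => complex.Im (ddc u q j k)).
Proof.
move=> su j k; have sd v w : smooth ('D_w ('D_v u)) by exact/smooth_derive/smooth_derive.
split.
  have -> : (fun q => complex.Re (ddc u q j k)) =
     2^-1 *: ('D_(dy j) ('D_(dx k) u) - 'D_(dx j) ('D_(dy k) u)).
    by apply/funext => q; rewrite ddcE.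
  by apply/smoothZ/smoothB; exact: sd.
have -> : (fun q => complex.Im (ddc u q j k)) =
   2^-1 *: ('D_(dx j) ('D_(dx k) u) + 'D_(dy j) ('D_(dy k) u)).
  by apply/funext => q; rewrite ddcE.
by apply/smoothZ/smoothD; exact: sd.
Qed.

End Ddc.

(** * Supports, test forms and positive currents *)

Section Supports.
Context (R : realType) (n : nat).
Local Notation C := (Cn R n).
Implicit Types (u : C -> R) (q v : C).

Lemma fsupp_closed (V : nmodType) (f : C -> V) : closed (fsupp f).
Proof. exact: closed_closure. Qed.

Lemma fsupp_sub (V : nmodType) (f : C -> V) (D : set C) : closed D ->
  (forall q, ~ D q -> f q = 0) -> fsupp f `<=` D.
Proof.
move=> cD h; rewrite /fsupp [X in _ `<=` X](closure_id D).1//.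
by apply: closure_subset => q /= fq; apply: contrapT => nD; exact/fq/h.
Qed.

Lemma notin_fsupp (V : nmodType) (f : C -> V) q : ~ fsupp f q -> f q = 0.
Proof. by move=> nq; apply: contrapT => fq; apply/nq/subset_closure. Qed.

Lemma fsupp_compact (V : nmodType) (f : C -> V) (D : set C) : compact D ->
  (forall q, ~ D q -> f q = 0) -> compact (fsupp f).
Proof.
move=> cD h; apply: (subclosed_compact _ cD); first exact: fsupp_closed.
by apply: fsupp_sub => //; apply: compact_closed => //; exact: norm_hausdorff.
Qed.

Lemma derive_notin_fsupp u q v : ~ fsupp u q -> 'D_v u q = 0.
Proof.
move=> nq; have E : \near q, u q = cst 0 q.
  have := open_nbhs_nbhs (conj (closed_openC (@fsupp_closed _ u)) nq).
  by apply: filterS => p /= /notin_fsupp.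
have -> : 'D_v u q = 'D_v (cst 0) q by exact: near_eq_derive.
exact: derive_cst.
Qed.

Lemma fsupp_derive u v : fsupp ('D_v u) `<=` fsupp u.
Proof.
by apply: fsupp_sub; [exact: fsupp_closed|move=> q; exact: derive_notin_fsupp].
Qed.

Lemma derive2_notin_fsupp u q v w : ~ fsupp u q -> 'D_w ('D_v u) q = 0.
Proof. by move=> nq; apply: derive_notin_fsupp => /fsupp_derive. Qed.

Lemma fsupp_ddc u : smooth u -> forall q, ~ fsupp u q -> ddc u q = 0.
Proof.
move=> su q nq; apply/matrixP => j k; rewrite (ddcE q j k su) mxE.
have E v w : 'D_w ('D_v u) q = 0 by exact: derive2_notin_fsupp.
have alg (a b c d : R) : a = 0 -> b = 0 -> c = 0 -> d = 0 ->
    (2^-1 * (a - b)) +i* (2^-1 * (c + d)) = 0 :> R[i].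
  by move=> -> -> -> ->; rewrite subrr addr0 mulr0.
exact: alg (E _ _) (E _ _) (E _ _) (E _ _).
Qed.

Lemma test_form_ddc u : test_function u -> test_form (ddc u).
Proof.
move=> [su cu]; split; first exact: smooth_ddc.
by apply: (fsupp_compact cu); exact: fsupp_ddc.
Qed.

End Supports.

Section TestForms.
Context (R : realType) (n : nat).
Local Notation C := (Cn R n).
Implicit Types (a b : form11 R n) (q v : C).

Lemma test_form_lin (c : R[i]) a b : test_form a -> test_form b ->
  test_form (fun q => c *: a q + b q).
Proof.
move=> [sa ca] [sb cb]; split.
  move=> j k; have [ra ia] := sa j k; have [rb ib] := sb j k; split.
    have -> : (fun q => complex.Re ((c *: a q + b q) j k)) =
      complex.Re c *: (fun q => complex.Re (a q j k))
      - complex.Im c *: (fun q => complex.Im (a q j k)) + (fun q => complex.Re (b q j k)).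
      by apply/funext => q; rewrite !mxE cReD cReM.
    by apply: smoothD => //; apply: smoothB; exact: smoothZ.
  have -> : (fun q => complex.Im ((c *: a q + b q) j k)) =
    complex.Re c *: (fun q => complex.Im (a q j k))
    + complex.Im c *: (fun q => complex.Re (a q j k)) + (fun q => complex.Im (b q j k)).
    by apply/funext => q; rewrite !mxE cImD cImM.
  by apply: smoothD => //; apply: smoothD; exact: smoothZ.
apply: (fsupp_compact (compactU ca cb)) => q nq.
rewrite (notin_fsupp (f := a)) ?(notin_fsupp (f := b)) ?scaler0 ?addr0//.
  by move=> h; apply: nq; right.
by move=> h; apply: nq; left.
Qed.

Lemma test_form0 : test_form (fun=> 0 : 'M[R[i]]_n).
Proof.
split; last by apply: (fsupp_compact compact0).
have s0 : smooth (cst 0 : C -> R) by exact: smooth_cst.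
move=> j k; split.
  have -> : (fun q : C => complex.Re ((0 : 'M[R[i]]_n) j k)) = cst 0.
    by apply/funext => q; rewrite mxE.
  exact: s0.
have -> : (fun q : C => complex.Im ((0 : 'M[R[i]]_n) j k)) = cst 0.
    by apply/funext => q; rewrite mxE.
exact: s0.
Qed.

Lemma test_form_conj a : test_form a -> test_form (fun q => conj_form (a q)).
Proof.
move=> [sa ca]; split.
  move=> j k; have [ra ia] := sa k j; split.
    have -> : (fun q => complex.Re (conj_form (a q) j k)) =
      - (fun q => complex.Re (a q k j)).
      apply/funext => q; rewrite mxE -[RHS]/(- complex.Re (a q k j)).
      by case: (a q k j).
    exact: smoothN.
  have -> : (fun q => complex.Im (conj_form (a q) j k)) = (fun q => complex.Im (a q k j)).
    by apply/funext => q; rewrite mxE; case: (a q k j) => x y /=; rewrite opprK.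
  exact: ia.
apply: (fsupp_compact ca) => q nq; apply/matrixP => j k.
by rewrite (notin_fsupp nq) !mxE; apply: complex_eq; rewrite /= ?opprK ?oppr0.
Qed.

Lemma test_form_scaled (u : C -> R) (A : 'M[R[i]]_n) : test_function u ->
  test_form (fun q => (u q)%:C *: A).
Proof.
move=> [su cu]; split.
  move=> j k; split.
    have -> : (fun q => complex.Re (((u q)%:C *: A) j k)) = complex.Re (A j k) *: u.
      by apply/funext => q; rewrite mxE cReM /= mul0r subr0 [LHS]mulrC.
    exact: smoothZ.
  have -> : (fun q => complex.Im (((u q)%:C *: A) j k)) = complex.Im (A j k) *: u.
    by apply/funext => q; rewrite mxE cImM /= mul0r addr0 [LHS]mulrC.
  exact: smoothZ.
by apply: (fsupp_compact cu) => q nq; rewrite (notin_fsupp nq) scale0r.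
Qed.

End TestForms.

Section Currents.
Context (R : realType) (n : nat) (T : current11 R n).
Local Notation C := (Cn R n).
Implicit Types (a b : form11 R n) (q v : C).

Lemma current0 : T (fun=> 0) = 0.
Proof.
have := current_linear T 1 (test_form0 R n) (test_form0 R n).
have -> : (fun q : C => 1 *: (0 : 'M[R[i]]_n) + 0) = (fun=> 0).
  by apply/funext => q; rewrite scaler0 addr0.
by rewrite mul1r => /eqP; rewrite eq_sym -subr_eq0 addrK => /eqP.
Qed.

Lemma currentZ (c : R[i]) a : test_form a -> T (fun q => c *: a q) = c * T a.
Proof.
move=> ta; rewrite -[RHS]addr0 -current0 -current_linear//; last exact: test_form0.
by congr (current_val T _); apply/funext => q; rewrite addr0.
Qed.

Hypothesis Tpos : positive_current T.

(** Both [b + a] and [b - a] are positive forms, so [T a] and [- T a] are nonnegative once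
    [T b = 0]. *)
Lemma current_dominated_real a b : test_form a -> test_form b ->
  (forall q v, complex.Im (phi (a q) v) = 0) ->
  (forall q v, `|complex.Re (phi (a q) v)|%:C <= phi (b q) v) -> T b = 0 -> T a = 0.
Proof.
move=> ta tb ra ab Tb.
have h1 : 0 <= T (fun q => 1 *: a q + b q).
  apply: Tpos; first exact: test_form_lin.
  move=> q v; rewrite -/(phi _ _) phiD scale1r real_ge0 cImD cReD.
  have := ab q v; rewrite lecE /= ra add0r => /andP[/eqP -> h]; rewrite eqxx /=.
  by have := ler_norm (- complex.Re (phi (a q) v)); rewrite normrN; lra.
have h2 : 0 <= T (fun q => (-1) *: a q + b q).
  apply: Tpos; first exact: test_form_lin.
  move=> q v; rewrite -/(phi _ _) phiD phiZ mulN1r real_ge0 cImD cReD.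
  have := ab q v; rewrite lecE /=; case: (phi (a q) v) (ra q v) => x y /= -> /andP[/eqP -> h].
  by rewrite oppr0 addr0 eqxx /=; have := ler_norm x; lra.
rewrite current_linear// Tb addr0 mul1r in h1.
rewrite current_linear// Tb addr0 mulN1r oppr_ge0 in h2.
by apply/eqP; rewrite eq_le h1 h2.
Qed.

(** The forms [(a + conj a) / 2] and [(a - conj a) / (2 i)] have as [phi] the real and imaginary
    parts of [phi a]. The real case applies to each, and [a = a1 + i a2]. *)
Lemma current_dominated a b (c : R) : test_form a -> test_form b ->
  (forall q v, (Normc.normc (phi (a q) v))%:C <= c%:C * phi (b q) v) -> T b = 0 -> T a = 0.
Proof.
move=> ta tb ab Tb.
pose b' := fun q : C => c%:C *: b q + 0.
have tb' : test_form b' by apply: test_form_lin => //; exact: test_form0.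
have Tb' : T b' = 0.
  have -> : b' = (fun q => c%:C *: b q) by apply/funext => q; rewrite /b' addr0.
  by rewrite currentZ// Tb mulr0.
have phib' q v : phi (b' q) v = c%:C * phi (b q) v by rewrite phiD phiZ phi0 addr0.
have ta' := test_form_conj ta.
pose a1 := fun q => (2%:R^-1 : R[i]) *: (1 *: a q + conj_form (a q)) + 0.
have ta1 : test_form a1.
  by apply: test_form_lin; [exact: test_form_lin|exact: test_form0].
pose a2 := fun q => ((2%:R : R[i])^-1 * - 'i%C) *: ((-1) *: conj_form (a q) + a q) + 0.
have ta2 : test_form a2.
  by apply: test_form_lin; [exact: test_form_lin|exact: test_form0].
have h : (2%:R : R[i])^-1 = (2^-1)%:C by rewrite fmorphV rmorph_nat.
have p1 q v : phi (a1 q) v = (complex.Re (phi (a q) v))%:C.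
  rewrite /a1 phiD phi0 addr0 phiZ phiD phiZ phi_conj h; case: (phi (a q) v) => x y.
  by apply: complex_eq => /=; field.
have p2 q v : phi (a2 q) v = (complex.Im (phi (a q) v))%:C.
  rewrite /a2 phiD phi0 addr0 phiZ phiD phiZ phi_conj h; case: (phi (a q) v) => x y.
  by apply: complex_eq => /=; field.
have T1 : T a1 = 0.
  apply: (current_dominated_real ta1 tb' _ _ Tb') => q v; rewrite p1 //= phib'.
  by apply: le_trans (ab q v); rewrite lecR normRe_le.
have T2 : T a2 = 0.
  apply: (current_dominated_real ta2 tb' _ _ Tb') => q v; rewrite p2 //= phib'.
  by apply: le_trans (ab q v); rewrite lecR normIm_le.
have -> : a = (fun q => 'i%C *: a2 q + a1 q).
  apply/funext => q; rewrite /a1 /a2 !addr0 h.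
  apply/matrixP => j k; rewrite !mxE; case: (a q j k) (a q k j) => x y [x' y'].
  by apply: complex_eq => /=; field.
apply: (etrans (current_linear T 'i%C ta2 ta1)).
by move: T1 T2; move: (T a1) (T a2) => _ _ -> ->; rewrite mulr0 addr0.
Qed.

End Currents.

(** * Squared distances, compact boxes and norms *)

Section Quadratic.
Context (R : realType) (n : nat).
Local Notation C := (Cn R n).
Implicit Types (q v : C) (c : 'rV[R]_n).

Definition xdist c q : R := rsq (q.1 - c).
Definition ydist c q : R := rsq (q.2 - c).

Let shift_smooth (f : C -> R) (k : R) : smooth f -> smooth (f - cst k).
Proof. by move=> sf; apply: smoothB => //; exact: smooth_cst. Qed.

Let shift_derive (f : C -> R) (k : R) v : smooth f -> 'D_v (f - cst k) = 'D_v f.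
Proof.
move=> sf; apply/funext => q; rewrite deriveB; last 2 first.
- exact: smooth_derivable.
- exact: derivable_cst.
by rewrite derive_cst subr0.
Qed.

Let xdistE c : xdist c = \sum_j (re_coord j - cst (c 0 j)) * (re_coord j - cst (c 0 j)).
Proof.
apply/funext => q; rewrite fct_sumE; apply: eq_bigr => j _.
by rewrite !mxE expr2.
Qed.

Let ydistE c : ydist c = \sum_j (im_coord j - cst (c 0 j)) * (im_coord j - cst (c 0 j)).
Proof.
apply/funext => q; rewrite fct_sumE; apply: eq_bigr => j _.
by rewrite !mxE expr2.
Qed.

Lemma smooth_xdist c : smooth (xdist c).
Proof.
rewrite xdistE; apply: smooth_sum => j; have h := shift_smooth (c 0 j) (@smooth_re R n j).
exact: smoothM.
Qed.

Lemma smooth_ydist c : smooth (ydist c).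
Proof.
rewrite ydistE; apply: smooth_sum => j; have h := shift_smooth (c 0 j) (@smooth_im R n j).
exact: smoothM.
Qed.

Lemma levi_xdist c q v : levi (xdist c) q v = 2 * sqnorm v.
Proof.
rewrite xdistE levi_sum; last first.
  move=> j; have h := shift_smooth (c 0 j) (@smooth_re R n j); exact: smoothM.
rewrite /sqnorm mulr_sumr; apply: eq_bigr => j _.
have E w : 'D_w (re_coord j - cst (c 0 j)) = cst (re_coord j w).
  by rewrite (shift_derive _ _ (@smooth_re R n j)) derive_re.
rewrite levi_sqr; last 2 first.
- exact/shift_smooth/smooth_re.
- by move=> w; rewrite E; eexists.
have E1 w : 'D_w (re_coord j - cst (c 0 j)) q = re_coord j w.
  exact: (congr1 (fun f => f q) (E w)).
by rewrite (E1 v) (E1 (cJ v)) /re_coord /= mxE sqrrN.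
Qed.

Lemma levi_ydist c q v : levi (ydist c) q v = 2 * sqnorm v.
Proof.
rewrite ydistE levi_sum; last first.
  move=> j; have h := shift_smooth (c 0 j) (@smooth_im R n j); exact: smoothM.
rewrite /sqnorm mulr_sumr; apply: eq_bigr => j _.
have E w : 'D_w (im_coord j - cst (c 0 j)) = cst (im_coord j w).
  by rewrite (shift_derive _ _ (@smooth_im R n j)) derive_im.
rewrite levi_sqr; last 2 first.
- exact/shift_smooth/smooth_im.
- by move=> w; rewrite E; eexists.
have E1 w : 'D_w (im_coord j - cst (c 0 j)) q = im_coord j w.
  exact: (congr1 (fun f => f q) (E w)).
by rewrite (E1 v) (E1 (cJ v)) /im_coord /= addrC.
Qed.

Lemma rsq_coord (x : 'rV[R]_n) j : x 0 j ^+ 2 <= rsq x.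
Proof.
rewrite /rsq (bigD1 j)//= lerDl; apply: sumr_ge0 => k _; exact: sqr_ge0.
Qed.

Lemma compact_rsq_ball c (A : R) : compact [set x : 'rV[R]_n | rsq (x - c) <= A].
Proof.
apply: bounded_closed_compact.
  (* [A + 1] replaces the square root of [A]: a real whose square is at most [A] has absolute value
     at most [A + 1]. *)
  exists (`|c| + (A + 1)); split; first exact: num_real.
  move=> M hM x /= hx; apply: (le_trans _ (ltW hM)).
  rewrite -[x](subrK c) addrC; apply: (le_trans (ler_normD _ _)); rewrite lerD2l.
  have A0 : 0 <= A by apply: le_trans hx; exact: rsq_ge0.
  rewrite -[leLHS]/(mx_norm (x - c)).
  have [->|/mx_norm_neq0[[i j] /= E]] := eqVneq (mx_norm (x - c)) 0.
    by rewrite addr_ge0.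
  rewrite E (ord1 i).
  have := le_trans (rsq_coord (x - c) j) hx.
  move: ((x - c) 0 j) => z; rewrite -real_normK ?num_real// => hz.
  have := normr_ge0 z; nra.
have -> : [set x | rsq (x - c) <= A] = (fun x => rsq (x - c)) @^-1` [set y | y <= A] by [].
move: (@continuous_rsq R n c) => /continuous_closedP; apply; exact: closed_le.
Qed.

Lemma compact_box c (A : R) d (B : R) :
  compact [set q : C | xdist c q <= A /\ ydist d q <= B].
Proof.
have -> : [set q : C | xdist c q <= A /\ ydist d q <= B] =
  [set x | rsq (x - c) <= A] `*` [set y | rsq (y - d) <= B] by [].
by apply: compact_setX; exact: compact_rsq_ball.
Qed.

End Quadratic.

Section Norms.
Context (R : realType) (n : nat).
Local Notation C := (Cn R n).

Lemma coord_le_norm (x : 'rV[R]_n) j : `|x 0 j| <= `|x|.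
Proof.
rewrite -[leRHS]/(mx_norm x) mx_normrE.
by apply/bigmax_geP; right; exists (0, j).
Qed.

Lemma norm_lt_coord (x : 'rV[R]_n) (e : R) : 0 < e -> (forall j, `|x 0 j| < e) -> `|x| < e.
Proof.
move=> e0 h; rewrite -[ltLHS]/(mx_norm x).
have [->//|/mx_norm_neq0[[i j] /= ->]] := eqVneq (mx_norm x) 0.
by rewrite (ord1 i).
Qed.

Lemma rsq_le_norm (x : 'rV[R]_n) : rsq x <= n%:R * `|x| ^+ 2.
Proof.
have -> : n%:R * `|x| ^+ 2 = \sum_(j < n) `|x| ^+ 2 by rewrite sumr_const card_ord mulr_natl.
apply: ler_sum => j _; rewrite -(real_normK (num_real (x 0 j))).
by rewrite ler_pXn2r ?nnegrE// coord_le_norm.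
Qed.

(** Passage from balls of the maximum norm to the Euclidean balls on which the bumps live; half of
    [e ^+ 2] leaves room for the strict inequality. *)
Lemma nbhs_dist (q : C) (U : set C) : nbhs q U ->
  exists2 d : R, 0 < d & forall p, xdist q.1 p + ydist q.2 p <= d -> U p.
Proof.
move=> /nbhs_ballP[e /= e0 he]; exists (e ^+ 2 / 2); first by rewrite divr_gt0// exprn_gt0.
move=> p hp; apply: he.
have hx : xdist q.1 p <= e ^+ 2 / 2 by have := rsq_ge0 (p.2 - q.2); rewrite -/(ydist _ _); lra.
have hy : ydist q.2 p <= e ^+ 2 / 2 by have := rsq_ge0 (p.1 - q.1); rewrite -/(xdist _ _); lra.
have aux (x : 'rV[R]_n) : rsq x <= e ^+ 2 / 2 -> `|x| < e.
  move=> hx'; apply: norm_lt_coord => // j.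
  have h1 := le_trans (rsq_coord x j) hx'.
  have e2 : 0 < e ^+ 2 by rewrite exprn_gt0.
  rewrite -(ltr_pXn2r (n := 2)) ?nnegrE ?(ltW e0)// real_normK ?num_real//; lra.
by split; rewrite -ball_normE /= distrC; apply: aux.
Qed.

End Norms.

Lemma compact_open_cover (R : realType) (V : normedModType R) (L : set V) :
  compact L -> cover_compact L.
Proof. by move=> cL; rewrite -compact_cover. Qed.

(** * Bump functions and bounds for test forms *)

Section Bumps.
Context (R : realType) (n : nat).
Local Notation C := (Cn R n).
Implicit Types (q p : C).

Definition ball_bump q (d : R) : C -> R := ramp (R := R) \o (cst d - (xdist q.1 + ydist q.2)).

Lemma bump_ge0 q d p : 0 <= ball_bump q d p.
Proof. exact: ramp_ge0. Qed.

Lemma bump_gt0 q d : 0 < d -> 0 < ball_bump q d q.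
Proof.
move=> d0; apply: ramp_gt0.
rewrite -[ltRHS]/(d - (rsq (q.1 - q.1) + rsq (q.2 - q.2))) !subrr.
have -> : rsq (0 : 'rV[R]_n) = 0 by apply: big1 => j _; rewrite mxE expr0n.
by rewrite addr0 subr0.
Qed.

Lemma smooth_bump q d : smooth (ball_bump q d).
Proof.
apply: (smooth_comp (@is_derive_ramp_family R) _ 0); apply: smoothB; first exact: smooth_cst.
by apply: smoothD; [exact: smooth_xdist|exact: smooth_ydist].
Qed.

Lemma fsupp_bump q d : fsupp (ball_bump q d) `<=` [set p | xdist q.1 p + ydist q.2 p <= d].
Proof.
apply: fsupp_sub.
  have cs : continuous (xdist q.1 + ydist q.2 : C -> R).
    by apply: smooth_continuous; apply: smoothD; [exact: smooth_xdist|exact: smooth_ydist].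
  by move: cs => /continuous_closedP/(_ [set y | y <= d]); apply; exact: closed_le.
move=> p /= /negP; rewrite -ltNge => h; apply: ramp_le0.
by rewrite -[leLHS]/(d - (xdist q.1 p + ydist q.2 p)); lra.
Qed.

Lemma test_bump q d : test_function (ball_bump q d).
Proof.
split; first exact: smooth_bump.
apply: (subclosed_compact _ (@compact_box R n q.1 d q.2 d)); first exact: fsupp_closed.
move=> p /fsupp_bump /= h.
by have := rsq_ge0 (p.2 - q.2); have := rsq_ge0 (p.1 - q.1);
   rewrite -/(xdist _ _) -/(ydist _ _); split; lra.
Qed.

Lemma test_functionD (u w : C -> R) : test_function u -> test_function w ->
  test_function (u + w).
Proof.
move=> [su cu] [sw cw]; split; first exact: smoothD.
apply: (fsupp_compact (compactU cu cw)) => q nq.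
rewrite fctE (notin_fsupp (f := u)) ?(notin_fsupp (f := w)) ?addr0//.
  by move=> h; apply: nq; right.
by move=> h; apply: nq; left.
Qed.

Lemma test_function0 : test_function (cst 0 : C -> R).
Proof.
by split; [exact: smooth_cst|apply: (fsupp_compact compact0)].
Qed.

Variable T : current11 R n.

(** Finitely many balls on which [T] vanishes cover [L]. The sum of their bumps is positive on [L],
    and linearity kills the sum term by term, so no partition of unity is involved. *)
Lemma vanishing_bump (L : set C) : compact L -> L `<=` ~` csupp T ->
  exists b : C -> R, [/\ test_function b, forall q, 0 <= b q, forall q, L q -> 0 < b q &
    T (fun q => (b q)%:C *: std_form R n) = 0].
Proof.
move=> cL LT.
have /choice[d hd] : forall q, exists d : R, L q -> 0 < d /\
    vanishes_on T [set p | xdist q.1 p + ydist q.2 p <= d].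
  move=> q; have [Lq|nLq] := pselect (L q); last by exists 0.
  have [U [oU vU] Uq] : (\bigcup_(U in [set U | open U /\ vanishes_on T U]) U) q.
    by apply: contrapT; exact: LT.
  have [d d0 hd] := nbhs_dist (open_nbhs_nbhs (conj oU Uq)).
  exists d => _; split=> // a ta ha; apply: vU => //.
  by move=> p /ha /= hp; apply: hd.
have [||D DL LD] := compact_open_cover cL (D := L)
  (f := fun q => [set p | 0 < ball_bump q (d q) p]).
- move=> q _; have /continuousP := smooth_continuous (@smooth_bump q (d q)).
  by move=> /(_ [set y | 0 < y] (@open_gt R 0)).
- by move=> q Lq; exists q => //; apply: bump_gt0; have [] := hd _ Lq.
have hl (l : seq C) : {subset l <= L} ->
    test_function (\sum_(q <- l) ball_bump q (d q)) /\
    T (fun p => ((\sum_(q <- l) ball_bump q (d q)) p)%:C *: std_form R n) = 0.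
  elim: l => [_|q l IH hl].
    rewrite big_nil; split; first exact: test_function0.
    have -> : (fun p : C => ((0 : C -> R) p)%:C *: std_form R n) = (fun=> 0).
      by apply/funext => p; rewrite scale0r.
    exact: current0.
  have [|tl Tl] := IH; first by move=> p pl; apply: hl; rewrite inE pl orbT.
  have [_ vq] := hd q (set_mem (hl q (mem_head _ _))).
  rewrite big_cons; split; first by apply: test_functionD => //; exact: test_bump.
  have -> :
    (fun p => ((ball_bump q (d q) + \sum_(q <- l) ball_bump q (d q)) p)%:C *: std_form R n) =
    (fun p => 1 *: ((ball_bump q (d q) p)%:C *: std_form R n) +
              ((\sum_(q <- l) ball_bump q (d q)) p)%:C *: std_form R n).
    by apply/funext => p; rewrite scale1r -scalerDl -rmorphD.
  rewrite current_linear; last 2 first.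
  - by apply: test_form_scaled; exact: test_bump.
  - exact: test_form_scaled.
  rewrite Tl addr0 mul1r; apply: vq.
    by apply: test_form_scaled; exact: test_bump.
  apply: (subset_trans _ (@fsupp_bump q (d q))); apply: fsupp_sub; first exact: fsupp_closed.
  by move=> p /notin_fsupp ->; rewrite scale0r.
have [tb Tb] := hl (enum_fset D) DL.
exists (\sum_(q <- enum_fset D) ball_bump q (d q)); split => //.
  by move=> p; rewrite fct_sumE; apply: sumr_ge0 => q _; exact: bump_ge0.
move=> p /LD[q Dq /= hq]; rewrite fct_sumE.
apply: (lt_le_trans hq); rewrite (big_rem q)//= lerDl.
by apply: sumr_ge0 => q' _; exact: bump_ge0.
Qed.

Lemma smooth_compact_bound (f : C -> R) (D : set C) : smooth f -> compact D ->
  (forall q, ~ D q -> f q = 0) -> exists2 b, 0 <= b & forall q, `|f q| <= b.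
Proof.
move=> sf cD f0; have [[p Dp]|De] := pselect (D !=set0); last first.
  by exists 0 => // q; rewrite f0 ?normr0// => Dq; apply: De; exists q.
have [||m _ hm] := compact_EVT_max (f := fun q => `|f q|) _ cD.
- by exists p.
- apply: continuous_subspaceT => q.
  by apply: cvg_norm; exact: smooth_continuous.
exists `|f m| => // q; have [Dq|nDq] := pselect (D q); first exact/hm/mem_set.
by rewrite f0// normr0.
Qed.

Lemma test_form_bound (a : form11 R n) : test_form a ->
  exists2 b, 0 <= b & forall q v, Normc.normc (phi (a q) v) <= b * sqnorm v.
Proof.
move=> [sa ca].
have hjk j k : exists b, forall q, Normc.normc (a q j k) <= b.
  have [sr si] := sa j k.
  have [|b1 _ h1] := smooth_compact_bound sr ca; first by move=> q /notin_fsupp ->; rewrite mxE.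
  have [|b2 _ h2] := smooth_compact_bound si ca; first by move=> q /notin_fsupp ->; rewrite mxE.
  by exists (b1 + b2) => q; apply: (le_trans (normc_le _)); apply: lerD.
have /choice[f hf] : forall p : 'I_n * 'I_n, exists b, forall q, Normc.normc (a q p.1 p.2) <= b.
  by case=> j k; exact: hjk.
pose b := \sum_p `|f p|.
exists (n%:R * n%:R * (2 * b)).
  by rewrite !mulr_ge0// sumr_ge0.
move=> q v; apply: phi_le => j k; apply: (le_trans (hf (j, k) q)).
apply: (le_trans (ler_norm _)); rewrite /b (bigD1 (j, k))//= lerDl.
by apply: sumr_ge0.
Qed.

End Bumps.

(** * The converse: the support lies over the hull *)

Section SupportInHull.
Context (R : realType) (n : nat).
Local Notation C := (Cn R n).

Theorem csupp_sub_hull (K : set 'rV[R]_n) (T : current11 R n) : compact K ->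
  positive_current T -> bounded_set (cpi @` csupp T) -> ddc_le0_on T (~` tube K) ->
  csupp T `<=` tube (convex_hull K).
Proof.
move=> cK Tpos Tbd Tddc z0 Tz0; split => //=; apply: contrapT => nHz0; move: Tz0; apply.
have [c [r [Hr rz0]]] := ball_separation (compact_convex_hull cK)
  (@convex_hull_convex R n K) nHz0.
(* Strict bounds: the closed region beyond [M1] misses the support, and [z0] has a neighbourhood
   inside. The factor [n%:R] in [M2] converts the maximum norm into the Euclidean one. *)
have [M1 hM1 z0M1] : exists2 M1, (forall q, csupp T q -> xdist c q < M1) & xdist c z0 < M1.
  have [M [_ hM]] := Tbd.
  pose M2 := n%:R * (`|M| + 1 + `|c|) ^+ 2.
  exists (Num.max M2 (xdist c z0) + 1); last by rewrite ltr_pwDr// le_max lexx orbT.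
  move=> q Tq; rewrite ltr_pwDr// le_max; apply/orP; left.
  apply: (le_trans (rsq_le_norm _)); rewrite ler_wpM2l//.
  rewrite ler_pXn2r ?nnegrE ?addr_ge0//.
  apply: (le_trans (ler_normB _ _)); rewrite lerD2r; apply: hM; last by exists q.
  by rewrite ltr_pwDr// ler_norm.
pose s : C -> R := xdist c - cst M1.
have ss : smooth s by apply: smoothB; [exact: smooth_xdist|exact: smooth_cst].
(* Both distances have [levi] equal to [2 * sqnorm v], so the factor one half leaves [sqnorm v]. The
   ramp is zero where [xdist c] is at most [M1] and grows linearly beyond; a factor above 1 lets it
   overcome [xdist c]. *)
pose rho : C -> R := xdist c + (- 2^-1) *: ydist z0.2 + cst (- r) + (- 3) *: (ramp (R := R) \o s).
have sramp (w : C -> R) : smooth w -> smooth (ramp (R := R) \o w).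
  by move=> sw; exact: (smooth_comp (@is_derive_ramp_family R) sw 0).
have srho : smooth rho.
  apply: smoothD; last by apply: smoothZ; exact: sramp.
  apply: smoothD; last exact: smooth_cst.
  by apply: smoothD; [exact: smooth_xdist|apply: smoothZ; exact: smooth_ydist].
have rhoE q : rho q = xdist c q - ydist z0.2 q / 2 - r - 3 * ramp (s q).
  rewrite -[LHS]/(xdist c q + (- 2^-1) * ydist z0.2 q + - r + (- 3) * ramp (s q)).
  ring.
have xg0 q : 0 <= xdist c q by exact: rsq_ge0.
have yg0 q : 0 <= ydist z0.2 q by exact: rsq_ge0.
have rho_le q : rho q <= xdist c q - r.
  by rewrite rhoE; have := yg0 q; have := ramp_ge0 (s q); lra.
have crho := smooth_continuous srho.
pose D := [set q | 0 <= rho q].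
have clD : closed D.
  by move: crho => /continuous_closedP/(_ [set y | 0 <= y]); apply; exact: closed_ge.
have cD : compact D.
  (* By [ramp_ge], [rho <= 3 * M1 + 3 - r - 2 * xdist - ydist / 2]; the two sizes of the box are
     read off this. *)
  apply: (subclosed_compact clD
    (@compact_box R n c ((3 * M1 + 3 - r) / 2) z0.2 (2 * (3 * M1 + 3 - r)))).
  move=> q; rewrite /D /= rhoE.
  have := ramp_ge (s q); rewrite -[s q]/(xdist c q - M1).
  by have := xg0 q; have := yg0 q; split; lra.
pose u : C -> R := ramp (R := R) \o rho.
have su : smooth u by exact: sramp.
have u0 q : ~ D q -> u q = 0.
  by move=> /negP; rewrite -ltNge => h; apply: ramp_le0; exact: ltW.
have fu : fsupp u `<=` D by apply: fsupp_sub.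
have tu : test_function u by split => //; exact: (fsupp_compact cD).
have tddc := test_form_ddc tu.
have Tu : T (ddc u) <= 0.
  apply: Tddc => //; first by move=> q; exact: ramp_ge0.
  move=> q /fu Dq [/= Kq _].
  have := Hr _ (sub_convex_hull Kq); have := rho_le q.
  by move: Dq; rewrite /D /= /xdist; lra.
have levi_u q v : levi u q v = ramp_family 2 (rho q) * ('D_v rho q ^+ 2 + 'D_(cJ v) rho q ^+ 2)
    + ramp_family 1 (rho q) * levi rho q v.
  exact: (levi_comp q v (@is_derive_ramp_family R 0) (@is_derive_ramp_family R 1) srho).
have levi_rho q v : xdist c q <= M1 -> levi rho q v = sqnorm v.
  move=> qM; rewrite leviD; last 2 first.
  - apply: smoothD; last exact: smooth_cst.
    by apply: smoothD; [exact: smooth_xdist|apply: smoothZ; exact: smooth_ydist].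
  - by apply: smoothZ; exact: sramp.
  rewrite leviZ; last exact: sramp.
  rewrite (levi_comp q v (@is_derive_ramp_family R 0) (@is_derive_ramp_family R 1) ss).
  have sq : s q <= 0 by rewrite -[s q]/(xdist c q - M1) subr_le0.
  have E k : ramp_family k.+1 (s q) = 0 by exact: flat_le0.
  rewrite (E 0) (E 1) !mul0r addr0 mulr0 addr0.
  rewrite leviD; last 2 first.
  - by apply: smoothD; [exact: smooth_xdist|apply: smoothZ; exact: smooth_ydist].
  - exact: smooth_cst.
  rewrite levi_cst addr0 leviD; last 2 first.
  - exact: smooth_xdist.
  - by apply: smoothZ; exact: smooth_ydist.
  rewrite leviZ; last exact: smooth_ydist.
  by rewrite levi_xdist levi_ydist; field.
have levi_ge q v : xdist c q <= M1 -> ramp_family 1 (rho q) * sqnorm v <= levi u q v.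
  move=> qM; rewrite levi_u levi_rho// lerDr mulr_ge0 ?ramp2_ge0//.
  by apply: addr_ge0; exact: sqr_ge0.
(* [levi u] can be negative only on this compact set, which misses the support of [T]. *)
pose L := D `&` [set q | M1 <= xdist c q].
have cL : compact L.
  apply: compact_closedI => //.
  have := smooth_continuous (@smooth_xdist R n c).
  by move=> /continuous_closedP/(_ [set y | M1 <= y]); apply; exact: closed_ge.
have LT : L `<=` ~` csupp T by move=> q [_ /= h] /hM1; rewrite ltNge h.
have [b [tb b0 bL Tb]] := vanishing_bump cL LT.
have [k k0 hk] := test_form_bound tddc.
have [m m0 hm] : exists2 m, 0 < m & forall q, L q -> m <= b q.
  have [[q Lq]|Le] := pselect (L !=set0); last first.
    by exists 1 => // q Lq; exfalso; apply: Le; exists q.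
  have [||p /set_mem Lp hp] := compact_EVT_min (f := b) _ cL.
  - by exists q.
  - by apply: continuous_subspaceT; case: tb => /smooth_continuous.
  by exists (b p); [exact: bL|move=> q' Lq'; exact/hp/mem_set].
pose B := fun q : C => (b q)%:C *: std_form R n.
have tB : test_form B by exact: test_form_scaled.
(* [- levi u] is at most [k * sqnorm v] and the bump is at least [m] on [L], so the multiple [k / m]
   restores positivity there. As [T B = 0], still [T S <= 0], and positivity of [S] forces
   [T S = 0]. *)
pose S := fun q : C => (k / m)%:C *: B q + ddc u q.
have tS : test_form S by exact: test_form_lin.
have phiS q v : phi (S q) v = (k / m * b q * sqnorm v + levi u q v)%:C.
  rewrite phiD phiZ [phi (B q) v]phiZ phi_std phi_ddc//.
  by apply: complex_eq => /=; ring.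
have km0 q v : 0 <= k / m * b q * sqnorm v.
  apply: mulr_ge0; last exact: sqnorm_ge0.
  by apply: mulr_ge0 => //; rewrite divr_ge0// ltW.
have S0 q v : 0 <= k / m * b q * sqnorm v + levi u q v.
  have [qM|qM] := lerP (xdist c q) M1.
    rewrite addr_ge0//; apply: le_trans (levi_ge q v qM).
    by rewrite mulr_ge0 ?sqnorm_ge0 ?ramp1_ge0.
  have hq := hk q v; rewrite phi_ddc// in hq.
  have hle : - levi u q v <= k * sqnorm v.
    apply: le_trans hq; apply: le_trans (normRe_le _).
    by rewrite -[complex.Re _]/(levi u q v) -normrN ler_norm.
  have [Dq|nDq] := pselect (D q).
    have Lq : L q by split => //=; exact: ltW.
    have : k * sqnorm v <= k / m * b q * sqnorm v.
      rewrite ler_wpM2r ?sqnorm_ge0// -mulrA ler_peMr//.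
      by rewrite ler_pdivlMl// mulr1 hm.
    lra.
  have nfu : ~ fsupp u q by move=> /fu.
  have -> : levi u q v = 0.
    by apply: complexI; rewrite -phi_ddc// (fsupp_ddc su nfu) phi0.
  by rewrite addr0.
have TS : T S = 0.
  have : T S <= 0 by rewrite current_linear// Tb mulr0 add0r.
  have : 0 <= T S.
    by apply: Tpos => // q v; rewrite -/(phi _ _) phiS ler0c.
  by move=> h1 h2; apply/eqP; rewrite eq_le h1 h2.
have rho_z0 : 0 < rho z0.
  rewrite rhoE ramp_le0; last by rewrite -[s z0]/(xdist c z0 - M1) subr_le0 ltW.
  have -> : ydist z0.2 z0 = 0.
    by rewrite /ydist subrr; apply: big1 => j _; rewrite mxE expr0n.
  by move: rz0; rewrite -/(xdist c z0); lra.
(* Half the value at [z0], so that a whole neighbourhood of [z0] has [levi u >= kap * sqnorm v]. *)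
pose kap := ramp_family 1 (rho z0) / 2.
have kap0 : 0 < kap by rewrite divr_gt0// ramp1_gt0.
have sr1 : smooth (ramp_family (R := R) 1 \o rho).
  exact: (smooth_comp (@is_derive_ramp_family R) srho 1).
exists ([set q | xdist c q < M1] `&` [set q | kap < ramp_family 1 (rho q)]); last first.
  split; first exact: z0M1.
  have h := ramp1_gt0 rho_z0.
  suff : kap < ramp_family 1 (rho z0) by [].
  by rewrite /kap; lra.
split.
  apply: openI.
    have /continuousP := smooth_continuous (@smooth_xdist R n c).
    by move=> /(_ [set y | y < M1] (@open_lt R M1)).
  have /continuousP := smooth_continuous sr1.
  by move=> /(_ [set y | kap < y] (@open_gt R kap)).
move=> a ta ha; have [l l0 hl] := test_form_bound ta.
(* On the support of [a], [|phi a| <= l * sqnorm v], which is at most [l / kap] times [phi S]. *)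
apply: (current_dominated Tpos (c := l / kap) ta tS _ TS) => q v.
rewrite phiS -rmorphM lecR.
have lk : 0 <= l / kap by rewrite divr_ge0// ltW.
have [aq|naq] := pselect (fsupp a q); last first.
  rewrite (notin_fsupp naq) phi0 normc_ReIm /= expr0n/= addr0 sqrtr0.
  by rewrite mulr_ge0.
have [/= qM qk] := ha _ aq.
apply: (le_trans (hl q v)).
apply: (@le_trans _ _ (l / kap * (kap * sqnorm v))).
  by rewrite mulrA divfK// gt_eqF.
rewrite ler_wpM2l//; apply: (@le_trans _ _ (levi u q v)); last by rewrite lerDr.
apply: le_trans (levi_ge q v (ltW qM)).
by rewrite ler_wpM2r ?sqnorm_ge0// ltW.
Qed.

End SupportInHull.

(** * Existence: admissible functions and the extended functional *)

Section AdmissibleFunctions.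
Context (R : realType) (n : nat).
Local Notation C := (Cn R n).
Variables (K : set 'rV[R]_n) (z0 : C).
Hypothesis cK : compact K.
Hypothesis Kz0 : convex_hull K z0.1.

Definition quadratic (a b c : R) : C -> R := cst a + b *: xdist 0 + c *: ydist 0.

(** The constants will fix the total mass of the measure, and the two squared norms will supply the
    majorant of [weight]. *)
Definition admissible (u : C -> R) : Prop :=
  exists f a b c, test_function f /\ u = f + quadratic a b c.

Lemma smooth_quadratic a b c : smooth (quadratic a b c).
Proof.
apply: smoothD; last by apply: smoothZ; exact: smooth_ydist.
by apply: smoothD; [exact: smooth_cst|apply: smoothZ; exact: smooth_xdist].
Qed.

Lemma quadraticE a b c q : quadratic a b c q = a + b * xdist 0 q + c * ydist 0 q.
Proof. by []. Qed.

Lemma levi_quadratic a b c q v : levi (quadratic a b c) q v = (2 * b + 2 * c) * sqnorm v.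
Proof.
have sx := @smooth_xdist R n 0; have sy := @smooth_ydist R n 0.
rewrite leviD; last 2 first.
- by apply: smoothD; [exact: smooth_cst|exact: smoothZ].
- exact: smoothZ.
rewrite leviD; last 2 first.
- exact: smooth_cst.
- exact: smoothZ.
rewrite levi_cst add0r leviZ// leviZ// levi_xdist levi_ydist; ring.
Qed.

Lemma admissible_smooth u : admissible u -> smooth u.
Proof.
by move=> [f [a [b [c [[sf _] ->]]]]]; apply: smoothD => //; exact: smooth_quadratic.
Qed.

Lemma test_function_admissible u : test_function u -> admissible u.
Proof.
move=> tu; exists u, 0, 0, 0; split => //.
by apply/funext => q; rewrite fctE quadraticE !mul0r !addr0.
Qed.

Lemma quadratic_admissible a b c : admissible (quadratic a b c).
Proof.
exists (cst 0), a, b, c; split; first exact: test_function0.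
by apply/funext => q; rewrite fctE add0r.
Qed.

Lemma test_functionZ (k : R) (f : C -> R) : test_function f -> test_function (k *: f).
Proof.
move=> [sf cf]; split; first exact: smoothZ.
by apply: (fsupp_compact cf) => q nq; rewrite fctE (notin_fsupp nq) scaler0.
Qed.

Lemma subspace_admissible : subspace_set (admissible : set (C -> R)).
Proof.
split; first by apply: test_function_admissible; exact: test_function0.
move=> k u w [f [a [b [c [tf ->]]]]] [f' [a' [b' [c' [tf' ->]]]]].
exists (k *: f + f'), (k * a + a'), (k * b + b'), (k * c + c'); split.
  by apply: test_functionD => //; exact: test_functionZ.
apply/funext => q; rewrite -[LHS]/(k * (f q + quadratic a b c q) + (f' q + quadratic a' b' c' q)).
by rewrite -[RHS]/(k * f q + f' q + quadratic _ _ _ q) !quadraticE; ring.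
Qed.

Lemma test_function_bound (f : C -> R) : test_function f ->
  exists2 M, 0 <= M & forall q, `|f q| <= M.
Proof. by move=> [sf cf]; apply: (smooth_compact_bound sf cf) => q /notin_fsupp. Qed.

Lemma hull_bound : exists2 M, 0 <= M & forall q : C, convex_hull K q.1 -> xdist 0 q <= M.
Proof.
have [M M0 hM] := compact_rsq_bound 0 (compact_convex_hull cK).
by exists M => // q; exact: hM.
Qed.

Lemma hull_neq0 : K !=set0.
Proof.
apply: contrapT => Ke; have : @set0 'rV[R]_n z0.1; last by [].
apply: Kz0; split; last by move=> x Kx; exfalso; apply: Ke; exists x.
by apply/convex_setP.
Qed.

(* The growth in the imaginary directions is killed by the sign condition on
   the tube, so the three lines argument applies along complex lines joining
   two points of the hull. *)
Lemma admissible_max u : admissible u ->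
  (forall q v : C, convex_hull K q.1 -> 0 <= levi u q v) ->
  (forall q : C, K q.1 -> u q <= 0) -> u z0 <= 0.
Proof.
move=> au hlevi hK; have su := admissible_smooth au.
case: au => f [a [b [c [tf uE]]]].
have ueq q : u q = f q + (a + b * xdist 0 q + c * ydist 0 q) by rewrite uE.
have [N N0 hN] := test_function_bound tf.
have [M M0 hM] := hull_bound.
(* Otherwise [u] would tend to infinity along [t *: y] over a point of [K]. The product is used
   instead of [c <= 0], which can fail when [n = 0]. *)
have cy (y : 'rV[R]_n) : c * rsq y <= 0.
  rewrite leNgt; apply/negP => cy0.
  have [k Kk] := hull_neq0.
  pose Q := N + `|a| + `|b| * rsq k.
  have Q0 : 0 <= Q by rewrite !addr_ge0// mulr_ge0// rsq_ge0.
  (* [Q] bounds all the other terms of [u] at [(k, t *: y)], and this [t] makes [t * (c * rsq y)],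
     hence also the quadratic term, exceed [Q]. *)
  pose t := 1 + Q / (c * rsq y).
  have t1 : 1 <= t by rewrite lerDl divr_ge0// ltW.
  have tt : t <= t ^+ 2 by rewrite expr2 ler_peMl// (le_trans _ t1).
  have ht : Q < t * (c * rsq y).
    by rewrite mulrDl mul1r divfK ?gt_eqF// ltrDr.
  have := hK (k, t *: y) Kk; rewrite ueq.
  have -> : xdist 0 ((k, t *: y) : C) = rsq k by rewrite /xdist subr0.
  have -> : ydist 0 ((k, t *: y) : C) = t ^+ 2 * rsq y.
    rewrite /ydist subr0 /rsq mulr_sumr; apply: eq_bigr => j _; rewrite mxE; ring.
  have h1 : - N <= f (k, t *: y).
    by have := hN (k, t *: y); rewrite ler_norml => /andP[].
  have h2 : - `|a| <= a by rewrite lerNl -normrN ler_norm.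
  have h3 : - (`|b| * rsq k) <= b * rsq k.
    rewrite -mulNr ler_wpM2r ?rsq_ge0//.
    by rewrite lerNl -normrN ler_norm.
  have h4 : t * (c * rsq y) <= t ^+ 2 * (c * rsq y) by rewrite ler_wpM2r// ltW.
  have h5 : c * (t ^+ 2 * rsq y) = t ^+ 2 * (c * rsq y) by ring.
  rewrite h5; rewrite /Q in ht; lra.
(* The whole fibre over [x] is required to be good, because the three lines argument needs the sign
   on entire boundary lines; then [P] is convex and contains [K]. *)
pose P := [set x | convex_hull K x /\ forall y, u (x, y) <= 0].
suff : convex_hull K `<=` P.
  by move=> /(_ _ Kz0)[_ /(_ z0.2)]; case: z0.
apply: convex_hull_min; last first.
  by move=> x Kx; split; [exact: sub_convex_hull|move=> y; exact: hK].
apply/convex_setP => x1 x2 t t01 [hx1 ux1] [hx2 ux2].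
have /convex_setP cvx := @convex_hull_convex R n K.
have seg s : x2 + s *: (x1 - x2) = s *: x1 + (1 - s) *: x2.
  by apply/rowP => j; rewrite !mxE; ring.
split; first exact: cvx.
move=> y; rewrite -seg.
have -> : y = y + 0 *: (x1 - x2) by rewrite scale0r addr0.
apply: (@three_lines R n u x2 y (x1 - x2) (N + `|a| + `|b| * M) su) => //.
- by move=> s r s01; apply: hlevi; rewrite /= seg; exact: cvx.
- by move=> r; rewrite scale0r addr0; exact: ux2.
- by move=> r; rewrite scale1r addrC subrK; exact: ux1.
- move=> s r s01; rewrite ueq.
  have hx : convex_hull K (x2 + s *: (x1 - x2)) by rewrite seg; exact: cvx.
  set w : C := (_, _).
  have h1 : f w <= N by apply: le_trans (ler_norm _) (hN w).
  have h2 : a <= `|a| by exact: ler_norm.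
  have h3 : b * xdist 0 w <= `|b| * M.
    apply: (le_trans (ler_norm _)); rewrite normrM ler_wpM2l//.
    rewrite ger0_norm; last exact: rsq_ge0.
    exact: hM.
  have h4 : c * ydist 0 w <= 0 by exact: cy.
  lra.
Qed.

Local Notation test_space := (((C * C) + C)%type).

(* A function on the sum type is a pair: a density in (q, v), on which the
   current acts, and a function on C^n, to be integrated against the measure. *)
Definition hull_domain : set test_space := fun s =>
  match s with inl p => convex_hull K p.1.1 | inr w => K w.1 end.

Definition weight (s : test_space) : R :=
  match s with inl p => sqnorm p.2 | inr w => 1 + rsq w.2 end.

Definition sum_fun (f : C -> C -> R) (g : C -> R) (s : test_space) : R :=
  match s with inl p => f p.1 p.2 | inr w => g w end.

(** The minus sign encodes the equation in the form [T (ddc u) - mu u = - u z0]. *)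
Definition levi_pair (u : C -> R) : test_space -> R := sum_fun (levi u) (- u).

Lemma levi_pair_dominated u : admissible u -> weight_dominated hull_domain weight (levi_pair u).
Proof.
move=> [f [a [b [c [tf ->]]]]].
have [N N0 hN] := test_function_bound tf; have [M M0 hM] := hull_bound.
have [k k0 hk] := test_form_bound (test_form_ddc tf).
have sf : smooth f by case: tf.
have sq := smooth_quadratic a b c.
exists (k + 2 * `|b| + 2 * `|c| + (N + `|a| + `|b| * M + `|c|)).
  by rewrite !addr_ge0// !mulr_ge0.
have bM : 0 <= `|b| * M by rewrite mulr_ge0.
case=> [[q v]|w] /= hs.
  rewrite leviD// levi_quadratic.
  have s0 := sqnorm_ge0 v.
  have h1 : `|levi f q v| <= k * sqnorm v.
    have := hk q v; rewrite phi_ddc//; apply: le_trans.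
    exact: (normRe_le (levi f q v)%:C).
  have h2 : `|(2 * b + 2 * c) * sqnorm v| <= (2 * `|b| + 2 * `|c|) * sqnorm v.
    rewrite normrM (ger0_norm s0) ler_wpM2r//.
    by apply: (le_trans (ler_normD _ _)); rewrite !normrM (ger0_norm (ler0n R 2)).
  apply: (le_trans (ler_normD _ _)); apply: (le_trans (lerD h1 h2)).
  rewrite -mulrDl ler_wpM2r//.
  have := normr_ge0 a; have := normr_ge0 c; lra.
rewrite -[X in `|X|]/(- (f w + (a + b * xdist 0 w + c * rsq (w.2 - 0)))) normrN subr0.
have y0 := rsq_ge0 w.2.
have x1 : xdist 0 w <= M by apply: hM; exact: sub_convex_hull.
have x0 : 0 <= xdist 0 w by exact: rsq_ge0.
have h1 := hN w.
have h2 : `|b * xdist 0 w| <= `|b| * M.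
  by rewrite normrM (ger0_norm x0) ler_wpM2l.
have h3 : `|c * rsq w.2| = `|c| * rsq w.2 by rewrite normrM (ger0_norm y0).
apply: (le_trans (ler_normD _ _)).
apply: (le_trans (lerD h1 (ler_normD _ _))).
apply: (@le_trans _ _ (N + (`|a| + `|b| * M + `|c| * rsq w.2))).
  rewrite lerD2l h3 lerD2r; apply: (le_trans (ler_normD _ _)).
  by rewrite lerD2l.
have := normr_ge0 a; have := normr_ge0 b; have := normr_ge0 c => c0 b0 a0.
have e1 : 0 <= `|c| * rsq w.2 by rewrite mulr_ge0.
have e2 : 0 <= (k + 2 * `|b| + 2 * `|c| + (N + `|a| + `|b| * M)) * rsq w.2.
  by apply: mulr_ge0 => //; lra.
lra.
Qed.

(** [admissible_max] is exactly the positivity of [u |-> - u z0] that the extension theorem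
    demands. *)
Lemma levi_pair_extension : exists L : (test_space -> R) -> R,
  [/\ linear_on (weight_dominated hull_domain weight) L,
      forall f, weight_dominated hull_domain weight f -> (forall s, hull_domain s -> 0 <= f s) ->
        0 <= L f &
      forall u, admissible u -> L (levi_pair u) = - u z0].
Proof.
have [] := @positive_extension R test_space (C -> R) hull_domain weight admissible levi_pair
  (fun u => - u z0) subspace_admissible.
- move=> a u w [[q v]|z] /admissible_smooth su /admissible_smooth sw _ /=.
    rewrite leviD//; last exact: smoothZ.
    by rewrite leviZ.
  by rewrite !fctE -[_ *: _]/(_ * _); ring.
- by move=> a u w _ _ /=; rewrite !fctE -[_ *: _]/(_ * _); ring.
- move=> u au h; rewrite oppr_ge0; apply: admissible_max => //.
    by move=> q v hq; exact: (h (inl (q, v)) hq).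
  by move=> q hq; have := h (inr q) hq; rewrite /= fctE oppr_ge0.
- have [M M0 hM] := hull_bound.
  (* The majorant: [levi] is [(4 - 2) * sqnorm v], and on the tube
     [- u = 1 + 2 * M - 2 |x|^2 + |y|^2] is at least [1 + |y|^2], since [|x|^2 <= M] there. *)
  exists (quadratic (- (1 + 2 * M)) 2 (-1)); first exact: quadratic_admissible.
  case=> [[q v]|w] /= hs.
    by rewrite levi_quadratic; have := sqnorm_ge0 v; lra.
  rewrite -[leRHS]/(- (- (1 + 2 * M) + 2 * xdist 0 w + (-1) * rsq (w.2 - 0))) subr0.
  by have := hM w (sub_convex_hull hs); lra.
move=> L [Ll Lp Lu]; exists L; split => // u au; apply: Lu => //.
exact: levi_pair_dominated.
Qed.

End AdmissibleFunctions.

(** * Existence: the current and the measure read off the functional *)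

Section JensenCurrent.
Context (R : realType) (n : nat).
Local Notation C := (Cn R n).
Variables (K : set 'rV[R]_n) (z0 : C).
Hypothesis cK : compact K.
Hypothesis Kz0 : convex_hull K z0.1.
Local Notation test_space := (((C * C) + C)%type).
Local Notation dom := (weight_dominated (@hull_domain R n K) (@weight R n)).
Variable L : (test_space -> R) -> R.
Hypothesis Llin : linear_on dom L.
Hypothesis Lpos : forall f, dom f -> (forall s, hull_domain K s -> 0 <= f s) -> 0 <= L f.
Hypothesis Llevi : forall u, admissible u -> L (levi_pair u) = - u z0.

Let zero : C -> R := fun=> 0.
Let fzero : C -> C -> R := fun _ _ => 0.

Let dom0 : dom 0. Proof. by have [] := subspace_dominated (@hull_domain R n K) (@weight R n). Qed.
Let dom_lin a f g : dom f -> dom g -> dom (a *: f + g).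
Proof. by have [_] := subspace_dominated (@hull_domain R n K) (@weight R n); apply. Qed.
Let domZ a f : dom f -> dom (a *: f).
Proof. by move=> df; rewrite -[_ *: f]addr0; exact: dom_lin. Qed.

Let L0 : L 0 = 0.
Proof. by have := Llin 1 dom0 dom0; rewrite scale1r addr0; lra. Qed.
Let LZ a f : dom f -> L (a *: f) = a * L f.
Proof. by move=> df; rewrite -[_ *: f]addr0 Llin// L0 addr0. Qed.
Let LD f g : dom f -> dom g -> L (f + g) = L f + L g.
Proof. by move=> df dg; rewrite -[f in LHS]scale1r Llin// mul1r. Qed.
Let Lle f g : dom f -> dom g -> (forall s, hull_domain K s -> f s <= g s) -> L f <= L g.
Proof.
move=> df dg fg; have dN : dom ((-1) *: f) by exact: domZ.
have : 0 <= L ((-1) *: f + g).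
  apply: Lpos; first exact: dom_lin.
  by move=> s Ss; rewrite !fctE scaleN1r addrC subr_ge0 fg.
by rewrite Llin// mulN1r addrC subr_ge0.
Qed.

(** Twice [L mass_fun] bounds the mass; the factor 2 comes from estimating real and imaginary parts
    separately. *)
Let mass_fun : test_space -> R := sum_fun (fun _ v => sqnorm v) zero.
Let dom_mass : dom mass_fun.
Proof.
exists 1 => // -[[q v]|w] _ /=; first by rewrite ger0_norm ?mul1r// sqnorm_ge0.
by rewrite normr0 mul1r addr_ge0// rsq_ge0.
Qed.

Let form_part (f : C -> C -> R) : test_space -> R := sum_fun f zero.

Let dom_form f b : (forall q v : C, convex_hull K q.1 -> `|f q v| <= b * sqnorm v) ->
  dom (form_part f).
Proof.
move=> hf; exists `|b| => // -[[q v]|w] hs /=.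
  by apply: (le_trans (hf q v hs)); rewrite ler_wpM2r ?sqnorm_ge0// ler_norm.
by rewrite normr0 mulr_ge0// addr_ge0// rsq_ge0.
Qed.

Let L_form_le f b : (forall q v : C, convex_hull K q.1 -> `|f q v| <= b * sqnorm v) ->
  `|L (form_part f)| <= b * L mass_fun.
Proof.
move=> hf; have df := dom_form hf.
have dm := domZ b dom_mass.
rewrite ler_norml; apply/andP; split.
  have dN : dom ((- 1) *: form_part f) by exact: domZ.
  have : L ((-1) *: form_part f) <= L (b *: mass_fun).
    apply: Lle => // -[[q v]|w] hs; rewrite !fctE /=.
      rewrite scaleN1r; apply: le_trans (hf q v hs); by rewrite -normrN ler_norm.
    by rewrite !scaler0.
  by rewrite !LZ// mulN1r lerNl.
rewrite -LZ//; apply: Lle => // -[[q v]|w] hs; rewrite !fctE /=.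
  by apply: le_trans (hf q v hs); rewrite ler_norm.
by rewrite scaler0.
Qed.

Definition current_fun (a : form11 R n) : R[i] :=
  L (form_part (fun q v => complex.Re (phi (a q) v))) +i*
  L (form_part (fun q v => complex.Im (phi (a q) v))).

Let re_le (a : form11 R n) b :
  (forall q v : C, convex_hull K q.1 -> Normc.normc (phi (a q) v) <= b * sqnorm v) ->
  forall q v : C, convex_hull K q.1 -> `|complex.Re (phi (a q) v)| <= b * sqnorm v.
Proof. by move=> h q v hq; apply: le_trans (h q v hq); exact: normRe_le. Qed.
Let im_le (a : form11 R n) b :
  (forall q v : C, convex_hull K q.1 -> Normc.normc (phi (a q) v) <= b * sqnorm v) ->
  forall q v : C, convex_hull K q.1 -> `|complex.Im (phi (a q) v)| <= b * sqnorm v.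
Proof. by move=> h q v hq; apply: le_trans (h q v hq); exact: normIm_le. Qed.

Let current_fun_le (a : form11 R n) b :
  (forall q v : C, convex_hull K q.1 -> Normc.normc (phi (a q) v) <= b * sqnorm v) ->
  Normc.normc (current_fun a) <= 2 * b * L mass_fun.
Proof.
move=> h; apply: (le_trans (normc_le _)).
have h1 := L_form_le (re_le h); have h2 := L_form_le (im_le h).
by have := lerD h1 h2; rewrite -mulrA mulr2n mulrDl mul1r.
Qed.

Let dom_re a : test_form a -> dom (form_part (fun q v => complex.Re (phi (a q) v))).
Proof. by move=> /test_form_bound[b _ hb]; apply: (dom_form (b := b)); apply: re_le. Qed.
Let dom_im a : test_form a -> dom (form_part (fun q v => complex.Im (phi (a q) v))).
Proof. by move=> /test_form_bound[b _ hb]; apply: (dom_form (b := b)); apply: im_le. Qed.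

Lemma current_fun_linear (c : R[i]) (a b : form11 R n) : test_form a -> test_form b ->
  current_fun (fun q => c *: a q + b q) = c * current_fun a + current_fun b.
Proof.
move=> ta tb; have ra := dom_re ta; have ia := dom_im ta.
have rb := dom_re tb; have ib := dom_im tb.
apply: complex_eq; rewrite ?cReD ?cImD ?cReM ?cImM [LHS]/=.
  have -> : form_part (fun q v => complex.Re (phi (c *: a q + b q) v)) =
    complex.Re c *: form_part (fun q v => complex.Re (phi (a q) v)) +
    ((- complex.Im c) *: form_part (fun q v => complex.Im (phi (a q) v)) +
     form_part (fun q v => complex.Re (phi (b q) v))).
    apply/funext => -[[q v]|w]; rewrite !fctE /=; last by rewrite !scaler0 !addr0.
    by rewrite phiD phiZ cReD cReM scaleNr -addrA.
  by rewrite !Llin//=; [ring|exact: dom_lin].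
have -> : form_part (fun q v => complex.Im (phi (c *: a q + b q) v)) =
  complex.Re c *: form_part (fun q v => complex.Im (phi (a q) v)) +
  (complex.Im c *: form_part (fun q v => complex.Re (phi (a q) v)) +
   form_part (fun q v => complex.Im (phi (b q) v))).
  apply/funext => -[[q v]|w]; rewrite !fctE /=; last by rewrite !scaler0 !addr0.
  by rewrite phiD phiZ cImD cImM -addrA.
by rewrite !Llin//=; [ring|exact: dom_lin].
Qed.

(** The current has order zero, with a constant that does not depend on the compact set. *)
Lemma current_fun_continuous (D : set C) : compact D -> exists (N : nat) (M : R),
  forall (a : form11 R n) (b : R), test_form a -> fsupp a `<=` D -> coef_bound N a b ->
    Normc.normc (current_fun a) <= M * b.
Proof.
move=> _; exists 0%N, (2 * (n%:R * n%:R * 2) * L mass_fun) => a b _ _ hb.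
have -> : 2 * (n%:R * n%:R * 2) * L mass_fun * b = 2 * (n%:R * n%:R * (2 * b)) * L mass_fun.
  by ring.
apply: current_fun_le => q v _; apply: phi_le => j k.
by have := hb [::] j k q isT; apply.
Qed.

Definition jensen_current : current11 R n :=
  Current11 current_fun_linear current_fun_continuous.

Lemma jensen_current_positive : positive_current jensen_current.
Proof.
move=> a ta pa; rewrite real_ge0 /=.
have -> : form_part (fun q v => complex.Im (phi (a q) v)) = 0.
  apply/funext => -[[q v]|w] //=.
  by have := pa q v; rewrite real_ge0 => /andP[/eqP].
rewrite L0 eqxx /=; apply: Lpos; first exact: dom_re.
by move=> [[q v]|w] _ //=; have := pa q v; rewrite real_ge0 => /andP[].
Qed.

Lemma jensen_current_mass : finite_mass jensen_current.
Proof.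
apply: (@le_lt_trans _ _ (2 * L mass_fun)%:E); last exact: ltry.
apply: ge_ereal_sup => _ [a [ta ha ->]]; rewrite lee_fin.
have := @current_fun_le a 1; rewrite mulr1; apply => q v _.
by rewrite mul1r; exact: phi_comass.
Qed.

Lemma jensen_current_supp : csupp jensen_current `<=` tube (convex_hull K).
Proof.
move=> q Tq; split => //=; apply: contrapT => nq; apply: Tq.
exists (~` tube (convex_hull K)); last by case.
have clH : closed (convex_hull K).
  by apply: compact_closed; [exact: norm_hausdorff|exact: compact_convex_hull].
split.
  apply: closed_openC.
  have -> : tube (convex_hull K) = fst @^-1` convex_hull K :> set C.
    by apply/seteqP; split => [p []|p].
  have cf : continuous (fst : C -> 'rV[R]_n) by move=> p; exact: cvg_fst.
  by move: cf => /continuous_closedP; apply.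
(* [a] vanishes over the hull, so the bound [b = 0] is allowed in [current_fun_le]. *)
move=> a ta ha; have : Normc.normc (jensen_current a) <= 2 * 0 * L mass_fun.
  apply: current_fun_le => p v hp; have -> : a p = 0.
    by apply: notin_fsupp => /ha; apply.
  by rewrite phi0 mul0r normc_ReIm/= expr0n/= addr0 sqrtr0.
rewrite mulr0 mul0r => h; apply: Normc.eq0_normc; apply/eqP; rewrite eq_le h.
by rewrite andTb normc_ReIm sqrtr_ge0.
Qed.

Let measure_part (g : C -> R) : test_space -> R := sum_fun fzero g.

Let dom_measure g (b : R) : (forall w, K w.1 -> `|g w| <= b * (1 + rsq w.2)) ->
  dom (measure_part g).
Proof.
move=> hg; exists `|b| => // -[[q v]|w] hs /=.
  by rewrite normr0 mulr_ge0// sqnorm_ge0.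
apply: (le_trans (hg w hs)); rewrite ler_wpM2r ?ler_norm//.
by rewrite addr_ge0// rsq_ge0.
Qed.

Let dom_bounded g : bounded_function g -> dom (measure_part g).
Proof.
move=> [M hM]; apply: (dom_measure (b := `|M|)) => w _.
apply: (le_trans (hM w)); apply: (le_trans (ler_norm M)).
by rewrite ler_peMr// lerDl rsq_ge0.
Qed.

Let measure_fun (g : C -> R) : R := L (measure_part g).

Let measure_fun_lin : linear_on (@bounded_function R C) measure_fun.
Proof.
move=> a f g bf bg; rewrite /measure_fun -Llin; [|exact: dom_bounded|exact: dom_bounded].
congr L; apply/funext => -[[q v]|w] //=.
by rewrite !fctE /= scaler0 addr0.
Qed.

Let L_split (f : C -> C -> R) (g : C -> R) : dom (form_part f) -> dom (measure_part g) ->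
  L (sum_fun f g) = L (form_part f) + measure_fun g.
Proof.
move=> df dg; rewrite /measure_fun -LD//; congr L.
by apply/funext => -[[q v]|w]; rewrite fctE /= ?addr0 ?add0r.
Qed.

(** The constant [-1] has zero [levi], so its pair is the function 1 on the measure side alone. *)
Let measure_fun1 : measure_fun (fun=> 1) = 1.
Proof.
have h := Llevi (@quadratic_admissible R n (- 1) 0 0).
have E : - quadratic (- 1) 0 0 z0 = 1 by rewrite quadraticE !mul0r !addr0 opprK.
rewrite E in h; rewrite -[RHS]h; congr L; apply/funext => -[[q v]|w].
  by rewrite -[RHS]/(levi (quadratic (- 1) 0 0) q v) levi_quadratic !mulr0 addr0 mul0r.
by rewrite -[RHS]/(- quadratic (- 1) 0 0 w) quadraticE !mul0r !addr0 opprK.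
Qed.

(** Chebyshev's inequality: on the tube, outside the box, [|y|^2 > r], so the indicator is at most
    [|y|^2 / r]; the choice of [r] makes the second moment [Y] at most [e * r]. *)
Let measure_fun_tight (e : R) : 0 < e ->
  exists2 D : set C, compact D & measure_fun \1_(~` D) <= e.
Proof.
move=> e0; have [M M0 hM] := hull_bound cK.
pose Y := measure_fun (ydist 0).
have dY : dom (measure_part (ydist 0)).
  apply: (dom_measure (b := 1)) => w _; rewrite mul1r -[ydist 0 w]/(rsq (w.2 - 0)) subr0.
  by rewrite ger0_norm ?rsq_ge0// lerDr.
pose r := `|Y| / e + 1.
have r0 : 0 < r by rewrite ltr_wpDl// divr_ge0// ltW.
exists [set q | xdist 0 q <= M /\ ydist 0 q <= r]; first exact: compact_box.
have d1 : dom (measure_part \1_(~` [set q : C | xdist 0 q <= M /\ ydist 0 q <= r])).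
  by apply: dom_bounded; exists 1 => x; rewrite indicE ger0_norm ?ler0n// lern1 leq_b1.
have dYr := domZ r^-1 dY.
apply: (@le_trans _ _ (L (r^-1 *: measure_part (ydist 0)))).
  apply: Lle => // -[[q v]|w] hs; rewrite fctE /=; first by rewrite scaler0.
  have y0 : 0 <= ydist 0 w by exact: rsq_ge0.
  rewrite indicE; case: (boolP (w \in _)) => [/set_mem hw|_]; last first.
    by rewrite mulr_ge0// invr_ge0 ltW.
  rewrite -[leRHS]/(r^-1 * ydist 0 w) mulrC ler_pdivlMr// mul1r leNgt.
  apply/negP => hlt; apply: hw; split; last exact: ltW.
  by apply: hM; exact: sub_convex_hull.
rewrite LZ// mulrC ler_pdivrMr// -[L _]/Y /r mulrDr mulr1 mulrCA divff ?gt_eqF// mulr1.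
by have := ler_norm Y; lra.
Qed.

Lemma jensen_measure : exists mu : probability (borel_Cn R n) R,
  mu (tube K) = 1%E /\ ddc_eq_dirac jensen_current mu z0.
Proof.
have [|mu [mu0 muE]] := functional_representation measure_fun_lin _ measure_fun1
  measure_fun_tight.
  move=> f bf f0; apply: Lpos; first exact: dom_bounded.
  by move=> [[q v]|w] _ //=.
exists mu; split.
  have clK : closed (tube K : set C).
    have -> : tube K = fst @^-1` K :> set C.
      by apply/seteqP; split => [p []|p].
    have cf : continuous (fst : C -> 'rV[R]_n) by move=> p; exact: cvg_fst.
    move: cf => /continuous_closedP; apply.
    by apply: compact_closed => //; exact: norm_hausdorff.
  have oK := closed_openC clK.
  have mK : measurable (~` tube K : set (borel_Cn R n)) by exact: sub_sigma_algebra.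
  (* [L] sees functions only on [hull_domain], whose second half is the tube, where this indicator
     is zero. *)
  have := mu0 _ oK; have -> : measure_fun \1_(~` tube K) = 0.
    have d1 : dom (measure_part \1_(~` tube K)).
      by apply: dom_bounded; exists 1 => x; rewrite indicE ger0_norm ?ler0n// lern1 leq_b1.
    apply/eqP; rewrite eq_le; apply/andP; split.
      rewrite -[leRHS]L0; apply: Lle => // -[[q v]|w] hs //=.
      by rewrite indicE; case: (boolP (w \in _)) => // /set_mem; case; split.
    rewrite -[leLHS]L0; apply: Lle => // -[[q v]|w] hs; first exact: lexx.
    by rewrite -[leRHS]/((\1_(~` tube K) : C -> R) w) indicE ler0n.
  move=> /(_ erefl) muK; rewrite -(setCK (tube K)) probability_setC// muK.
  by rewrite sube0.
move=> u tu; have au := test_function_admissible tu.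
have su : smooth u by case: tu.
have E1 : form_part (fun q v => complex.Im (phi (ddc u q) v)) = 0.
  by apply/funext => -[[q v]|w] //=; rewrite phi_ddc.
have E2 : form_part (fun q v => complex.Re (phi (ddc u q) v)) = form_part (levi u).
  by apply/funext => -[[q v]|w] //=; rewrite phi_ddc.
have dl : dom (form_part (levi u)) by rewrite -E2; apply/dom_re/test_form_ddc.
have [M M0 hM] := test_function_bound tu.
have bu : bounded_function u by exists M.
have bNu : bounded_function (- u) by exists M => q; rewrite fctE normrN.
have h := Llevi au; rewrite /levi_pair L_split// in h; last exact: dom_bounded.
have hN : measure_fun (- u) = - measure_fun u.
  have b0 : bounded_function (0 : C -> R) by exists 0 => q; rewrite normr0.
  have m0 : measure_fun 0 = 0.
    by have := measure_fun_lin 1 b0 b0; rewrite scale1r addr0; lra.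
  by rewrite -scaleN1r -[_ *: u]addr0 measure_fun_lin// m0 addr0 mulN1r.
rewrite -[LHS]/(L _ +i* L _) E1 E2 L0; apply: complex_eq => //=.
by rewrite -muE//; [rewrite hN in h; lra|exact: smooth_continuous].
Qed.

End JensenCurrent.

Theorem jensen_current_exists (R : realType) (n : nat) (K : set 'rV[R]_n) (z0 : Cn R n) :
  compact K -> convex_hull K (cpi z0) ->
  exists T : current11 R n,
    [/\ positive_current T, finite_mass T, csupp T `<=` tube (convex_hull K) &
        exists mu : probability (borel_Cn R n) R,
          mu (tube K) = 1%E /\ ddc_eq_dirac T mu z0].
Proof.
move=> cK Kz0; have [L [Llin Lpos Llevi]] := levi_pair_extension cK Kz0.
exists (jensen_current Llin Lpos); split.
- exact: jensen_current_positive.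
- exact: jensen_current_mass.
- exact: jensen_current_supp.
- exact: jensen_measure.
Qed.

Theorem theorem7p2 (R : realType) (n : nat) (K : set 'rV[R]_n)
    (K_connected : connected K) (K_compact : compact K) :
  (forall z0 : Cn R n, convex_hull K (cpi z0) ->
     exists T : current11 R n,
       [/\ positive_current T,
           finite_mass T,
           csupp T `<=` tube (convex_hull K) &
           exists mu : probability (borel_Cn R n) R,
             mu (tube K) = 1%E /\ ddc_eq_dirac T mu z0])
  /\
  (forall T : current11 R n,
     positive_current T ->
     finite_mass T ->
     bounded_set (cpi @` csupp T) ->
     ddc_le0_on T (~` tube K) ->
     csupp T `<=` tube (convex_hull K)).
Proof.
split; first by move=> z0; exact: jensen_current_exists.
by move=> T Tpos _ Tbd Tddc; exact: csupp_sub_hull.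
Qed.
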